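(* Let $1<q<\infty$ and $1<p<\infty$. There is a constant $c$, independent of $w$ and $f$, such that for every $w\in A_p$ and every sequence of functions $f=\{f_j\}_{j=1}^\infty$ on $\mathbb{R}^n$, $$\|\overline M_q f\|_{L^p(w)}\le c\,[w]_{A_p}^{\max\{\frac1q,\frac1{p-1}\}}\,\|\overline f_q\|_{L^p(w)},$$ and this inequality is sharp: the exponent $\max\{\frac1q,\frac1{p-1}\}$ cannot be replaced by any smaller number in an estimate valid for all $w\in A_p$ and all $f$ with a constant independent of $w$ and $f$.
   Context: $Mf(x)=\sup_{Q\ni x}\frac1{|Q|}\int_Q|f(y)|\,dy$ is the Hardy–Littlewood maximal operator on $\mathbb{R}^n$ (supremum over cubes containing $x$ with sides parallel to the axes). For $f=\{f_j\}_{j=1}^\infty$, $$\overline M_q f(x)=\Big(\sum_{j=1}^\infty (Mf_j(x))^q\Big)^{1/q},\qquad \overline f_q(x)=\Big(\sum_{j=1}^\infty|f_j(x)|^q\Big)^{1/q}.$$ A weight is a non-negative locally integrable function $w$ on $\mathbb{R}^n$. For $1<p<\infty$, $p'$ is defined by $1/p+1/p'=1$, and $w\in A_p$ means $$[w]_{A_p}:=\sup_{Q}\left(\frac1{|Q|}\int_Q w\right)\left(\frac1{|Q|}\int_Q w^{1-p'}\right)^{p-1}<\infty,$$ the supremum being over all cubes. $\|g\|_{L^p(w)}=(\int|g|^p w\,dx)^{1/p}$. *)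

(* Defs.v *)
From HB Require Import structures.
From mathcomp Require Import all_boot all_order all_algebra.
From mathcomp Require Import all_classical all_reals all_analysis.
Import Order.TTheory GRing.Theory Num.Theory.
Import numFieldNormedType.Exports.

Set Implicit Arguments.
Unset Strict Implicit.
Unset Printing Implicit Defensive.

Local Open Scope classical_set_scope.
Local Open Scope ring_scope.
Local Open Scope ereal_scope.

Section cons_measure.
Context {d} {T : measurableType d} {R : realType} {n : nat}.
Variable m1 : {sigma_finite_measure set T -> \bar R}.
Variable m2 : {sigma_finite_measure set (n.-tuple T) -> \bar R}.

Definition cons_pair (z : T * n.-tuple T) : n.+1.-tuple T :=
  [tuple of z.1 :: z.2].

Lemma measurable_cons_pair : measurable_fun [set: T * n.-tuple T] cons_pair.
Proof. exact: measurable_cons. Qed.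

Definition cons_measure (A : set (n.+1.-tuple T)) : \bar R :=
  (m1 \x m2) (cons_pair @^-1` A).

Let cons_measure0 : cons_measure set0 = 0.
Proof. by rewrite /cons_measure preimage_set0 measure0. Qed.

Let cons_measure_ge0 A : 0 <= cons_measure A.
Proof. exact: measure_ge0. Qed.

Let measurable_cons_preimage A :
  measurable A -> measurable (cons_pair @^-1` A).
Proof.
by move=> mA; rewrite -[X in measurable X]setTI; exact: measurable_cons_pair.
Qed.

Let cons_measure_semi_sigma_additive : semi_sigma_additive cons_measure.
Proof.
move=> F mF tF mUF; rewrite /cons_measure preimage_bigcup.
apply: measure_semi_sigma_additive.
- by move=> k; exact: measurable_cons_preimage.
- apply/trivIsetP => i j _ _ ij; rewrite -preimage_setI.
  by move/trivIsetP : tF => /(_ _ _ _ _ ij) ->//; rewrite preimage_set0.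
- by rewrite -preimage_bigcup; exact: measurable_cons_preimage.
Qed.

HB.instance Definition _ := isMeasure.Build _ _ _ cons_measure
  cons_measure0 cons_measure_ge0 cons_measure_semi_sigma_additive.

Let cons_measure_sigma_finite : sigma_finite setT cons_measure.
Proof.
have /sigma_finiteP[F [TF ndF Foo]] := sigma_finiteT m1.
have /sigma_finiteP[G [TG ndG Goo]] := sigma_finiteT m2.
pose uncons (t : n.+1.-tuple T) : T * n.-tuple T :=
  (thead t, [tuple of behead t]).
have unconsK : cancel cons_pair uncons.
  by move=> [x t]; congr pair; exact/val_inj.
have muncons : measurable_fun setT uncons.
  apply/measurable_fun_pair; first exact: measurable_tnth.
  exact: measurable_behead.
exists (fun k => uncons @^-1` (F k `*` G k)).
  apply/seteqP; split=> // t _.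
  have [i _ Fi] : (\bigcup_i F i) (thead t) by rewrite -TF.
  have [j _ Gj] : (\bigcup_i G i) [tuple of behead t] by rewrite -TG.
  exists (maxn i j) => //; split => /=.
    by move: (thead t) Fi; exact/subsetPset/ndF/leq_maxl.
  by move: [tuple of behead t] Gj; exact/subsetPset/ndG/leq_maxr.
move=> k; have [mF Fk] := Foo k; have [mG Gk] := Goo k; split.
  rewrite -[X in measurable X]setTI; apply: muncons => //.
  exact: measurableX.
rewrite /cons_measure (_ : _ @^-1` _ = F k `*` G k); last first.
  by rewrite -comp_preimage (_ : _ \o _ = id) ?preimage_id//; exact/funext.
by rewrite product_measure1E// lte_mul_pinfty// ge0_fin_numE.
Qed.

HB.instance Definition _ := Measure_isSigmaFinite.Build _ _ _ cons_measure
  cons_measure_sigma_finite.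

End cons_measure.

Fixpoint power_measure {d} {T : measurableType d} {R : realType}
    (m : {sigma_finite_measure set T -> \bar R}) (n : nat) :
    {sigma_finite_measure set (n.-tuple T) -> \bar R} :=
  if n is k.+1 then cons_measure m (power_measure m k)
  else @dirac _ (0.-tuple T) [tuple] R.

Section lebesgue_Rn.
Variables (R : realType) (n : nat).

Definition borel_lebesgue :
    {sigma_finite_measure set (n.-tuple (measurableTypeR R)) -> \bar R} :=
  power_measure (@lebesgue_measure R) n.

(* R^n with its Lebesgue (i.e., completed Borel) sigma-algebra. *)
Definition Rn : measurableType _ := caratheodory_type (mu_ext borel_lebesgue).

Definition lebesgue_Rn : {measure set Rn -> \bar R} :=
  @completed_measure_extension _ _ _ borel_lebesgue.

Definition coordinate (x : Rn) (i : 'I_n) : R :=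
  tnth (x : n.-tuple (measurableTypeR R)) i.

End lebesgue_Rn.

Section weighted_maximal.
Context {R : realType} {n : nat}.
Local Notation mu := (lebesgue_Rn R n).
Implicit Types (f : Rn R n -> R) (g : Rn R n -> \bar R) (w : Rn R n -> R).

Definition cube (a : Rn R n) (l : R) : set (Rn R n) :=
  [set x | forall i, (coordinate a i <= coordinate x i <= coordinate a i + l)%R].

Definition cubes : set (set (Rn R n)) :=
  [set Q | exists a l, (0 < l)%R /\ Q = cube a l].

Definition average g (Q : set (Rn R n)) : \bar R :=
  (mu Q)^-1 * \int[mu]_(y in Q) g y.

Definition cube_maximal f (x : Rn R n) : \bar R :=
  ereal_sup [set average (fun y => `|f y|%:E) Q
            | Q in cubes `&` [set Q | Q x]].

Definition vmaximal (q : R) (f : (Rn R n -> R)^nat) (x : Rn R n) : \bar R :=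
  (\sum_(j <oo) cube_maximal (f j) x `^ q) `^ q^-1.

Definition vnorm (q : R) (f : (Rn R n -> R)^nat) (x : Rn R n) : \bar R :=
  (\sum_(j <oo) `|f j x|%:E `^ q) `^ q^-1.

(* Every compact subset of R^n lies in a cube. *)
Definition weight w : Prop :=
  [/\ measurable_fun [set: Rn R n] w,
      forall x, (0 <= w x)%R &
      forall Q, cubes Q -> \int[mu]_(x in Q) (w x)%:E < +oo].

(* [dual_weight p w] is w^(1 - p'), written as (w^-1)^(p' - 1) because
   0 ^ (1 - p') is meant to be +oo (as is 0^-1 in \bar R), whereas
   [0 `^ r = 0] in the library for r < 0. *)
Definition dual_weight (p : R) w (x : Rn R n) : \bar R :=
  ((w x)%:E)^-1 `^ (fine (hoelder_conjugate p%:E) - 1).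

Definition Ap_const (p : R) w : \bar R :=
  ereal_sup [set average (EFin \o w) Q *
                 average (dual_weight p w) Q `^ (p - 1) | Q in cubes].

Definition Ap (p : R) w : Prop := weight w /\ Ap_const p w < +oo.

Definition wLnorm (p : R) w g : \bar R :=
  (\int[mu]_x (`|g x| `^ p * (w x)%:E)) `^ p^-1.

End weighted_maximal.

(* Main.v *)
Require Import Defs.
From mathcomp Require Import all_boot all_order all_algebra.
From mathcomp Require Import all_classical all_reals all_analysis.
From mathcomp Require Import measurable_realfun ring lra zify.
Import Order.TTheory GRing.Theory Num.Theory.
Import numFieldNormedType.Exports.

(** Upper bound. A cube near the origin lies in a cell of comparable size of one
    of 2^n shifted dyadic grids (the one-third trick). Cutting each grid down to
    finitely many leaves, and letting the mesh tend to 0 by Fatou's lemma,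
    replaces R^n by a finite set X with nested partitions, on which the f_j and
    F = |f|_q are averaged over the leaves. Call a cell principal when the
    averages of f over the cells between it and the preceding principal cell
    violate sum_j (max avg f_j)^q <= A (avg F)^q. A stopping time and Doob's
    inequality show that at least half of a principal cell lies in no smaller
    principal cell, whereas by construction
      sum_j (M f_j)^q <= A sum_{P principal} (avg_P F)^q.
    For s = min(q, p - 1) the right-hand side is at most
    A (sum_P (avg_P F)^s)^(q/s), and duality together with Doob's inequality
    for the measures w and sigma = w^(1-p') bounds sum_P (avg_P F)^s in
    L^(p/s)(w) by a multiple of [w]_Ap |F|_{L^p(w)}^s. Since
    1/s = max(1/q, 1/(p-1)), this is the claim.

    Sharpness. Let v be 1/|x_1| truncated between 1 and 2^m, an A_1 weight with
    constant O(m). The exponent 1/q is forced by the weight v and the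
    indicators of the shells 2^-(j+1) < x_1 <= 2^-j of the unit cube, the
    exponent 1/(p-1) by the weight v^(1-p) and the single function v. *)

Set Implicit Arguments.
Unset Strict Implicit.
Unset Printing Implicit Defensive.

Local Open Scope classical_set_scope.
Local Open Scope ring_scope.

(** * Inequalities for real powers *)

(** The exponent s obeys two constraints. It must be at most q so that the sparse sum of q-th powers
    is controlled by the one of s-th powers. It must be at most p - 1 so that, with S and W the
    averages of sigma and w over a cell, S^s W = (W S^(p-1)) S^(-(p-1-s)) uses the A_p constant once
    and leaves a nonpositive power of S. That power is compared with sigma at points where sigma <=
    4 S. The p-th power of the norm then carries [w]^(p/s). Several estimates bound a quantity by a
    part of itself and absorb that part. This is legitimate because all sums over X are finite, one
    reason for the discretisation. Averaging over leaves destroys the relation between w and sigma: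
    only 1 <= w sigma^(p-1) survives. The discrete theorem therefore treats w and sigma as two
    functions and has F^p sigma^(1-p) on the right; Hoelder's inequality on each leaf turns this
    back into the integral of F^p w. The maximal function is only ever compared with measurable
    functions, so its own measurability is never established. *)

Section power_inequalities.
Variable R : realType.
Implicit Types (p q r a b x y X C D : R).

Lemma young_powR p a b : 1 < p -> 0 <= a -> 0 <= b ->
  a * b <= a `^ p / p + b `^ (p / (p - 1)) * (1 - p^-1).
Proof.
move=> p1 a0 b0; have p0 : 0 < p by lra.
have p10 : 0 < p - 1 by lra.
have q0 : 0 < p / (p - 1) by rewrite divr_gt0.
rewrite (_ : 1 - p^-1 = (p / (p - 1))^-1); last by field; apply/andP; split; lra.
by apply: conjugate_powR => //; field; apply/andP; split; lra.
Qed.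

(* Young's inequality with the weight [t] for which the second sum is absorbed
   by the left-hand side. *)
Lemma young_absorb (I : finType) (a b : I -> R) p C D X : 1 < p ->
  (forall i, 0 <= a i) -> (forall i, 0 <= b i) -> 0 <= C -> 0 < D ->
  X <= C * \sum_i a i * b i -> \sum_i b i `^ (p / (p - 1)) <= D * X ->
  X <= C `^ p * D `^ (p - 1) * \sum_i a i `^ p.
Proof.
move=> p1 a0 b0 C0 D0 XC bD.
have p0 : 0 < p by lra.
have p10 : p - 1 != 0 by lra.
have pN0 : p != 0 by lra.
pose t := D `^ ((p - 1) / p).
have t0 : 0 < t by rewrite powR_gt0.
have : X <= (C * t) `^ p / p * (\sum_i a i `^ p) +
            (t^-1 `^ (p / (p - 1))) * (1 - p^-1) * (D * X).
  apply: (le_trans XC).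
  apply: (@le_trans _ _ (\sum_i ((C * t) `^ p / p * a i `^ p +
     (t^-1 `^ (p / (p - 1))) * (1 - p^-1) * b i `^ (p / (p - 1))))).
    rewrite mulr_sumr; apply: ler_sum => i _.
    have := @young_powR p (C * t * a i) (t^-1 * b i) p1.
    have -> : C * t * a i * (t^-1 * b i) = C * (a i * b i) by field; lra.
    move=> /(_ _ _) H.
    apply: le_trans (H _ _) _.
    - by rewrite !mulr_ge0// ltW.
    - by rewrite mulr_ge0// invr_ge0 ltW.
    rewrite [X in X / p]powRM//; last by rewrite mulr_ge0// ltW.
    rewrite [X in _ + X * _]powRM// ?invr_ge0 ?(ltW t0)//.
    by rewrite le_eqVlt; apply/orP; left; apply/eqP; ring.
  rewrite big_split/= -!mulr_sumr lerD2l ler_wpM2l//.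
  by rewrite mulr_ge0 ?powR_ge0// subr_ge0 invf_le1//; lra.
have -> : t^-1 `^ (p / (p - 1)) = D^-1.
  rewrite -[D^-1]powR_inv1 ?(ltW D0)// -[t^-1]powR_inv1 ?(ltW t0)// /t -!powRrM.
  by congr (_ `^ _); field; apply/andP; split.
have -> : D^-1 * (1 - p^-1) * (D * X) = (1 - p^-1) * X by field; apply/andP; split; lra.
have -> : (C * t) `^ p = C `^ p * D `^ (p - 1).
  rewrite powRM//; last exact: ltW.
  by rewrite /t -powRrM -mulrA mulVf// mulr1.
set S := \sum_i _; set E := C `^ p * _.
move=> H; have : X / p <= E / p * S by lra.
by rewrite mulrAC ler_pM2r// invr_gt0.
Qed.

(** A and B are any upper bounds for the two norms, since callers know majorants such as F and not
    the norms. Once the cases A = 0 and B = 0 are settled, division by A and B reduces the claim to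
    Young's inequality. *)
Lemma hoelder_le (I : finType) (a b : I -> R) p A B : 1 < p ->
  (forall i, 0 <= a i) -> (forall i, 0 <= b i) -> 0 <= A -> 0 <= B ->
  \sum_i a i `^ p <= A `^ p -> \sum_i b i `^ (p / (p - 1)) <= B `^ (p / (p - 1)) ->
  \sum_i a i * b i <= A * B.
Proof.
move=> p1 a0 b0 A0 B0 aA bB.
have p0 : 0 < p by lra.
have q0 : 0 < p / (p - 1) by rewrite divr_gt0//; lra.
have sum0 (c : I -> R) s : 0 < s -> \sum_i c i `^ s <= 0 -> forall i, c i = 0.
  move=> s0 le0 i.
  have /eqP : \sum_i c i `^ s = 0.
    by apply/eqP; rewrite eq_le le0/=; apply: sumr_ge0 => *; exact: powR_ge0.
  rewrite psumr_eq0; last by move=> *; exact: powR_ge0.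
  move=> /allP /(_ i (mem_index_enum _)) /= /eqP; exact: powR_eq0_eq0.
have [A_eq0|A_neq0] := eqVneq A 0.
  rewrite A_eq0 mul0r big1// => i _; rewrite (sum0 _ _ p0) ?mul0r//.
  by rewrite (le_trans aA)// A_eq0 powR0//; lra.
have [B_eq0|B_neq0] := eqVneq B 0.
  rewrite B_eq0 mulr0 big1// => i _; rewrite (sum0 b _ q0) ?mulr0//.
  by rewrite (le_trans bB)// B_eq0 powR0//; lra.
have Agt0 : 0 < A by lra.
have Bgt0 : 0 < B by lra.
suff : \sum_i (a i / A) * (b i / B) <= 1.
  have -> : \sum_i a i / A * (b i / B) = (\sum_i a i * b i) / (A * B).
    by rewrite mulr_suml; apply: eq_bigr => i _; field; apply/andP; split.
  by rewrite ler_pdivrMr ?mulr_gt0// mul1r.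
apply: (@le_trans _ _ (\sum_i (a i `^ p / A `^ p / p +
   b i `^ (p / (p - 1)) / B `^ (p / (p - 1)) * (1 - p^-1)))).
  apply: ler_sum => i _; apply: le_trans (young_powR p1 _ _) _.
  - by rewrite divr_ge0.
  - by rewrite divr_ge0.
  rewrite !powRM ?invr_ge0//.
  by rewrite -[A^-1]powR_inv1// -[B^-1]powR_inv1// -!powRrM !mulN1r !powRN.
rewrite big_split/= -!mulr_suml.
have h1 : (\sum_i a i `^ p) / A `^ p <= 1.
  by rewrite ler_pdivrMr ?mul1r// powR_gt0.
have h2 : (\sum_i b i `^ (p / (p - 1))) / B `^ (p / (p - 1)) <= 1.
  by rewrite ler_pdivrMr ?mul1r// powR_gt0.
have ip0 : 0 < p^-1 by rewrite invr_gt0.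
have ip1 : p^-1 < 1 by rewrite invf_lt1.
nra.
Qed.

(* With b = |(B_j)|_q, the numbers (B_j / b)^(q-1) form the dual sequence. *)
Lemma minkowski_dual (J : finType) (B : J -> R) q b : 1 < q ->
  (forall j, 0 <= B j) -> 0 <= b ->
  (forall (v : J -> R) V, (forall j, 0 <= v j) -> 0 <= V ->
     \sum_j v j `^ (q / (q - 1)) <= V `^ (q / (q - 1)) ->
     \sum_j B j * v j <= b * V) ->
  \sum_j B j `^ q <= b `^ q.
Proof.
move=> q1 B0 b0 H; set S := \sum_j _.
have S0 : 0 <= S by apply: sumr_ge0 => *; exact: powR_ge0.
have [->|Sn0] := eqVneq S 0; first exact: powR_ge0.
have Sgt0 : 0 < S by lra.
have q10 : q - 1 != 0 by lra.
have qn0 : q != 0 by lra.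
have := H (fun j => B j `^ (q - 1)) (S `^ ((q - 1) / q)).
have -> : \sum_j B j * B j `^ (q - 1) = S.
  by apply: eq_bigr => j _; rewrite mulr_powRB1//; lra.
have -> : \sum_j (B j `^ (q - 1)) `^ (q / (q - 1)) = S.
  by apply: eq_bigr => j _; rewrite -powRrM mulrCA divff// mulr1.
have -> : (S `^ ((q - 1) / q)) `^ (q / (q - 1)) = S.
  rewrite -powRrM (_ : _ * _ = 1) ?powRr1//; field; exact/andP.
move=> /(_ (fun=> powR_ge0 _ _) (powR_ge0 _ _) (lexx _)) SbS.
have : S `^ q^-1 <= b.
  rewrite -(@ler_pM2r _ (S `^ ((q - 1) / q))) ?powR_gt0//.
  rewrite -powRD; last by rewrite (gt_eqF Sgt0) implybT.
  by rewrite (_ : _ + _ = 1) ?powRr1//; field.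
move=> /(ge0_ler_powR (ltW (lt_trans ltr01 q1)))H1.
have := H1 (powR_ge0 _ _) b0.
by rewrite -powRrM mulVf// powRr1.
Qed.

(** Pairing with a dual sequence v reduces the claim to Hoelder's inequality for each i, summed over
    i. *)
Lemma minkowski_sum (I J : finType) (P : pred I) (f : J -> I -> R) (F : I -> R) q :
  1 < q -> (forall j i, 0 <= f j i) -> (forall i, 0 <= F i) ->
  (forall i, \sum_j f j i `^ q <= F i `^ q) ->
  \sum_j (\sum_(i | P i) f j i) `^ q <= (\sum_(i | P i) F i) `^ q.
Proof.
move=> q1 f0 F0 fF.
apply: minkowski_dual => //.
- by move=> j; apply: sumr_ge0.
- exact: sumr_ge0.
move=> v V v0 V0 vV; under eq_bigr do rewrite mulr_suml.
rewrite exchange_big/= mulr_suml; apply: ler_sum => i _.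
exact: (hoelder_le q1).
Qed.

Lemma powR_max_le a b q : 0 <= q -> 0 <= a -> 0 <= b ->
  (Num.max a b) `^ q <= a `^ q + b `^ q.
Proof. by move=> q0 a0 b0; rewrite maxEle; case: ifP => _; rewrite ?lerDr ?lerDl powR_ge0. Qed.

(** Write a^t as a times a^(t-1); the second factor grows when a is replaced by a + b. *)
Lemma powR_superadd a b t : 1 <= t -> 0 <= a -> 0 <= b ->
  a `^ t + b `^ t <= (a + b) `^ t.
Proof.
move=> t1 a0 b0; have t0 : 0 < t by lra.
rewrite -[a `^ t]mulr_powRB1// -[b `^ t]mulr_powRB1// -[leRHS]mulr_powRB1 ?addr_ge0//.
rewrite mulrDl lerD// ler_wpM2l//; apply: ge0_ler_powR; rewrite ?nnegrE ?subr_ge0 ?lerDl ?lerDr ?addr_ge0 //.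
Qed.

(** With t = q / s this trades the exponent q for s in the sparse sum. *)
Lemma sum_powR_le (I : finType) (P : pred I) (a : I -> R) t : 1 <= t ->
  (forall i, 0 <= a i) -> \sum_(i | P i) a i `^ t <= (\sum_(i | P i) a i) `^ t.
Proof.
move=> t1 a0.
suff : 0 <= \sum_(i | P i) a i /\ \sum_(i | P i) a i `^ t <= (\sum_(i | P i) a i) `^ t.
  by case.
apply: (big_ind2 (fun x y : R => 0 <= y /\ x <= y `^ t)).
- by split => //; exact: powR_ge0.
- move=> x1 y1 x2 y2 [y10 h1] [y20 h2]; split; first exact: addr_ge0.
  by apply: le_trans (powR_superadd _ _ _) => //; exact: lerD.
- by [].
Qed.

(* The discrete chain rule behind Doob's inequality; a case of Young's
   inequality for y and x^(p-1). *)
Lemma powR_increment p x y : 1 < p -> 0 <= x -> 0 <= y ->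
  y `^ p - x `^ p <= p / (p - 1) * (y * (y `^ (p - 1) - x `^ (p - 1))).
Proof.
move=> p1 x0 y0.
have := young_powR p1 y0 (powR_ge0 x (p - 1)).
have p10 : p - 1 != 0 by lra.
rewrite -powRrM mulrCA divff// mulr1 [y * (_ - _)]mulrBr mulr_powRB1//; last lra.
set u := y `^ p; set v := x `^ p; set w := y * _ => H.
have p1p : 0 < p - 1 by lra.
rewrite -(ler_pM2r p1p).
have -> : p / (p - 1) * (u - w) * (p - 1) = p * (u - w) by field.
have pp : 0 < p by lra.
have : p * w <= p * (u / p + v * (1 - p^-1)) by rewrite ler_pM2l.
have -> : p * (u / p + v * (1 - p^-1)) = u + v * (p - 1) by field; lra.
lra.
Qed.

End power_inequalities.

(** * Sparse domination on a finite filtered space *)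

Section averages.
Variables (R : realType) (X : finType) (T : eqType) (c : nat -> X -> T).
Implicit Types (k : nat) (f g nu : X -> R).

(** The cells of generation k are the fibres of [c k], and adapted means measurable with respect to
    them. The target is any type, so that stopping conditions and levels can be adapted as well. *)
Definition adapted (U : Type) k (g : X -> U) :=
  forall x y, c k x = c k y -> g x = g y.

(** Conditional expectation of f given generation k, for the measure with point masses nu. *)
Definition wavg nu k f x : R :=
  (\sum_(y | c k y == c k x) f y * nu y) / (\sum_(y | c k y == c k x) nu y).

Lemma adapted_wavg nu k f : adapted k (wavg nu k f).
Proof. by move=> x y exy; rewrite /wavg exy. Qed.

Lemma wavg_ge0 nu k f x : (forall y, 0 <= nu y) -> (forall y, 0 <= f y) ->
  0 <= wavg nu k f x.
Proof.
by move=> nu0 f0; apply: divr_ge0; apply: sumr_ge0 => y _ //; exact: mulr_ge0.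
Qed.

Lemma cell_mass_gt0 nu k x : (forall y, 0 < nu y) ->
  0 < \sum_(y | c k y == c k x) nu y.
Proof.
move=> nu0; rewrite (bigD1 x)//= ltr_pwDl//.
by apply: sumr_ge0 => y _; exact: ltW.
Qed.

(** Conditional expectation is self-adjoint and fixes adapted functions: exchange the two sums and
    use that g and the cell mass are constant on cells. *)
Lemma wavg_proj nu k f g : (forall y, 0 < nu y) -> adapted k g ->
  \sum_x nu x * wavg nu k f x * g x = \sum_x nu x * f x * g x.
Proof.
move=> nu0 gk; rewrite /wavg.
pose W x := \sum_(y | c k y == c k x) nu y.
have W0 x : W x != 0 by rewrite gt_eqF// cell_mass_gt0.
transitivity (\sum_x \sum_(y | c k y == c k x) nu x * (f y * nu y / W x) * g x).
  by apply: eq_bigr => x _; rewrite -mulr_suml -mulr_sumr -mulr_suml.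
rewrite (exchange_big_dep predT)//=; apply: eq_bigr => y _.
transitivity (\sum_(x | c k x == c k y) nu x * (f y * nu y / W y * g y)).
  apply: eq_big => [x|x /eqP e]; first by rewrite eq_sym.
  by rewrite (gk _ _ e) /W e -[LHS]mulrA.
by rewrite -mulr_suml -/(W y); field; exact: W0.
Qed.

End averages.

(** * Doob's maximal inequality *)

Section doob.
Variables (R : realType) (X : finType) (T : eqType) (c : nat -> X -> T).
Hypothesis c_nested : forall k x y, c k.+1 x = c k.+1 y -> c k x = c k y.
Implicit Types (k : nat) (f g nu : X -> R).

Lemma adaptedS (U : Type) k (g : X -> U) : adapted c k g -> adapted c k.+1 g.
Proof. by move=> gk x y /c_nested; exact: gk. Qed.

Lemma adapted_leq (U : Type) k l (g : X -> U) : (k <= l)%N ->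
  adapted c k g -> adapted c l g.
Proof.
move=> /subnK <-; elim: (l - k)%N => [//|m ih] gk; rewrite addSn.
exact/adaptedS/ih.
Qed.

Fixpoint rmax (s : nat -> X -> R) k x :=
  if k is k'.+1 then Num.max (rmax s k' x) (s k x) else s 0%N x.

Lemma rmax_ge0 s k x : (forall k x, 0 <= s k x) -> 0 <= rmax s k x.
Proof. by move=> s0; elim: k => //= k ih; rewrite le_max ih. Qed.

Lemma le_rmax s k l x : (l <= k)%N -> s l x <= rmax s k x.
Proof.
elim: k => [|k ih]/=; first by rewrite leqn0 => /eqP ->.
rewrite leq_eqVlt => /predU1P[->|]; first by rewrite le_max lexx orbT.
by rewrite ltnS => /ih sk; rewrite le_max sk.
Qed.

Lemma adapted_rmax s k : (forall k, adapted c k (s k)) ->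
  adapted c k (rmax s k).
Proof.
move=> sk; elim: k => [|k ih] x y exy /=; first exact: sk.
by rewrite (ih x y (c_nested exy)) (sk k.+1 x y exy).
Qed.

(** The martingale property is assumed in tested form, against adapted functions. This is how it is
    proved for stopped martingales, and it makes sense for a nu that vanishes outside one cell. *)
Lemma doob (nu : X -> R) (s : nat -> X -> R) p n : 1 < p ->
  (forall x, 0 <= nu x) -> (forall k x, 0 <= s k x) ->
  (forall k, adapted c k (s k)) ->
  (forall k g, (k < n)%N -> adapted c k g ->
     \sum_x nu x * s k.+1 x * g x = \sum_x nu x * s k x * g x) ->
  \sum_x nu x * (rmax s n x) `^ p <=
    (p / (p - 1)) `^ p * \sum_x nu x * (s n x) `^ p.
Proof.
move=> p1 nu0 s0 sk mart.
have p0 : 0 < p by lra.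
have p10 : p - 1 != 0 by lra.
have pn0 : p != 0 by lra.
have q1 : 1 <= p / (p - 1) by rewrite ler_pdivlMr; lra.
(* The maximum changes at step k + 1 only where it becomes [s k.+1], so the chain rule applies with
   that value. The martingale property then replaces [s k.+1] by [s k] against the older, adapted
   maximum, and the induction hypothesis applies. *)
have key k : (k <= n)%N -> \sum_x nu x * (rmax s k x) `^ p <=
    p / (p - 1) * \sum_x nu x * s k x * (rmax s k x) `^ (p - 1).
  elim: k => [_|k ih kn].
    rewrite mulr_sumr; apply: ler_sum => x _ /=.
    by rewrite -[nu x * _ * _]mulrA mulr_powRB1// ler_peMl// mulr_ge0 ?powR_ge0.
  have step x : nu x * (rmax s k.+1 x) `^ p <= nu x * (rmax s k x) `^ p +
      p / (p - 1) * (nu x * s k.+1 x * (rmax s k.+1 x) `^ (p - 1) -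
                     nu x * s k.+1 x * (rmax s k x) `^ (p - 1)).
    rewrite -mulrBr.
    rewrite -[nu x * s _ _ * _]mulrA mulrCA -mulrDr ler_wpM2l// addrC -lerBlDr.
    rewrite /= maxEle; case: ifPn => _; last by rewrite !subrr !mulr0.
    by apply: powR_increment => //; exact: rmax_ge0.
  apply: (le_trans (ler_sum _ (fun x _ => step x))).
  rewrite big_split/= -mulr_sumr sumrB.
  rewrite (mart k (fun x => rmax s k x `^ (p - 1)))//; last first.
    by move=> x y exy; rewrite (adapted_rmax sk exy).
  have := ih (ltnW kn); set A := \sum_x _; set B := \sum_x _; set C := \sum_x _.
  by rewrite mulrBr; lra.
have := key n (leqnn n).
(* Splitting nu into nu^(1/p) and nu^(1-1/p) matches the unweighted sums of [young_absorb], used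
   with C = p / (p - 1) and D = 1. *)
rewrite (_ : \sum_x nu x * s n x * (rmax s n x) `^ (p - 1) =
  \sum_x (nu x `^ p^-1 * s n x) * (nu x `^ (1 - p^-1) * (rmax s n x) `^ (p - 1))); last first.
  apply: eq_bigr => x _; rewrite mulrACA -powRD; last first.
    by rewrite (_ : p^-1 + _ = 1) ?oner_eq0//; ring.
  by rewrite (_ : p^-1 + _ = 1) ?powRr1 ?mulrA//; ring.
move=> H.
have -> : \sum_x nu x * s n x `^ p = \sum_x (nu x `^ p^-1 * s n x) `^ p.
  apply: eq_bigr => x _; rewrite powRM ?powR_ge0// -powRrM mulVf//.
  by rewrite powRr1.
have -> : (p / (p - 1)) `^ p = (p / (p - 1)) `^ p * 1 `^ (p - 1).
  by rewrite powR1 mulr1.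
apply: young_absorb H _ => //.
- by move=> x; rewrite mulr_ge0 ?powR_ge0.
- by move=> x; rewrite mulr_ge0 ?powR_ge0.
- lra.
- rewrite mul1r; apply: ler_sum => x _; rewrite powRM ?powR_ge0// -!powRrM.
  rewrite (_ : (1 - p^-1) * _ = 1); last by field; apply/andP; split.
  by rewrite powRr1// (_ : (p - 1) * _ = p)//; field.
Qed.

End doob.

(** * Stopping times and the exceptional set of a cell *)

Section filtration.
Variables (R : realType) (X : finType) (T : eqType) (c : nat -> X -> T).
Hypothesis c_nested : forall k x y, c k.+1 x = c k.+1 y -> c k x = c k y.
Implicit Types (i k l : nat) (x y : X).

Lemma nested_leq k l x y : (k <= l)%N -> c l x = c l y -> c k x = c k y.
Proof.
move=> /subnK <-; elim: (l - k)%N => [//|m ih]; rewrite addSn => /c_nested; exact: ih.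
Qed.

Definition avg k (f : X -> R) x := wavg c (fun=> 1) k f x.

Definition cell_card k x : R := \sum_(y | c k y == c k x) 1.

Lemma cell_card_gt0 k x : 0 < cell_card k x.
Proof. by apply: cell_mass_gt0 => _; exact: ltr01. Qed.

Lemma avgE k f x : avg k f x = (\sum_(y | c k y == c k x) f y) / cell_card k x.
Proof. by congr (_ / _); apply: eq_bigr => y _; rewrite mulr1. Qed.

Lemma adapted_avg k f : adapted c k (avg k f).
Proof. exact: adapted_wavg. Qed.

Lemma adapted_avg_le i k f : (i <= k)%N -> adapted c k (avg i f).
Proof. by move=> ik; apply: (adapted_leq c_nested ik); exact: adapted_avg. Qed.

Lemma avg_ge0 k f x : (forall y, 0 <= f y) -> 0 <= avg k f x.
Proof. by move=> f0; apply: wavg_ge0 => // _; exact: ler01. Qed.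

Lemma avg_proj k f g : adapted c k g ->
  \sum_x avg k f x * g x = \sum_x f x * g x.
Proof.
move=> gk; have := @wavg_proj R X T c (fun=> 1) k f g (fun=> ltr01) gk.
by under eq_bigr do rewrite mul1r; under [RHS]eq_bigr do rewrite mul1r.
Qed.

Lemma avg_minkowski (J : finType) (f : J -> X -> R) F q k x : 1 < q ->
  (forall j y, 0 <= f j y) -> (forall y, 0 <= F y) ->
  (forall y, \sum_j f j y `^ q <= F y `^ q) ->
  \sum_j avg k (f j) x `^ q <= avg k F x `^ q.
Proof.
move=> q1 f0 F0 fF; have cc0 := cell_card_gt0 k x.
under eq_bigr => j _ do rewrite avgE powRM ?invr_ge0 ?(ltW cc0)// ?sumr_ge0//.
rewrite -mulr_suml avgE powRM ?invr_ge0 ?(ltW cc0)// ?sumr_ge0//.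
by rewrite ler_wpM2r ?powR_ge0//; exact: minkowski_sum.
Qed.

Section doubling.
Variables (N : nat) (D : R).
Hypothesis D_ge1 : 1 <= D.
Hypothesis c_doubling : forall k x, (k < N)%N ->
  cell_card k x <= D * cell_card k.+1 x.

Lemma avg_doubling k f x : (forall y, 0 <= f y) -> (k < N)%N ->
  avg k.+1 f x <= D * avg k f x.
Proof.
move=> f0 kN; have h0 := cell_card_gt0 k x; have h1 := cell_card_gt0 k.+1 x.
rewrite !avgE ler_pdivrMr//.
have -> : D * ((\sum_(y | c k y == c k x) f y) / cell_card k x) * cell_card k.+1 x =
  (\sum_(y | c k y == c k x) f y) * (D * cell_card k.+1 x / cell_card k x).
  by ring.
apply: (@le_trans _ _ ((\sum_(y | c k y == c k x) f y) * 1)); last first.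
  by rewrite ler_wpM2l ?sumr_ge0// ler_pdivlMr// mul1r c_doubling.
rewrite mulr1 [leLHS]big_mkcond [leRHS]big_mkcond; apply: ler_sum => y _.
case: ifPn => [/eqP /c_nested ->|_]; first by rewrite eqxx.
by case: ifP.
Qed.

Section stopping.
Variables (F : X -> R) (i : nat) (lam : R).
Hypothesis F_ge0 : forall x, 0 <= F x.

(** Stopping occurs at the first generation from i on where the average of F exceeds lam; being
    alive at k means that this comes after k. *)
Definition alive k x :=
  [forall l : 'I_k.+1, (i <= l)%N ==> (avg l F x <= lam)].

Lemma aliveP k x :
  reflect (forall l, (i <= l <= k)%N -> avg l F x <= lam) (alive k x).
Proof.
apply: (iffP forallP) => [h l /andP[il lk]|h l].
  by have := h (Ordinal (lk : (l < k.+1)%N)); rewrite il.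
by apply/implyP => il; apply: h; rewrite il -ltnS ltn_ord.
Qed.

Lemma alive_leq k l x : (k <= l)%N -> alive l x -> alive k x.
Proof.
move=> kl /aliveP h; apply/aliveP => m /andP[im mk].
by apply: h; rewrite im (leq_trans mk).
Qed.

Lemma adapted_alive k : adapted c k (alive k).
Proof.
move=> x y exy; apply: eq_forallb => l.
by rewrite (adapted_avg_le F (ltnSE (ltn_ord l)) exy).
Qed.

(** The stopped martingale of the averages of h, with time counted from generation i. The value at
    the stopping time itself is kept; for h = F it may exceed lam, but by [avg_doubling] at most by
    the factor D. *)
Fixpoint stopped (h : X -> R) k x :=
  if k is k'.+1 then
    if alive (i + k') x then avg (i + k) h x else stopped h k' x
  else avg i h x.

Lemma stopped_ge0 h k x : (forall y, 0 <= h y) -> 0 <= stopped h k x.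
Proof.
by move=> h0; elim: k => [|k ih] /=; [|case: ifP => // _]; exact: avg_ge0.
Qed.

Lemma adapted_stopped h k : adapted (fun k => c (i + k)) k (stopped h k).
Proof.
elim: k => [|k ih] x y /=; first by rewrite addn0; exact: adapted_avg.
rewrite addnS => exy.
rewrite (adapted_alive (c_nested exy)) (ih x y (c_nested exy)).
by rewrite (adapted_avg h exy).
Qed.

Lemma stopped_alive h k x : alive (i + k) x -> stopped h k x = avg (i + k) h x.
Proof.
case: k => [|k] ax /=; first by rewrite addn0.
by rewrite (alive_leq _ ax)// addnS.
Qed.

(** The increment lives on the points alive at i + k, an adapted set, and there it is an increment
    of plain averages. *)
Lemma stopped_martingale h k g : adapted c (i + k) g ->
  \sum_x stopped h k.+1 x * g x = \sum_x stopped h k x * g x.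
Proof.
move=> gk; pose G x := (alive (i + k) x)%:R * g x.
have Gk : adapted c (i + k) G.
  by move=> x y exy; rewrite /G (adapted_alive exy) (gk _ _ exy).
have E : \sum_x avg (i + k.+1) h x * G x = \sum_x avg (i + k) h x * G x.
  rewrite avg_proj ?avg_proj// addnS; exact: adaptedS.
apply/eqP; rewrite -subr_eq0 -sumrB; apply/eqP.
transitivity (\sum_x (avg (i + k.+1) h x * G x - avg (i + k) h x * G x)).
  apply: eq_bigr => x _ /=; rewrite /G; case: ifPn => [ax|_].
    by rewrite stopped_alive// mul1r.
  by rewrite !subrr mul0r !mulr0 subrr.
by rewrite sumrB E subrr.
Qed.

(** After time 0 the value in force is an average over a cell on whose parent the average of F is at
    most lam. One generation costs D, and Minkowski's inequality passes from F to the family. *)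
Lemma stopped_bound (J : finType) (f : J -> X -> R) q k x : 1 < q ->
  (forall j y, 0 <= f j y) -> (forall y, \sum_j f j y `^ q <= F y `^ q) ->
  (i + k <= N)%N -> avg i F x <= lam ->
  \sum_j stopped (f j) k x `^ q <= (D * lam) `^ q.
Proof.
move=> q1 f0 fF + aF; have q0 : 0 <= q by lra.
have lam0 : 0 <= lam by apply: le_trans aF; exact: avg_ge0.
have D0 : 0 <= D by apply: le_trans D_ge1; exact: ler01.
elim: k => [_|k ih]/=.
  apply: (le_trans (avg_minkowski _ _ q1 f0 F_ge0 fF)).
  apply: ge0_ler_powR; rewrite ?nnegrE ?avg_ge0 ?mulr_ge0//.
  by apply: (le_trans aF); rewrite ler_peMl.
rewrite addnS => ikN.
case: (boolP (alive _ _)) => [/aliveP ax|_]; last exact/ih/ltnW.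
apply: (le_trans (avg_minkowski _ _ q1 f0 F_ge0 fF)).
apply: ge0_ler_powR; rewrite ?nnegrE ?avg_ge0 ?mulr_ge0//.
apply: (le_trans (avg_doubling x F_ge0 ikN)).
by rewrite ler_wpM2l// ax// leq_addr leqnn.
Qed.

Lemma stopped_dead k x : avg i F x <= lam ->
  ~~ alive (i + k) x -> lam < stopped F k x.
Proof.
move=> aF; elim: k => [|k ih] /=.
  rewrite addn0 => /aliveP; apply: contra_notP => _ l.
  by rewrite -eqn_leq => /eqP <-.
case: ifPn => [/aliveP ax|nax _]; last exact: ih.
move=> /aliveP; rewrite ltNge; apply: contra_notN => aF1 l /andP[il].
rewrite addnS in aF1 *; rewrite leq_eqVlt => /predU1P[->//|]; rewrite ltnS => lk.
by apply: ax; rewrite il.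
Qed.

End stopping.

Variables (J : finType) (f : J -> X -> R) (F : X -> R) (q : R).
Hypotheses (q_gt1 : 1 < q) (f_ge0 : forall j x, 0 <= f j x).
Hypotheses (F_ge0 : forall x, 0 <= F x).
Hypothesis (fF : forall x, \sum_j f j x `^ q <= F x `^ q).

Definition maxavg i k j x := rmax (fun m => avg (i + m) (f j)) (k - i) x.

Lemma maxavg_ge0 i k j x : 0 <= maxavg i k j x.
Proof. by apply: rmax_ge0 => *; exact: avg_ge0. Qed.

(** The middle factor is Doob's constant in L^q. With threshold 4 a, where a is the mean of F, the
    stopped family is bounded by 4 D a; the leading 4 makes Chebyshev's inequality lose only a
    quarter of the cell. *)
Definition stop_const : R := 4 * (q / (q - 1)) `^ q * (4 * D) `^ q.

Let in_cell i x0 x : R := (c i x == c i x0)%:R.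

Let sum_in_cell i x0 : \sum_x in_cell i x0 x = cell_card i x0.
Proof.
by rewrite /cell_card [RHS]big_mkcond; apply: eq_bigr => x _; rewrite /in_cell; case: eqP.
Qed.

Let adapted_in_cell i k x0 : (i <= k)%N -> adapted c k (in_cell i x0).
Proof.
move=> ik; apply: (adapted_leq c_nested ik) => x y exy.
by rewrite /in_cell exy.
Qed.

Lemma stop_const_ge1 : 1 <= stop_const.
Proof.
have D1 := D_ge1; have q1 := q_gt1.
have h1 : 1 <= (q / (q - 1)) `^ q.
  rewrite -[X in X <= _](powRr0 (q / (q - 1))) ler_powR//; last lra.
  by rewrite ler_pdivlMr; lra.
have h2 : 1 <= (4 * D) `^ q.
  by rewrite -[X in X <= _](powRr0 (4 * D)) ler_powR//; lra.
rewrite /stop_const; nra.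
Qed.

(** If F has mean 0, Chebyshev's inequality has no positive level to divide by; but then F and all
    f_j vanish on the cell. *)
Lemma bad_set_degenerate i x0 x : (i <= N)%N -> avg i F x0 = 0 ->
  c i x = c i x0 -> \sum_j maxavg i N j x `^ q = 0.
Proof.
move=> iN a0 ex; have q1 := q_gt1; have q0 : q != 0 by lra.
have F0 y : c i y = c i x0 -> F y = 0.
  move: a0; rewrite avgE => /eqP; rewrite mulf_eq0 invr_eq0 (gt_eqF (cell_card_gt0 _ _)) orbF.
  rewrite psumr_eq0// => /allP /(_ y (mem_index_enum _)) /implyP h.
  by move=> /eqP /h /eqP.
have f0 j y : c i y = c i x0 -> f j y = 0.
  move=> /F0 Fy; apply: (@powR_eq0_eq0 _ _ q); apply/eqP.
  have : \sum_j f j y `^ q = 0.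
    apply/eqP; rewrite eq_le sumr_ge0 ?andbT => [|*]; last exact: powR_ge0.
    by rewrite (le_trans (fF y))// Fy powR0.
  move/eqP; rewrite psumr_eq0; last by move=> *; exact: powR_ge0.
  by move=> /allP /(_ j (mem_index_enum _)).
rewrite big1// => j _; rewrite (_ : maxavg i N j x = 0) ?powR0//.
have a0' m : avg (i + m) (f j) x = 0.
  rewrite avgE big1 ?mul0r// => y /eqP /(nested_leq (leq_addr m i)) e.
  by apply: f0; rewrite e.
rewrite /maxavg; elim: (N - i)%N => [|m ih] /=; first exact: a0'.
by rewrite ih a0' maxxx.
Qed.

(** The half consists of two quarters: the points where some average of F exceeds 4 a, and those
    where none does but the maxima of the f_j are large. *)
Lemma bad_set_small i x0 : (i <= N)%N ->
  \sum_(x | c i x == c i x0)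
     (stop_const * avg i F x0 `^ q < \sum_j maxavg i N j x `^ q)%R%:R
  <= cell_card i x0 / 2.
Proof.
move=> iN; set a := avg i F x0; have q1 := q_gt1; have D1 := D_ge1.
have q0 : 0 < q by lra.
have a_ge0 : 0 <= a by exact: avg_ge0.
have [a0|a_neq0] := eqVneq a 0.
  rewrite big1 ?divr_ge0 ?(ltW (cell_card_gt0 _ _))// => x /eqP ex.
  by rewrite (@bad_set_degenerate i x0)// a0 powR0 ?mulr0 ?ltxx// gt_eqF.
have a_gt0 : 0 < a by lra.
pose lam := 4 * a; pose n := (N - i)%N; pose nu := in_cell i x0.
have inN : (i + n)%N = N by rewrite /n addnC subnK.
have nu0 x : 0 <= nu x by rewrite /nu /in_cell ler0n.
have aF x : c i x = c i x0 -> avg i F x <= lam.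
  by move=> e; rewrite (adapted_avg F e) -/a /lam; lra.
pose bad x := stop_const * a `^ q < \sum_j maxavg i N j x `^ q.
have mart h k g : adapted (fun k => c (i + k)) k g ->
    \sum_x nu x * stopped F i lam h k.+1 x * g x =
    \sum_x nu x * stopped F i lam h k x * g x.
  move=> gk; have := @stopped_martingale F i lam h k (fun x => nu x * g x).
  move=> H; transitivity (\sum_x stopped F i lam h k.+1 x * (nu x * g x)).
    by apply: eq_bigr => x _; ring.
  rewrite H; first by apply: eq_bigr => x _; ring.
  by move=> x y exy; rewrite /nu (gk _ _ exy) (adapted_in_cell _ (leq_addr k i) exy).
(* The stopped martingale of F has mean a over the cell and exceeds 4 a at every stopped point. *)
have dead : \sum_x nu x * (~~ alive F i lam N x)%:R <= cell_card i x0 / 4.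
  have lam_gt0 : 0 < lam by rewrite /lam; lra.
  rewrite -(@ler_pM2l _ lam)//.
  have -> : lam * (cell_card i x0 / 4) = \sum_x nu x * stopped F i lam F n x * 1.
    transitivity (\sum_x nu x * stopped F i lam F 0 x * 1).
      rewrite /lam -sum_in_cell [in LHS](_ : 4 * a * _ = (\sum_x nu x) * a); last by rewrite /nu; field.
      rewrite mulr_suml; apply: eq_bigr => x _; rewrite mulr1 /= /nu /in_cell.
      by case: eqP => [e|_]; rewrite ?mul0r// (adapted_avg F e).
    by elim: (n) => [//|k ->]; rewrite mart.
  rewrite mulr_sumr; apply: ler_sum => x _; rewrite mulrCA mulr1 /nu /in_cell.
  case: eqP => [e|_]; rewrite ?mul0r// !mul1r.
  case: (boolP (alive F i lam N x)) => ax /=.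
    by rewrite mulr0 stopped_ge0.
  by rewrite mulr1 ltW// stopped_dead ?aF// inN.
(* At points never stopped, stopped and plain averages coincide, so Doob's inequality for each
   stopped f_j, summed over j, controls the maxima. *)
have stay : \sum_x nu x * (alive F i lam N x && bad x)%:R <= cell_card i x0 / 4.
  have K0 : 0 < stop_const * a `^ q.
    by rewrite mulr_gt0 ?powR_gt0//; have := stop_const_ge1; lra.
  rewrite -(@ler_pM2l _ (stop_const * a `^ q))//.
  apply: (@le_trans _ _ (\sum_j \sum_x nu x * rmax (stopped F i lam (f j)) n x `^ q)).
    rewrite exchange_big mulr_sumr; apply: ler_sum => x _.
    rewrite -mulr_sumr mulrCA ler_wpM2l//.
    case: (boolP (alive _ _ _ _ _)) => ax /=; last first.
      by rewrite mulr0 sumr_ge0// => *; exact: powR_ge0.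
    have -> : \sum_j rmax (stopped F i lam (f j)) n x `^ q = \sum_j maxavg i N j x `^ q.
      apply: eq_bigr => j _; congr (_ `^ _); rewrite /maxavg -/n.
      have : alive F i lam (i + n) x by rewrite inN.
      elim: (n) => [|k ih] ak /=; first by rewrite addn0.
      rewrite ih; last by apply: alive_leq ak; rewrite addnS.
      by rewrite (alive_leq _ ak)// addnS.
    case: (boolP (bad x)) => [bx|_]; first by rewrite mulr1 ltW.
    by rewrite mulr0 sumr_ge0// => *; exact: powR_ge0.
  apply: (@le_trans _ _ (\sum_j ((q / (q - 1)) `^ q *
      \sum_x nu x * stopped F i lam (f j) n x `^ q))).
    apply: ler_sum => j _; apply: (@doob _ _ _ (fun k => c (i + k))) => //.
    - by move=> k x y; rewrite addnS; exact: c_nested.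
    - by move=> k x; exact: stopped_ge0.
    - by move=> k; exact: adapted_stopped.
    - by move=> k g _; exact: mart.
  rewrite -mulr_sumr exchange_big/=.
  apply: (@le_trans _ _ ((q / (q - 1)) `^ q * \sum_x nu x * (D * lam) `^ q)).
    rewrite ler_wpM2l ?powR_ge0//; apply: ler_sum => x _; rewrite -mulr_sumr.
    rewrite /nu /in_cell; case: eqP => [e|_]; rewrite ?mul0r// !mul1r.
    by apply: stopped_bound; rewrite ?inN// aF.
  rewrite -mulr_suml sum_in_cell /stop_const /lam.
  rewrite (_ : D * (4 * a) = (4 * D) * a); last by ring.
  rewrite [(4 * D * a) `^ q]powRM//; last by lra.
  by rewrite le_eqVlt; apply/orP; left; apply/eqP; field.
apply: (@le_trans _ _ (\sum_x nu x * (~~ alive F i lam N x)%:R +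
                       \sum_x nu x * (alive F i lam N x && bad x)%:R)); last lra.
rewrite -big_split big_mkcond; apply: ler_sum => x _ /=.
rewrite /nu /in_cell -/(bad x); case: eqP => _; rewrite ?mul0r ?addr0// !mul1r.
by case: (alive _ _ _ _ _); case: (bad x); rewrite /= ?addr0 ?add0r// ?ler01.
Qed.

End doubling.
End filtration.

(** * Principal cells and sparse domination *)

Section principal_cells.
Variables (R : realType) (X : finType) (T : eqType) (c : nat -> X -> T).
Hypothesis c_nested : forall k x y, c k.+1 x = c k.+1 y -> c k x = c k y.
Variables (N : nat) (D : R).
Hypothesis D_ge1 : 1 <= D.
Hypothesis c_doubling : forall k x, (k < N)%N ->
  cell_card R c k x <= D * cell_card R c k.+1 x.
Variables (J : finType) (f : J -> X -> R) (F : X -> R) (q : R).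
Hypotheses (q_gt1 : 1 < q) (f_ge0 : forall j x, 0 <= f j x).
Hypotheses (F_ge0 : forall x, 0 <= F x).
Hypothesis (fF : forall x, \sum_j f j x `^ q <= F x `^ q).
Local Notation avg := (avg c).
Local Notation fmax := (maxavg c f).

Lemma maxavg_diag k j x : fmax k k j x = avg k (f j) x.
Proof. by rewrite /maxavg subnn /= addn0. Qed.

Lemma maxavgS i k j x : (i <= k)%N ->
  fmax i k.+1 j x = Num.max (fmax i k j x) (avg k.+1 (f j) x).
Proof. by move=> ik; rewrite /maxavg subSn//= addnS subnKC. Qed.

Lemma adapted_maxavg i k j : (i <= k)%N -> adapted c k (fmax i k j).
Proof.
move=> ik; have -> : k = (i + (k - i))%N by rewrite subnKC.
rewrite /maxavg addKn.
apply: (@adapted_rmax _ _ _ (fun k => c (i + k))) => [m x y|m].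
  by rewrite addnS; exact: c_nested.
exact: adapted_avg.
Qed.

Lemma maxavg_le i k l j x : (i <= k)%N -> (k <= l)%N ->
  fmax i k j x <= fmax i l j x.
Proof.
move=> ik /subnK <-; elim: (l - k)%N => [//|m ih]; rewrite addSn maxavgS.
  by rewrite le_max ih.
by rewrite (leq_trans ik)// leq_addl.
Qed.

Definition good i k x :=
  \sum_j fmax i k j x `^ q <= stop_const D q * avg i F x `^ q.

(** Generation of the smallest principal cell around x found so far. A new one opens at the first
    generation where the maxima counted from the current one fail to be good. *)
Fixpoint top_level k x :=
  if k is k'.+1 then if good (top_level k' x) k x then top_level k' x else k
  else 0%N.

Definition principal k x := top_level k x == k.

Lemma top_level_le k x : (top_level k x <= k)%N.
Proof. by elim: k => //= k ih; case: ifP => _ //; exact: leqW. Qed.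

Lemma adapted_good i k : (i <= k)%N -> adapted c k (good i k).
Proof.
move=> ik x y exy; rewrite /good (adapted_avg_le c_nested F ik exy).
by congr (_ <= _); apply: eq_bigr => j _; rewrite (adapted_maxavg _ ik exy).
Qed.

Lemma adapted_top_level k : adapted c k (top_level k).
Proof.
elim: k => [//|k ih] x y exy /=; have e := c_nested exy.
by rewrite (ih x y e) (adapted_good (leqW (top_level_le k y)) exy).
Qed.

Lemma adapted_principal k : adapted c k (principal k).
Proof. by move=> x y exy; rewrite /principal (adapted_top_level exy). Qed.

Lemma good_diag k x : good k k x.
Proof.
rewrite /good; under eq_bigr do rewrite maxavg_diag.
apply: (le_trans (avg_minkowski c k x q_gt1 f_ge0 F_ge0 fF)).
by rewrite ler_peMl ?powR_ge0//; exact: stop_const_ge1.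
Qed.

Lemma good_top_level k x : good (top_level k x) k x.
Proof.
case: k => [|k] /=; first exact: good_diag.
by case: ifP => // _; exact: good_diag.
Qed.

(** Call the generations from one principal cell up to the next a run. This collects the q-th powers
    of the maxima over the closed runs, each recorded when its run closes. *)
Fixpoint past k j x : R :=
  if k is k'.+1 then
    if good (top_level k' x) k x then past k' j x
    else past k' j x + fmax (top_level k' x) k' j x `^ q
  else 0.

Lemma past_ge0 k j x : 0 <= past k j x.
Proof. by elim: k => //= k ih; case: ifP => // _; rewrite addr_ge0// powR_ge0. Qed.

(** The overall maximum is attained in some run, closed or current, and a maximum of q-th powers is
    at most their sum. *)
Lemma maxavg_past k j x :
  fmax 0 k j x `^ q <= past k j x + fmax (top_level k x) k j x `^ q.
Proof.
have q0 : 0 <= q by have := q_gt1; lra.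
have a0 i l : 0 <= fmax i l j x by exact: maxavg_ge0.
have b0 l : 0 <= avg l (f j) x by exact: avg_ge0.
elim: k => [|k ih] /=; first by rewrite add0r.
rewrite maxavgS//; case: ifPn => _.
  rewrite maxavgS ?top_level_le// maxEle; case: ifPn => _.
    apply: (le_trans (ge0_ler_powR q0 _ _ (_ : _ <=
      Num.max (fmax (top_level k x) k j x) (avg k.+1 (f j) x)))).
    - by rewrite nnegrE.
    - by rewrite nnegrE le_max a0.
    - by rewrite le_max lexx orbT.
    - by rewrite lerDr past_ge0.
  apply: (le_trans ih); rewrite lerD2l ge0_ler_powR// ?nnegrE//.
    by rewrite le_max a0.
  by rewrite le_max lexx.
apply: (le_trans (powR_max_le q0 _ _)) => //.
by rewrite maxavg_diag lerD2r.
Qed.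

(** Each closed run is charged to the principal cell that opened it; the second term on the left
    reserves the charge of the run still open. *)
Lemma sum_past k x :
  \sum_j past k j x + stop_const D q * avg (top_level k x) F x `^ q <=
  stop_const D q * \sum_(l < k.+1 | principal l x) avg l F x `^ q.
Proof.
have S0 : 0 <= stop_const D q by have := @stop_const_ge1 R D D_ge1 q q_gt1; lra.
elim: k => [|k ih] /=.
  rewrite big1// add0r (bigD1 ord0)//= mulrDr lerDl mulr_ge0// sumr_ge0// => *.
  exact: powR_ge0.
rewrite [in X in _ <= _ * X]big_mkcond big_ord_recr /= -big_mkcond/=.
rewrite mulrDr; case: ifPn => [gk|ngk].
  apply: (le_trans ih); rewrite lerDl mulr_ge0//; case: ifP => // _; exact: powR_ge0.
rewrite /principal /= (negbTE ngk) eqxx lerD2r big_split/=.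
apply: le_trans ih; rewrite lerD2l//.
exact: good_top_level.
Qed.

Lemma sparse_domination x :
  \sum_j fmax 0 N j x `^ q <=
  stop_const D q * \sum_(k < N.+1 | principal k x) avg k F x `^ q.
Proof.
apply: le_trans (sum_past N x).
apply: (@le_trans _ _ (\sum_j (past N j x + fmax (top_level N x) N j x `^ q))).
  by apply: ler_sum => j _; exact: maxavg_past.
by rewrite big_split/= lerD2l; exact: good_top_level.
Qed.

Lemma principal_next k l x : (k < l)%N -> principal k x -> principal l x ->
  exists2 m, (k <= m <= l)%N & ~~ good k m x.
Proof.
move=> kl /eqP kx lx.
suff H m : (k <= m)%N -> top_level m x = k \/ exists2 m', (k <= m' <= m)%N & ~~ good k m' x.
  have [e|//] := H l (ltnW kl); move: lx kl; rewrite /principal e => /eqP ->.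
  by rewrite ltnn.
move=> /subnK <-; elim: (m - k)%N => [|n [ih|[m' /andP[h1 h2] h3]]].
- by left.
- rewrite addSn /= ih; case: ifPn => [_|ng]; first by left.
  by right; exists (n + k).+1 => //; rewrite leqnn andbT -addSn leq_addl.
- by right; exists m' => //; rewrite h1 (leq_trans h2)// leq_add2r.
Qed.

(** The part of a principal cell outside all smaller principal cells; for different k these parts
    are disjoint. *)
Definition last_principal k x :=
  principal k x && [forall l : 'I_N.+1, (k < l)%N ==> ~~ principal l x].

Lemma last_principal_uniq k l x : (k <= N)%N -> (l <= N)%N ->
  last_principal k x -> last_principal l x -> k = l.
Proof.
move=> kN lN /andP[kx /forallP hk] /andP[lx /forallP hl].
case: (ltngtP k l) => // kl.
- by have := hk (Ordinal (lN : (l < N.+1)%N)); rewrite /= kl lx.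
- by have := hl (Ordinal (kN : (k < N.+1)%N)); rewrite /= kl kx.
Qed.

(** A point of the cell lying in a smaller principal cell has seen [good k] fail, hence belongs to
    the set of [bad_set_small]. *)
Lemma last_principal_large k x : (k <= N)%N -> principal k x ->
  cell_card R c k x / 2 <= \sum_(y | c k y == c k x) (last_principal k y)%:R.
Proof.
move=> kN kx.
have := bad_set_small c_nested D_ge1 c_doubling q_gt1 f_ge0 F_ge0 fF x kN.
set B := \sum_(_ | _) _ => HB.
suff : cell_card R c k x <= \sum_(y | c k y == c k x) (last_principal k y)%:R + B by lra.
rewrite -big_split; apply: ler_sum => y /eqP e /=.
case: (boolP (last_principal k y)) => [_|]; first by rewrite lerDl ler0n.
rewrite /last_principal (adapted_principal e) kx /= => /forallPn[l].
rewrite negb_imply negbK => /andP[kl ly].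
have ky : principal k y by rewrite (adapted_principal e).
have [m /andP[km ml] ng] := principal_next kl ky ly.
rewrite (_ : (_ < _)%R = true) ?add0r//.
rewrite -(adapted_avg F e); apply: lt_le_trans (_ : \sum_j fmax k m j y `^ q <= _).
  by rewrite ltNge.
apply: ler_sum => j _; apply: ge0_ler_powR; rewrite ?nnegrE ?maxavg_ge0//.
  by have := q_gt1; lra.
apply: maxavg_le => //; apply: (leq_trans ml); exact: ltnSE (ltn_ord l).
Qed.

End principal_cells.

Section doob_averages.
Variables (R : realType) (X : finType) (T : eqType) (c : nat -> X -> T).
Hypothesis c_nested : forall k x y, c k.+1 x = c k.+1 y -> c k x = c k y.
Variable N : nat.
Hypothesis c_inj : injective (c N).

Lemma wavg_leaf (nu f : X -> R) x : 0 < nu x -> wavg c nu N f x = f x.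
Proof.
move=> nux; rewrite /wavg (eq_bigl (pred1 x)); last first.
  by move=> y; rewrite /= (inj_eq c_inj).
rewrite [X in _ / X](eq_bigl (pred1 x)); last first.
  by move=> y; rewrite /= (inj_eq c_inj).
by rewrite !big_pred1_eq; field; rewrite gt_eqF.
Qed.

(** Cells of generation N are single points, so the martingale of averages ends at f. The constant
    does not depend on nu, which is why averages with respect to w and sigma cost no power of the
    A_p constant. *)
Lemma doob_wavg (nu f : X -> R) p : 1 < p -> (forall x, 0 < nu x) ->
  (forall x, 0 <= f x) ->
  \sum_x nu x * rmax (fun k => wavg c nu k f) N x `^ p <=
  (p / (p - 1)) `^ p * \sum_x nu x * f x `^ p.
Proof.
move=> p1 nu0 f0; have nu0' x := ltW (nu0 x).
have <- : \sum_x nu x * wavg c nu N f x `^ p = \sum_x nu x * f x `^ p.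
  by apply: eq_bigr => x _; rewrite wavg_leaf.
apply: (@doob R X T c c_nested nu (fun k => wavg c nu k f)) => //.
- by move=> k x; exact: wavg_ge0.
- by move=> k; exact: adapted_wavg.
- move=> k g _ gk; rewrite !wavg_proj//; exact: adaptedS.
Qed.

End doob_averages.

(** * The weighted bound for the sparse sum *)

Section weighted_estimate.
Variable R : realType.

(* u, v stand for averages with respect to sigma and w over a cell, and S, W
   for the averages of sigma and w; P, H bound the maximal functions. *)
Lemma cell_estimate (s p K u S W v P H sig w : R) :
  0 < s -> s + 1 <= p -> 0 <= K -> 0 <= u <= P -> 0 <= v <= H ->
  0 < S -> 0 < W -> 0 < sig -> 0 < w ->
  W * S `^ (p - 1) <= K -> sig <= 4 * S -> 1 <= w * sig `^ (p - 1) ->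
  (u * S) `^ s * (v * W) <= 4 `^ (p - 1 - s) * K *
    ((P `^ s * sig `^ (s / p)) * (H * w `^ (1 - s / p))).
Proof.
move=> s0 sp K0 /andP[u0 uP] /andP[v0 vH] S0 W0 sig0 w0 WS sS wsig.
have p0 : 0 < p by lra.
have P0 : 0 <= P by exact: le_trans uP.
have H0 : 0 <= H by exact: le_trans vH.
(* S^s W is W S^(p-1), at most K, times S^(-b). Here s <= p - 1 matters: for b >= 0 the bound sig <=
   4 S lets S^(-b) be replaced by a multiple of sig^(-b). *)
set b := p - 1 - s; have b0 : 0 <= b by rewrite /b; lra.
have step1 : S `^ s * W <= K * S `^ (- b).
  have -> : S `^ s * W = (W * S `^ (p - 1)) * S `^ (- b).
    rewrite -mulrA -powRD; last by rewrite (gt_eqF S0) implybT.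
    by rewrite mulrC; congr (_ * _ `^ _); rewrite /b; ring.
  by rewrite ler_wpM2r// powR_ge0.
have step2 : S `^ (- b) <= 4 `^ b * sig `^ (- b).
  rewrite !powRN ler_pdivlMr ?powR_gt0// ler_pdivrMl ?powR_gt0// mulrC.
  rewrite -powRM//; last exact: ltW.
  by apply: ge0_ler_powR => //; rewrite nnegrE ?mulr_ge0// ltW.
(* Since s / p + b = (p - 1) (1 - s / p), this is a power of 1 <= w sig^(p-1). *)
have step3 : sig `^ (- b) <= sig `^ (s / p) * w `^ (1 - s / p).
  have e0 : 0 <= 1 - s / p by rewrite subr_ge0 ler_pdivrMr// mul1r; lra.
  have : 1 <= (w * sig `^ (p - 1)) `^ (1 - s / p).
    by rewrite -[X in X <= _](powRr0 (w * sig `^ (p - 1))) ler_powR.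
  rewrite powRM ?powR_ge0 ?(ltW w0)// -powRrM => h.
  rewrite -(@ler_pM2r _ (sig `^ b)) ?powR_gt0//.
  rewrite -powRD; last by rewrite (gt_eqF sig0) implybT.
  rewrite addNr powRr0 mulrAC -powRD; last by rewrite (gt_eqF sig0) implybT.
  rewrite mulrC (_ : s / p + b = (p - 1) * (1 - s / p))//.
  by rewrite /b; field; rewrite gt_eqF.
rewrite powRM//; last exact: ltW.
apply: (@le_trans _ _ (P `^ s * H * (S `^ s * W))).
  have -> : u `^ s * S `^ s * (v * W) = (u `^ s * v) * (S `^ s * W) by ring.
  rewrite ler_wpM2r ?mulr_ge0 ?powR_ge0 ?(ltW W0)//.
  apply: ler_pM => //; first exact: powR_ge0.
  by apply: ge0_ler_powR => //; rewrite ?nnegrE// ltW.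
have -> : 4 `^ b * K * (P `^ s * sig `^ (s / p) * (H * w `^ (1 - s / p))) =
  P `^ s * H * (K * (4 `^ b * (sig `^ (s / p) * w `^ (1 - s / p)))) by ring.
rewrite ler_wpM2l ?mulr_ge0 ?powR_ge0//; apply: (le_trans step1).
rewrite ler_wpM2l//; apply: (le_trans step2).
by rewrite ler_wpM2l ?powR_ge0.
Qed.

Variables (X : finType) (T : eqType) (c : nat -> X -> T).
Hypothesis c_nested : forall k x y, c k.+1 x = c k.+1 y -> c k x = c k y.
Variable N : nat.
Hypothesis c_inj : injective (c N).
Variables (D : R).
Hypothesis D_ge1 : 1 <= D.
Hypothesis c_doubling : forall k x, (k < N)%N ->
  cell_card R c k x <= D * cell_card R c k.+1 x.
Variables (J : finType) (f : J -> X -> R) (F : X -> R) (q : R).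
Hypotheses (q_gt1 : 1 < q) (f_ge0 : forall j x, 0 <= f j x).
Hypotheses (F_ge0 : forall x, 0 <= F x).
Hypothesis (fF : forall x, \sum_j f j x `^ q <= F x `^ q).
Variables (p K : R) (w sig : X -> R).
Hypotheses (p_gt1 : 1 < p) (K_ge0 : 0 <= K).
Hypotheses (w_gt0 : forall x, 0 < w x) (sig_gt0 : forall x, 0 < sig x).
Hypothesis Ap_cell : forall k x, (k <= N)%N ->
  avg c k w x * avg c k sig x `^ (p - 1) <= K.
Hypothesis Ap_leaf : forall x, 1 <= w x * sig x `^ (p - 1).

Local Notation principal := (principal c D f F q).
Local Notation last_principal := (last_principal c N D f F q).

(** By Markov's inequality sig exceeds 4 times its mean on at most a quarter of the cell; removing
    these points from the half given by [last_principal_large] leaves at least a quarter. *)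
Let selected k x := last_principal k x && (sig x <= 4 * avg c k sig x).

Let selected_large k x : (k <= N)%N -> principal k x ->
  1 <= 4 * avg c k (fun y => (selected k y)%:R : R) x.
Proof.
move=> kN kx; have cc0 := cell_card_gt0 R c k x.
have large := last_principal_large c_nested D_ge1 c_doubling q_gt1 f_ge0 F_ge0 fF kN kx.
rewrite avgE mulrA ler_pdivlMr// mul1r.
have S0 : 0 < avg c k sig x.
  by rewrite avgE divr_gt0// cell_mass_gt0.
have high : \sum_(y | c k y == c k x) (4 * avg c k sig x < sig y)%R%:R <= cell_card R c k x / 4.
  have S4 : 0 < 4 * avg c k sig x by lra.
  rewrite -(ler_pM2l S4).
  have -> : 4 * avg c k sig x * (cell_card R c k x / 4) = \sum_(y | c k y == c k x) sig y.
    by rewrite avgE; field; rewrite gt_eqF.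
  rewrite mulr_sumr; apply: ler_sum => y _.
  case: (boolP (_ < _)) => [/ltW|_]; first by rewrite mulr1.
  by rewrite mulr0 ltW.
suff : \sum_(y | c k y == c k x) (last_principal k y)%:R <=
   \sum_(y | c k y == c k x) (selected k y)%:R +
   \sum_(y | c k y == c k x) (4 * avg c k sig x < sig y)%R%:R :> R by lra.
rewrite -big_split; apply: ler_sum => y /eqP e /=.
rewrite /selected (adapted_avg sig e) ltNge.
by case: (last_principal k y); case: (sig y <= _); rewrite /= ?addr0 ?add0r ?ler01.
Qed.

Let sum_selected x : \sum_(k < N.+1) (selected k x)%:R <= 1 :> R.
Proof.
have [/existsP[k kx]|] := boolP [exists k : 'I_N.+1, selected k x]; last first.
  by rewrite negb_exists => /forallP h; rewrite big1// => k _; rewrite (negbTE (h k)).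
rewrite (bigD1 k)//= kx big1 ?addr0// => l /negP lk.
case: (boolP (selected l x)) => // lx; case: lk; apply/eqP/val_inj.
case/andP: lx => lx _; case/andP: kx => kx _.
by apply: last_principal_uniq lx kx; exact: ltnSE (ltn_ord _).
Qed.

(** On a principal cell the mean of the indicator of the selected points is at least 1/4, and
    summation against an adapted g removes the mean. *)
Let sum_principal k (g : X -> R) : (k <= N)%N -> adapted c k g -> (forall x, 0 <= g x) ->
  \sum_x (principal k x)%:R * g x <= 4 * \sum_x (selected k x)%:R * g x.
Proof.
move=> kN gk g0.
have Gk : adapted c k (fun x => (principal k x)%:R * g x).
  by move=> x y e; rewrite (adapted_principal c_nested D f F q e) (gk _ _ e).
apply: (@le_trans _ _ (4 * \sum_x avg c k (fun y => (selected k y)%:R) x *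
    ((principal k x)%:R * g x))).
  rewrite mulr_sumr; apply: ler_sum => x _.
  case: (boolP (principal k x)) => kx; last by rewrite mul0r !mulr0.
  by rewrite mul1r mulrA ler_peMl// selected_large.
rewrite ler_pM2l// avg_proj//; apply: ler_sum => x _.
case: (boolP (selected k x)) => [/andP[/andP[kx _] _]|_]; last by rewrite !mul0r.
by rewrite kx mul1r.
Qed.

(** With r = p / s, the first two factors are C^r, without its power of K, and D^(r-1) from
    [young_absorb]; D is Doob's constant for w and the exponent conjugate to r. The last is Doob's
    constant for sig and the exponent p. *)
Definition sparse_const s : R :=
  (4 * 4 `^ (p - 1 - s)) `^ (p / s) *
  ((p / s) `^ (p / s / (p / s - 1))) `^ (p / s - 1) * (p / (p - 1)) `^ p.

Lemma sparse_bound s : 0 < s -> s + 1 <= p ->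
  \sum_x w x * (\sum_(k < N.+1 | principal k x) avg c k F x `^ s) `^ (p / s) <=
  sparse_const s * K `^ (p / s) * \sum_x F x `^ p * sig x `^ (1 - p).
Proof.
move=> s0 sp; have p1 := p_gt1; have K0 := K_ge0.
pose r := p / s; have r1 : 1 < r by rewrite /r ltr_pdivlMr//; lra.
have sn0 : s != 0 by rewrite gt_eqF.
have pn0 : p != 0 by lra.
have rs : s / p = r^-1 by rewrite /r invf_div.
pose G x := \sum_(k < N.+1 | principal k x) avg c k F x `^ s.
have G0 x : 0 <= G x by rewrite sumr_ge0// => *; exact: powR_ge0.
(* The extremal dual function of G in L^r(w): pairing it with G returns the left-hand side, so
   absorption replaces a supremum over dual functions. *)
pose h x := G x `^ (r - 1).
have h0 x : 0 <= h x by exact: powR_ge0.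
(* Averages of F factor into sig-averages of phi and averages of sig, and the right-hand side
   becomes the sum of sig phi^p. *)
pose phi x := F x / sig x.
have phi0 x : 0 <= phi x by rewrite divr_ge0// ltW.
pose P := rmax (fun k => wavg c sig k phi) N.
pose H := rmax (fun k => wavg c w k h) N.
have w0' x := ltW (w_gt0 x); have sig0' x := ltW (sig_gt0 x).
have P0 x : 0 <= P x by apply: rmax_ge0 => *; exact: wavg_ge0.
have H0 x : 0 <= H x by apply: rmax_ge0 => *; exact: wavg_ge0.
have avgF k x : avg c k F x = wavg c sig k phi x * avg c k sig x.
  rewrite !avgE /wavg (_ : \sum_(y | _) phi y * sig y = \sum_(y | c k y == c k x) F y).
    by field; rewrite !gt_eqF// ?cell_card_gt0 ?cell_mass_gt0.
  by apply: eq_bigr => y _; rewrite /phi divfK// gt_eqF.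
have avgh k x : avg c k (fun y => h y * w y) x = wavg c w k h x * avg c k w x.
  by rewrite !avgE /wavg; field; rewrite !gt_eqF// ?cell_card_gt0 ?cell_mass_gt0.
(* The averages of F and the principal sets are adapted, so h w may be replaced by its averages.
   After passing to the selected sets, which are disjoint, [cell_estimate] is used at most once per
   point. *)
have main : \sum_x w x * G x `^ r <= 4 * (4 `^ (p - 1 - s) * K) *
    \sum_x (P x `^ s * sig x `^ (s / p)) * (H x * w x `^ (1 - s / p)).
  have -> : \sum_x w x * G x `^ r =
      \sum_(k < N.+1) \sum_x (principal k x)%:R *
         (avg c k F x `^ s * avg c k (fun y => h y * w y) x).
    transitivity (\sum_x \sum_(k < N.+1) (h x * w x) *
        ((principal k x)%:R * avg c k F x `^ s)).
      apply: eq_bigr => x _; rewrite -mulr_sumr.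
      have -> : G x `^ r = G x * h x by rewrite mulr_powRB1//; lra.
      rewrite (_ : w x * (G x * h x) = h x * w x * G x); last by ring.
      congr (_ * _); rewrite /G big_mkcond; apply: eq_bigr => k _.
      by case: ifP; rewrite ?mul1r ?mul0r.
    rewrite exchange_big; apply: eq_bigr => k _.
    rewrite -(@avg_proj _ _ _ c k (fun y => h y * w y) (fun x => (principal k x)%:R * avg c k F x `^ s)).
      by apply: eq_bigr => x _; ring.
    move=> x y e; rewrite (adapted_principal c_nested D f F q e).
    by rewrite (adapted_avg F e).
  apply: (@le_trans _ _ (\sum_(k < N.+1) 4 * \sum_x (selected k x)%:R *
         (avg c k F x `^ s * avg c k (fun y => h y * w y) x))).
    apply: ler_sum => k _; apply: sum_principal; first exact: ltnSE (ltn_ord k).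
      by move=> x y e; rewrite (adapted_avg F e) (adapted_avg _ e).
    by move=> x; rewrite mulr_ge0 ?powR_ge0// avg_ge0// => y; exact: mulr_ge0.
  rewrite -mulr_sumr -mulrA ler_pM2l// exchange_big mulr_sumr/=.
  apply: ler_sum => x _.
  apply: (@le_trans _ _ (\sum_(k < N.+1) (selected k x)%:R * (4 `^ (p - 1 - s) * K *
     (P x `^ s * sig x `^ (s / p) * (H x * w x `^ (1 - s / p)))))); last first.
    by rewrite -mulr_suml ler_piMl ?sum_selected// !mulr_ge0 ?powR_ge0.
  apply: ler_sum => k _; case: (boolP (selected k x)) => [/andP[_ sk]|_]; last first.
    by rewrite !mul0r.
  have kN : (k <= N)%N := ltnSE (ltn_ord k).
  rewrite !mul1r avgF avgh; apply: cell_estimate => //.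
  - by rewrite wavg_ge0//= le_rmax.
  - by rewrite wavg_ge0//= le_rmax.
  - by rewrite avgE divr_gt0// ?cell_card_gt0 ?cell_mass_gt0.
  - by rewrite avgE divr_gt0// ?cell_card_gt0 ?cell_mass_gt0.
  - exact: Ap_cell.
have rr : r / (r - 1) / (r / (r - 1) - 1) = r.
  by field; repeat (apply/andP; split); lra.
have r10 : 0 < r - 1 by lra.
have r'1 : 1 < r / (r - 1) by rewrite ltr_pdivlMr//; lra.
have := @young_absorb R X _ _ r _ (r `^ (r / (r - 1))) _ r1 _ _ _ _ main.
have rn0 : r != 0 by lra.
move=> /(_ _ _ _ _ _) Y; apply: (le_trans (Y _ _ _ _ _)).
- by move=> x; rewrite mulr_ge0 ?powR_ge0.
- by move=> x; rewrite mulr_ge0 ?powR_ge0.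
- by rewrite !mulr_ge0 ?powR_ge0.
- by apply: powR_gt0; exact: lt_trans ltr01 r1.
(* The second factors are controlled by Doob's inequality for w and r / (r - 1), because h^(r/(r-1))
   = G^r. *)
- have := doob_wavg c_nested c_inj r'1 w_gt0 h0.
  rewrite rr.
  have -> : \sum_x w x * h x `^ (r / (r - 1)) = \sum_x w x * G x `^ r.
    apply: eq_bigr => x _; rewrite /h -powRrM mulrCA divff ?mulr1//.
    by rewrite gt_eqF.
  apply: le_trans; rewrite le_eqVlt; apply/orP; left; apply/eqP.
  apply: eq_bigr => x _; rewrite powRM ?powR_ge0// mulrC; congr (_ * _).
  rewrite -powRrM rs (_ : (1 - r^-1) * _ = 1) ?powRr1//.
  by field; rewrite rn0 (gt_eqF r10).
have dP := doob_wavg c_nested c_inj p1 sig_gt0 phi0.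
have -> : \sum_i (P i `^ s * sig i `^ (s / p)) `^ r = \sum_x sig x * P x `^ p.
  apply: eq_bigr => x _; rewrite powRM ?powR_ge0// -!powRrM rs mulVf// powRr1//.
  by rewrite mulrC; congr (_ * _ `^ _); rewrite /r; field.
have -> : \sum_x F x `^ p * sig x `^ (1 - p) = \sum_x sig x * phi x `^ p.
  apply: eq_bigr => x _; rewrite /phi powRM// ?invr_ge0//.
  rewrite -[(sig x)^-1]powR_inv1// -powRrM mulN1r mulrCA; congr (_ * _).
  rewrite -[X in X * _]powRr1// -powRD//.
  by rewrite (gt_eqF (sig_gt0 x)) implybT.
rewrite /sparse_const -/r mulrA [(_ * K) `^ r]powRM ?mulr_ge0 ?powR_ge0//.
set A := (_ * _) `^ r; set B := _ `^ (r - 1); set S := \sum_x sig x * phi x `^ p.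
have -> : A * B * (p / (p - 1)) `^ p * K `^ r * S = A * K `^ r * B * ((p / (p - 1)) `^ p * S) by ring.
by rewrite ler_wpM2l// !mulr_ge0 ?powR_ge0.
Qed.

Definition discrete_const : R :=
  stop_const D q `^ (p / q) * sparse_const (Num.min q (p - 1)).

Lemma discrete_bound :
  \sum_x w x * (\sum_j maxavg c f 0 N j x `^ q) `^ (p / q) <=
  discrete_const * K `^ (p / Num.min q (p - 1)) *
  \sum_x F x `^ p * sig x `^ (1 - p).
Proof.
set s := Num.min q (p - 1).
have q1 := q_gt1; have p1 := p_gt1.
have s0 : 0 < s by rewrite /s lt_min; apply/andP; split; lra.
have sp : s + 1 <= p by rewrite -lerBrDr /s ge_min lexx orbT.
have sq : s <= q by rewrite /s ge_min lexx.
have q0 : 0 < q by lra.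
have S0 : 0 <= stop_const D q by have := @stop_const_ge1 R D D_ge1 q q_gt1; lra.
have pq0 : 0 <= p / q by rewrite divr_ge0; lra.
have K0 := K_ge0.
pose G t x := \sum_(k < N.+1 | principal k x) avg c k F x `^ t.
have G0 t x : 0 <= G t x by rewrite sumr_ge0// => *; exact: powR_ge0.
apply: (@le_trans _ _ (stop_const D q `^ (p / q) * \sum_x w x * G s x `^ (p / s))); last first.
  by rewrite -!mulrA ler_wpM2l ?powR_ge0// !mulrA; exact: sparse_bound.
rewrite mulr_sumr; apply: ler_sum => x _; rewrite mulrCA ler_wpM2l ?(ltW (w_gt0 x))//.
apply: (@le_trans _ _ ((stop_const D q * G q x) `^ (p / q))).
  apply: ge0_ler_powR => //; rewrite ?nnegrE.
  - by rewrite sumr_ge0// => *; exact: powR_ge0.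
  - exact: mulr_ge0 S0 (G0 _ _).
  exact: (sparse_domination c N D_ge1 q_gt1 f_ge0 F_ge0 fF).
rewrite powRM; [|exact: S0|exact: G0].
apply: ler_wpM2l; first exact: powR_ge0.
have -> : p / s = (q / s) * (p / q) by field; rewrite !gt_eqF.
rewrite [leRHS]powRrM ge0_ler_powR// ?nnegrE ?powR_ge0//.
apply: le_trans (sum_powR_le _ _ _); last 2 first.
- by rewrite ler_pdivlMr// mul1r.
- by move=> k; exact: powR_ge0.
apply: ler_sum => k _; rewrite -powRrM mulrCA divff ?mulr1//.
by rewrite gt_eqF.
Qed.

End weighted_estimate.

(** * Dyadic labels and the size of their cells *)

Lemma card_divn_fiber d e a : (a < e)%N ->
  #|[pred z : 'I_(d * e) | (z %/ d == a)%N]| = d.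
Proof.
case: d => [|d] ae; first by rewrite eq_card0// => -[].
rewrite -sum1_card.
rewrite (eq_bigl (fun z : 'I_(d.+1 * e) => (fun z => z %/ d.+1 == a)%N z))//.
rewrite -(big_mkord (fun z => (z %/ d.+1 == a)%N) (fun=> 1%N)).
have h1 : (d.+1 * a <= d.+1 * e)%N by rewrite leq_mul2l ltnW ?orbT.
have h2 : (d.+1 * a.+1 <= d.+1 * e)%N by rewrite leq_mul2l ae orbT.
have h3 : (d.+1 * a <= d.+1 * a.+1)%N by rewrite leq_mul2l leqnSn orbT.
rewrite (@big_cat_nat _ _ _ (d.+1 * a.+1))//= (@big_cat_nat _ _ _ (d.+1 * a))//=.
rewrite big_nat_cond big_pred0 ?add0n; last first.
  move=> z; apply/negP => /andP[/andP[_ h]] /eqP za.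
  by move: h; rewrite -za mulnC ltnNge leq_divM.
rewrite [X in (_ + X)%N]big_nat_cond [X in (_ + X)%N]big_pred0 ?addn0; last first.
  move=> z; apply/negP => /andP[/andP[h _]] /eqP za.
  by move: h; rewrite -za mulnC leqNgt ltn_ceil.
rewrite big_nat_cond (eq_bigl (fun z => (d.+1 * a <= z < d.+1 * a.+1)%N)).
  by rewrite -big_nat sum_nat_const_nat muln1 mulnS addnK.
move=> z; case: (boolP (_ <= _ < _)%N) => //= /andP[ha hb].
by rewrite eqn_leq leq_divRL// mulnC ha andbT -ltnS ltn_divLR// mulnC.
Qed.

Section grid_labels.
Variables (R : realType) (n m : nat).
Local Notation leafT := {ffun 'I_n -> 'I_(2 ^ m)}.

(** Dropping the last m - k binary digits of every coordinate indexes the ancestor whose side is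
    2^(m-k) leaves. Truncated subtraction makes the label constant from k = m on. *)
Definition label k (x : leafT) : {ffun 'I_n -> nat} :=
  [ffun i => (x i %/ 2 ^ (m - k))%N].

Lemma label_nested k x y : label k.+1 x = label k.+1 y -> label k x = label k y.
Proof.
move=> /ffunP h; apply/ffunP => i; have := h i; rewrite !ffunE.
have [km|mk] := ltnP k m; last first.
  have /eqP -> : (m - k == 0)%N by rewrite subn_eq0.
  by have /eqP -> : (m - k.+1 == 0)%N by rewrite subn_eq0 leqW.
have -> : (m - k = (m - k.+1).+1)%N by rewrite subnSK.
by rewrite expnSr !divnMA => ->.
Qed.

Lemma label_inj : injective (label m).
Proof.
move=> x y /ffunP h; apply/ffunP => i; have := h i.
by rewrite !ffunE subnn expn0 !divn1 => /val_inj.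
Qed.

Lemma cell_card_label k x : (k <= m)%N ->
  cell_card R label k x = ((2 ^ (m - k)) ^ n)%:R.
Proof.
move=> km; rewrite /cell_card sumr_const; congr (_%:R).
transitivity #|family (fun i => [pred z : 'I_(2 ^ m) | (z %/ 2 ^ (m - k) == x i %/ 2 ^ (m - k))%N])|.
  apply: eq_card => y; rewrite -[LHS]/(label k y == label k x).
  apply/idP/familyP => [/eqP/ffunP e i|h].
    by rewrite inE; move: (e i); rewrite !ffunE => ->.
  by apply/eqP/ffunP => i; rewrite !ffunE; have := h i; rewrite inE => /eqP.
rewrite card_family foldrE big_image /=.
rewrite -[in RHS](card_ord n) -prod_nat_const; apply: eq_bigr => i _.
have e : (2 ^ m = 2 ^ (m - k) * 2 ^ k)%N by rewrite -expnD subnK.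
have := @card_divn_fiber (2 ^ (m - k)) (2 ^ k) (x i %/ 2 ^ (m - k)).
by rewrite -e; apply; rewrite ltn_divLR ?expn_gt0// mulnC -e.
Qed.

End grid_labels.

(** * Lebesgue measure of boxes and cubes *)

Local Open Scope ereal_scope.

Section integral_upper.
Context d (T : measurableType d) (R : realType).
Variable mu : {measure set T -> \bar R}.

(** The integral of a nonnegative function is a supremum over simple functions below it, hence
    monotone. This is what lets [vmaximal] and [vnorm] be integrated and compared directly. *)
Lemma le_integral_nonmeasurable (f g : T -> \bar R) :
  (forall x, 0 <= f x) -> (forall x, f x <= g x) ->
  \int[mu]_x f x <= \int[mu]_x g x.
Proof.
move=> f0 fg; have g0 x : 0 <= g x by exact: le_trans (fg x).
rewrite !ge0_integralTE//; apply: ub_ereal_sup => _ [h hf <-].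
by apply: ereal_sup_ubound; exists h => // x; exact: le_trans (fg x).
Qed.

End integral_upper.

Section boxes.
Variables (R : realType) (n : nat).
Local Notation mu := (lebesgue_Rn R n).
Local Notation leb := (@lebesgue_measure R).

Definition box (A : 'I_n -> set R) : set (Rn R n) :=
  [set x | forall i, A i (coordinate x i)].

Lemma measurable_Rn (A : set (n.-tuple (measurableTypeR R))) :
  measurable A -> @measurable _ (Rn R n) A.
Proof. by move=> mA; apply: sub_caratheodory; exact: sub_sigma_algebra. Qed.

Lemma lebesgue_RnE (A : set (n.-tuple (measurableTypeR R))) :
  measurable A -> mu A = borel_lebesgue R n A.
Proof. by move=> mA; rewrite /lebesgue_Rn /= /completed_measure_extension measurable_mu_extE. Qed.

Lemma measurable_coordinate i :
  measurable_fun [set: Rn R n] (fun x => coordinate x i : measurableTypeR R).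
Proof.
move=> _ Y mY; apply: measurable_Rn.
by have := @measurable_tnth _ (measurableTypeR R) n i measurableT Y mY.
Qed.

Lemma measurable_tuple_box m (A : 'I_m -> set R) :
  (forall i, measurable (A i)) ->
  measurable [set x : m.-tuple (measurableTypeR R) | forall i, A i (tnth x i)].
Proof.
move=> mA.
rewrite (_ : [set x | _] = \bigcap_(i in [set: 'I_m]) ((fun x : m.-tuple (measurableTypeR R) => tnth x i) @^-1` A i)); last first.
  apply/seteqP; split => x h i; first by move=> _; exact: h.
  exact: (h i Logic.I).
apply: fin_bigcap_measurable => // i _.
have := @measurable_tnth _ (measurableTypeR R) m i measurableT (A i) (mA i).
by rewrite setTI.
Qed.

Lemma measurable_box (A : 'I_n -> set R) :
  (forall i, measurable (A i)) -> measurable (box A).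
Proof. by move=> mA; apply: measurable_Rn; exact: measurable_tuple_box. Qed.

End boxes.

Lemma power_measure_box (R : realType) m (A : 'I_m -> set R) :
  (forall i, measurable (A i)) ->
  borel_lebesgue R m [set x : m.-tuple (measurableTypeR R) | forall i, A i (tnth x i)] =
  \prod_(i < m) lebesgue_measure (A i).
Proof.
elim: m A => [|m ih] A mA.
  rewrite big_ord0 /borel_lebesgue /= diracE.
  by rewrite mem_set//; case.
rewrite big_ord_recl /borel_lebesgue /= /cons_measure.
set B := [set x : m.-tuple _ | forall i, A (lift ord0 i) (tnth x i)].
rewrite (_ : _ @^-1` _ = A ord0 `*` B).
  rewrite product_measure1E; last 2 first.
  - exact: (mA ord0).
  - by apply: (@measurable_tuple_box R m (fun i => A (lift ord0 i))) => i.
  by congr (_ * _); exact: (ih (fun i => A (lift ord0 i))).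
apply/seteqP; split => [[x t] /= h|[x t] [/= h1 h2] i].
  split => /=; first by have := h ord0; rewrite /cons_pair tnth0.
  by move=> i; have := h (lift ord0 i); rewrite tnthS.
by case: (unliftP ord0 i) => [j|] ->; rewrite ?tnthS ?tnth0//; exact: h2.
Qed.

Lemma lebesgue_box (R : realType) n (A : 'I_n -> set R) :
  (forall i, measurable (A i)) ->
  lebesgue_Rn R n (box A) = \prod_(i < n) lebesgue_measure (A i).
Proof.
by move=> mA; rewrite lebesgue_RnE ?power_measure_box//; exact: measurable_tuple_box.
Qed.

Lemma lebesgue_box_const (R : realType) n (A : 'I_n -> set R) (l : R) :
  (forall i, measurable (A i)) ->
  (forall i, lebesgue_measure (A i) = l%:E) ->
  lebesgue_Rn R n (box A) = (l ^+ n)%:E.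
Proof.
move=> mA Al; rewrite lebesgue_box// (eq_bigr (fun=> l%:E))//.
by elim: (n) => [|m ih]; rewrite ?big_ord0// big_ord_recr/= ih exprSr EFinM.
Qed.

Section cubes.
Variables (R : realType) (n : nat).
Local Notation mu := (lebesgue_Rn R n).
Implicit Types (a x : Rn R n) (l : R).

Lemma cube_box a l :
  cube a l = box (fun i => `[coordinate a i, coordinate a i + l]%classic%R).
Proof. by apply/seteqP; split => x /= h i; have := h i; rewrite /= in_itv. Qed.

Lemma measurable_cube a l : measurable (cube a l).
Proof. by rewrite cube_box; apply: measurable_box. Qed.

Lemma lebesgue_cube a l : (0 <= l)%R -> mu (cube a l) = (l ^+ n)%:E.
Proof.
move=> l0; rewrite cube_box; apply: lebesgue_box_const => // i.
rewrite lebesgue_measure_itv/= lte_fin ltrDl; case: ltP => [_|l0'].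
  by rewrite -EFinD addrAC subrr add0r.
by rewrite (_ : l = 0%R)//; apply/eqP; rewrite eq_le l0 l0'.
Qed.

Definition Rn_of (f : 'I_n -> R) : Rn R n := [tuple f i | i < n].

Lemma coordinate_Rn_of f i : coordinate (Rn_of f) i = f i.
Proof. by rewrite /coordinate /Rn_of tnth_mktuple. Qed.

End cubes.

(** * Shifted dyadic grids *)

Local Close Scope ereal_scope.

(* If both fail, each grid has an endpoint in an interval shorter than 1/3,
   so 2^k / 3 is within 1/3 of an integer. *)
Lemma one_third (R : realType) (u lam : R) k :
  (2 ^ k)%:R / 3 <= u -> lam < 1 / 3 ->
  u + lam < (Num.truncn u).+1%:R \/
  u - (2 ^ k)%:R / 3 + lam < (Num.truncn (u - (2 ^ k)%:R / 3)).+1%:R.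
Proof.
move=> ku lam3; set v := u - _.
have v0 : 0 <= v by rewrite subr_ge0.
have u0 : 0 <= u by apply: le_trans ku; rewrite divr_ge0.
have [h0|h0] := ltP (u + lam) (Num.truncn u).+1%:R; first by left.
have [h1|h1] := ltP (v + lam) (Num.truncn v).+1%:R; first by right.
have /andP[a1 a2] := truncn_itv u0; have /andP[b1 b2] := truncn_itv v0.
move: h0 h1 a1 a2 b1 b2; set a := Num.truncn u; set b := Num.truncn v.
rewrite /v -(natr1 a) -(natr1 b); set K := (2 ^ k)%N => h0 h1 a1 a2 b1 b2.
exfalso.
have M3 c : ((3 * c)%:R = 3 * c%:R :> R) by exact: natrM.
(* The two failures put K = 2^k strictly within 1 of 3 (a - b). Between integers this is equality,
   and 3 does not divide a power of 2. *)
have l1 : (3 * a < 3 * b + K + 1)%N.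
  by rewrite -(ltr_nat R) [ltRHS]natrD [in ltRHS]natrD !M3; lra.
have l2 : (3 * b + K < 3 * a + 1)%N by rewrite -(ltr_nat R) [ltLHS]natrD [ltRHS]natrD !M3; lra.
have eK : K = (3 * (a - b))%N by move: l1 l2; clear; lia.
have : (3 %| K)%N by rewrite eK dvdn_mulr.
by rewrite /K Euclid_dvdX// => /andP[].
Qed.

Section grid.
Variables (R : realType) (n m : nat) (h : R) (o : 'I_n -> R).
Hypothesis h_gt0 : 0 < h.
Local Notation mu := (lebesgue_Rn R n).
Local Notation leafT := {ffun 'I_n -> 'I_(2 ^ m)}.
Implicit Types (x y : leafT) (z : Rn R n).

(** Half-open, so that the leaves of one grid are disjoint and still cover its window. *)
Definition leaf x : set (Rn R n) :=
  box (fun i => `[o i + (x i)%:R * h, o i + (x i).+1%:R * h[%classic).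

Lemma leafP x z : leaf x z <->
  forall i, o i + (x i)%:R * h <= coordinate z i < o i + (x i).+1%:R * h.
Proof. by split => H i; have := H i; rewrite /= in_itv. Qed.

Lemma measurable_leaf x : measurable (leaf x).
Proof. by apply: measurable_box => i; exact: measurable_itv. Qed.

Lemma lebesgue_leaf x : mu (leaf x) = (h ^+ n)%:E.
Proof.
apply: lebesgue_box_const => i; first exact: measurable_itv.
rewrite lebesgue_measure_itv/= lte_fin ltrD2l ltr_pM2r// ltr_nat ltnSn.
by rewrite -EFinD -natr1; congr (_%:E); ring.
Qed.

Lemma leaf_label k x z i b : leaf x z -> (k <= m)%N ->
  o i + b%:R * ((2 ^ (m - k))%:R * h) <= coordinate z i <
  o i + b.+1%:R * ((2 ^ (m - k))%:R * h) ->
  label k x i = b.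
Proof.
move=> /leafP /(_ i) /andP[h1 h2] km /andP[b1 b2].
have d0 : (0 < 2 ^ (m - k))%N by rewrite expn_gt0.
rewrite ffunE.
have l1 : (b * 2 ^ (m - k) < (x i).+1)%N.
  by rewrite -(ltr_nat R) -(ltr_pM2r h_gt0) natrM -mulrA; lra.
have l2 : (x i < b.+1 * 2 ^ (m - k))%N.
  by rewrite -(ltr_nat R) -(ltr_pM2r h_gt0) natrM -mulrA; lra.
by apply/eqP; rewrite eqn_leq -ltnS ltn_divLR// l2/= leq_divRL.
Qed.

Lemma leaf_inj x y z : leaf x z -> leaf y z -> x = y.
Proof.
move=> xz yz; apply: (@label_inj n m); apply/ffunP => i.
apply: (leaf_label xz) => //; move/leafP: yz => /(_ i).
by rewrite subnn expn0 mul1r ffunE subnn expn0 divn1.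
Qed.

Lemma trivIset_leaf (D : set leafT) : trivIset D leaf.
Proof.
apply/trivIsetP => x y _ _ /eqP xy; apply/seteqP; split => // z [xz yz].
by apply: xy; exact: leaf_inj xz yz.
Qed.

Lemma leaf_cover z :
  (forall i, o i <= coordinate z i < o i + (2 ^ m)%:R * h) ->
  exists x, leaf x z.
Proof.
move=> zo.
have u0 i : 0 <= (coordinate z i - o i) / h.
  by have /andP[h1 _] := zo i; rewrite divr_ge0 ?(ltW h_gt0)// subr_ge0.
have ub i : (Num.truncn ((coordinate z i - o i) / h) < 2 ^ m)%N.
  by rewrite truncn_lt_nat// ltr_pdivrMr//; have /andP[_] := zo i; lra.
exists [ffun i => Ordinal (ub i)]; apply/leafP => i; rewrite ffunE /=.
have /andP[t1 t2] := truncn_itv (u0 i).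
move: t1 t2; set t := Num.truncn _; rewrite ler_pdivlMr// ltr_pdivrMr// => t1 t2.
by apply/andP; split; lra.
Qed.

Definition cell k x : set (Rn R n) :=
  \big[setU/set0]_(y <- [seq y <- index_enum leafT | label k y == label k x]) leaf y.

Lemma cellP k x z : cell k x z <-> exists2 y, label k y = label k x & leaf y z.
Proof.
rewrite /cell -bigcup_seq; split => [[y /=]|[y e yz]].
  by rewrite mem_filter => /andP[/eqP e _] yz; exists y.
by exists y => //=; rewrite mem_filter e eqxx mem_index_enum.
Qed.

Lemma measurable_cell k x : measurable (cell k x).
Proof. by apply: bigsetU_measurable => y _; exact: measurable_leaf. Qed.

Lemma integral_cell k x (g : Rn R n -> \bar R) :
  measurable_fun [set: Rn R n] g -> (forall z, 0 <= g z)%E ->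
  (\int[mu]_(z in cell k x) g z =
   \sum_(y | label k y == label k x) \int[mu]_(z in leaf y) g z)%E.
Proof.
move=> mg g0; rewrite ge0_integral_bigsetU//=.
- by rewrite big_filter.
- by move=> y; exact: measurable_leaf.
- by rewrite filter_uniq// index_enum_uniq.
- exact: trivIset_leaf.
- exact: measurable_funS mg.
Qed.

(** The A_p condition speaks of closed cubes, so the half-open cell is placed in the closed cube of
    the same side. *)
Lemma cell_in_cube k x : (k <= m)%N ->
  cell k x `<=` cube (Rn_of (fun i => o i + (label k x i)%:R * ((2 ^ (m - k))%:R * h)))
                     ((2 ^ (m - k))%:R * h).
Proof.
move=> km z /cellP[y /ffunP e /leafP yz] i; rewrite coordinate_Rn_of -e ffunE.
have /andP[h1 h2] := yz i.
have d0 : (0 < 2 ^ (m - k))%N by rewrite expn_gt0.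
set d := (2 ^ (m - k))%N in d0 *.
have l1 : ((y i %/ d)%:R * d%:R <= (y i)%:R :> R) by rewrite -natrM ler_nat leq_divM.
have l2 : ((y i).+1%:R <= (y i %/ d)%:R * d%:R + d%:R :> R).
  by rewrite -natrM -natrD ler_nat -mulSnr ltn_ceil.
have l1h := ler_wpM2r (ltW h_gt0) l1; have l2h := ler_wpM2r (ltW h_gt0) l2.
apply/andP; split; lra.
Qed.

End grid.

(** * Weighted integrals *)

Local Open Scope ereal_scope.

Section integral_inequalities.
Context d (T : measurableType d) (R : realType).
Variable mu : {measure set T -> \bar R}.

Lemma integral_gt0 (A : set T) (g : T -> \bar R) : measurable A ->
  measurable_fun A g -> (forall x, A x -> 0 < g x) -> 0 < mu A ->
  0 < \int[mu]_(x in A) g x.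
Proof.
move=> mA mg g0 muA; rewrite lt_neqAle integral_ge0 ?andbT; last first.
  by move=> x /g0 /ltW.
apply/negP => /eqP /esym int0.
have /(ae_eq_integral_abs mu mA mg) [N [mN N0 AN]] : \int[mu]_(x in A) `|g x| = 0.
  by rewrite -int0; apply: eq_integral => x; rewrite inE => /g0 /ltW /gee0_abs.
have : mu A <= mu N.
  rewrite le_measure ?inE// => x Ax; apply: AN => /= /(_ Ax) gx0.
  by have := g0 _ Ax; rewrite gx0 ltxx.
by rewrite N0 leNgt muA.
Qed.

(* The pointwise form of Young's inequality between W du and sg = W^(1-p'). *)
Definition young_pair (p : R) (W : T -> R) (sg : T -> \bar R) :=
  forall x (c u : R), (0 < c)%R -> (0 <= u)%R ->
  u%:E <= (p^-1 * c `^ (1 - p) * (u `^ p * W x))%:E +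
          ((1 - p^-1) * c)%:E * sg x.

(** Hoelder's inequality, obtained by optimising c in the integrated Young inequality. This form
    admits sg = +oo where W = 0, and c = 1 already shows that g is integrable. *)
Lemma hoelder_young_pair p (W : T -> R) (sg : T -> \bar R) (A : set T) (g : T -> R)
    (X Y : R) :
  (1 < p)%R -> young_pair p W sg -> measurable A ->
  measurable_fun A W -> measurable_fun A sg -> measurable_fun A g ->
  (forall x, 0 <= W x)%R -> (forall x, 0 <= sg x) -> (forall x, 0 <= g x)%R ->
  (0 < Y)%R -> \int[mu]_(x in A) sg x = Y%:E ->
  \int[mu]_(x in A) (g x `^ p * W x)%:E = X%:E ->
  exists2 x, \int[mu]_(t in A) (g t)%:E = x%:E & (0 <= x /\ x `^ p * Y `^ (1 - p) <= X)%R.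
Proof.
move=> p1 yp mA mW msg mg W0 sg0 g0 Y0 intY intX.
have p0 : (0 < p)%R by lra.
have ip1 : (p^-1 < 1)%R by rewrite invf_lt1.
have ip0 : (0 < p^-1)%R by rewrite invr_gt0.
have H c : (0 < c)%R -> \int[mu]_(t in A) (g t)%:E <=
    (p^-1 * c `^ (1 - p) * X + (1 - p^-1) * c * Y)%:E.
  move=> c0.
  have k1 : (0 <= p^-1 * c `^ (1 - p))%R by rewrite mulr_ge0 ?powR_ge0// ltW.
  have k2 : (0 <= (1 - p^-1) * c)%R by rewrite mulr_ge0 ?(ltW c0)// subr_ge0 ltW.
  have m1 : measurable_fun A (fun x => (g x `^ p * W x)%:E).
    apply/measurable_EFinP; apply: measurable_funM => //.
    exact: (measurableT_comp (measurable_powR p)).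
  have m2 : measurable_fun A (fun x => (p^-1 * c `^ (1 - p))%:E * (g x `^ p * W x)%:E).
    exact: measurable_funeM.
  have m3 : measurable_fun A (fun x => ((1 - p^-1) * c)%:E * sg x).
    exact: measurable_funeM.
  apply: (@le_trans _ _ (\int[mu]_(x in A) ((p^-1 * c `^ (1 - p))%:E * (g x `^ p * W x)%:E +
    ((1 - p^-1) * c)%:E * sg x))).
    apply: ge0_le_integral => //.
    - by move=> x _; rewrite lee_fin.
    - exact/measurable_EFinP.
    - exact: emeasurable_funD.
    - by move=> x _; rewrite -EFinM; exact: yp.
  rewrite ge0_integralD//; last 2 first.
  - by move=> x _; rewrite -EFinM lee_fin !mulr_ge0 ?powR_ge0// ltW.
  - by move=> x _; rewrite mule_ge0.
  rewrite !ge0_integralZl_EFin//; last by move=> x _; rewrite lee_fin mulr_ge0 ?powR_ge0.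
  by rewrite intX intY -!EFinM -EFinD.
have X0 : (0 <= X)%R.
  rewrite -lee_fin -intX; apply: integral_ge0 => x _.
  by rewrite lee_fin mulr_ge0 ?powR_ge0.
have int0 : 0 <= \int[mu]_(t in A) (g t)%:E.
  by apply: integral_ge0 => x _; rewrite lee_fin.
have fin : \int[mu]_(t in A) (g t)%:E \is a fin_num.
  by rewrite ge0_fin_numE//; apply: le_lt_trans (H 1%R ltr01) _; rewrite ltry.
exists (fine (\int[mu]_(t in A) (g t)%:E)); first by rewrite fineK.
set x := fine _; have x0 : (0 <= x)%R by rewrite fine_ge0.
split => //; have [->|xn0] := eqVneq x 0%R.
  by rewrite powR0 ?mul0r// gt_eqF.
have xgt0 : (0 < x)%R by rewrite lt_neqAle eq_sym xn0.
(* For c = x / Y the second term is (1 - 1/p) x, which moves to the left-hand side. *)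
have c0 : (0 < x / Y)%R by rewrite divr_gt0.
have := H _ c0; rewrite -(fineK fin) -/x lee_fin => Hx.
have : (x <= (x / Y) `^ (1 - p) * X)%R.
  rewrite -(ler_pM2l ip0) mulrA.
  have e : ((1 - p^-1) * (x / Y) * Y = x - p^-1 * x)%R.
    by field; apply/andP; split; lra.
  by move: Hx; rewrite e; lra.
have -> : ((x / Y) `^ (1 - p) = (x `^ (p - 1) * Y `^ (1 - p))^-1)%R.
  rewrite powRM ?invr_ge0 ?(ltW Y0)// invfM -!powRN.
  rewrite -[(Y^-1)%R]powR_inv1 ?(ltW Y0)// -powRrM.
  by congr (_ `^ _ * _ `^ _)%R; ring.
rewrite ler_pdivlMl ?mulr_gt0 ?powR_gt0//.
by rewrite mulrAC [(_ * x)%R]mulrC mulr_powRB1.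
Qed.

Lemma minkowski_integral (J : finType) (A : set T) (f : J -> T -> R) (F : T -> R)
    (q : R) (xF : R) (xf : J -> R) :
  (1 < q)%R -> measurable A -> (forall j, measurable_fun A (f j)) ->
  measurable_fun A F -> (forall j t, 0 <= f j t)%R -> (forall t, 0 <= F t)%R ->
  (forall t, \sum_j f j t `^ q <= F t `^ q)%R ->
  \int[mu]_(t in A) (F t)%:E = xF%:E ->
  (forall j, \int[mu]_(t in A) (f j t)%:E = (xf j)%:E) ->
  (\sum_j xf j `^ q <= xF `^ q)%R.
Proof.
move=> q1 mA mf mF f0 F0 fF intF intf.
apply: minkowski_dual => //.
- move=> j; rewrite -lee_fin -intf; apply: integral_ge0 => t _; by rewrite lee_fin.
- by rewrite -lee_fin -intF; apply: integral_ge0 => t _; rewrite lee_fin.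
move=> v V v0 V0 vV.
rewrite -lee_fin.
have mfv j : measurable_fun A (fun t => (f j t * v j)%:E).
  by apply/measurable_EFinP; apply: measurable_funM => //; exact: measurable_cst.
have -> : (\sum_j xf j * v j)%:E = \int[mu]_(t in A) (\sum_j (f j t * v j)%:E).
  rewrite ge0_integral_sum//; last by move=> j t _; rewrite lee_fin mulr_ge0.
  rewrite -sumEFin; apply: eq_bigr => j _; rewrite mulrC EFinM -intf.
  under [RHS]eq_integral do rewrite mulrC EFinM.
  rewrite ge0_integralZl_EFin//; last exact/measurable_EFinP.
  by move=> t _; rewrite lee_fin.
have -> : (xF * V)%:E = \int[mu]_(t in A) (V%:E * (F t)%:E).
  rewrite ge0_integralZl_EFin//; last exact/measurable_EFinP.
    by rewrite intF mulrC EFinM.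
  by move=> t _; rewrite lee_fin.
apply: ge0_le_integral => //.
- by move=> t _; apply: sume_ge0 => j _; rewrite lee_fin mulr_ge0.
- exact: emeasurable_sum.
- by apply: measurable_funeM; exact/measurable_EFinP.
move=> t _; rewrite sumEFin -EFinM lee_fin [leRHS]mulrC.
exact: (hoelder_le q1).
Qed.

End integral_inequalities.

Section dual_weight.
Variables (R : realType) (n : nat) (p : R).
Hypothesis p_gt1 : (1 < p)%R.
Implicit Types w : Rn R n -> R.

Lemma dual_exponent : (fine (hoelder_conjugate p%:E) - 1 = (p - 1)^-1)%R.
Proof.
have p1 := p_gt1.
rewrite /hoelder_conjugate /= eqe gt_eqF ?(lt_trans ltr01)//.
rewrite -EFinD inver subr_eq0 gt_eqF// -EFinM /=.
by field; lra.
Qed.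

Lemma dual_weightE w x : (0 <= w x)%R -> dual_weight p w x =
  if w x == 0%R then +oo else ((w x) `^ (- (p - 1)^-1))%:E.
Proof.
move=> w0; have p1 := p_gt1; rewrite /dual_weight dual_exponent inver.
case: ifPn => wx; first by rewrite poweRyr// invr_eq0; lra.
by rewrite poweR_EFin -[((w x)^-1)%R]powR_inv1// -powRrM mulN1r.
Qed.

Lemma dual_weight_ge0 w x : 0 <= dual_weight p w x.
Proof. exact: poweR_ge0. Qed.

Lemma dual_weight_gt0 w x : (0 <= w x)%R -> 0 < dual_weight p w x.
Proof.
move=> w0; rewrite dual_weightE//; case: ifPn => // wx.
by rewrite lte_fin powR_gt0// lt_neqAle eq_sym wx.
Qed.

Lemma measurable_dual_weight w : (forall x, 0 <= w x)%R ->
  measurable_fun [set: Rn R n] w -> measurable_fun [set: Rn R n] (dual_weight p w).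
Proof.
move=> w0 mw; rewrite (_ : dual_weight p w = fun x =>
  if w x == 0%R then +oo else ((w x) `^ (- (p - 1)^-1))%:E); last first.
  by apply/funext => x; rewrite dual_weightE.
apply: measurable_fun_ifT.
- by apply: measurable_fun_eqr => //; exact: measurable_cst.
- exact: measurable_cst.
- by apply/measurable_EFinP; exact: (measurableT_comp (measurable_powR _)).
Qed.

(** At zeros of w the right-hand side is +oo. Elsewhere apply Young's inequality to the factors u
    c^((1-p)/p) w^(1/p) and c^((p-1)/p) w^(-1/p) of u. *)
Lemma young_pair_dual w : (forall x, 0 <= w x)%R -> young_pair p w (dual_weight p w).
Proof.
move=> w0 x c u c0 u0; have p1 := p_gt1.
have p0 : (0 < p)%R by lra.
have p10 : (0 < p - 1)%R by lra.
have ip1 : (p^-1 < 1)%R by rewrite invf_lt1.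
have k2 : (0 < (1 - p^-1) * c)%R by rewrite mulr_gt0// subr_gt0.
rewrite dual_weightE//; case: ifPn => [_|wx].
  by rewrite gt0_muley ?lte_fin// addey// leey.
have wx0 : (0 < w x)%R by rewrite lt_neqAle eq_sym wx w0.
rewrite -EFinM -EFinD lee_fin.
have := young_powR p1 (a := (u * (c `^ ((1 - p) / p) * w x `^ p^-1))%R)
  (b := (c `^ ((p - 1) / p) * w x `^ (- p^-1))%R).
rewrite !mulr_ge0 ?powR_ge0// => /(_ isT isT).
rewrite -mulrA mulrACA -!powRD; last 2 first.
- by rewrite (gt_eqF wx0) implybT.
- by rewrite (gt_eqF c0) implybT.
rewrite (_ : ((1 - p) / p + (p - 1) / p = 0)%R); last by ring.
rewrite subrr !powRr0 !mulr1 => /le_trans; apply.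
rewrite !powRM ?mulr_ge0 ?powR_ge0// -!powRrM.
rewrite (_ : (1 - p) / p * p = 1 - p)%R; last by field; lra.
rewrite mulVf ?gt_eqF// powRr1//.
rewrite (_ : (p - 1) / p * (p / (p - 1)) = 1)%R; last by field; apply/andP; split; lra.
rewrite powRr1 ?(ltW c0)//.
rewrite (_ : - p^-1 * (p / (p - 1)) = - (p - 1)^-1)%R; last by field; apply/andP; split; lra.
by rewrite le_eqVlt; apply/orP; left; apply/eqP; ring.
Qed.

End dual_weight.

(** * From the finite space to a single grid *)

Section grid_estimate.
Variables (R : realType) (n : nat) (p q K : R).
Hypotheses (p_gt1 : (1 < p)%R) (q_gt1 : (1 < q)%R).
Local Notation mu := (lebesgue_Rn R n).

(** Both integrals are finite on every cube. Finiteness of [Ap_const] alone does not give this: if w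
    vanishes almost everywhere, the product is 0 * +oo = 0. *)
Definition Ap_bound (w : Rn R n -> R) := forall (a : Rn R n) (l : R), (0 < l)%R ->
  exists W S : R, [/\ \int[mu]_(z in cube a l) (w z)%:E = W%:E,
    \int[mu]_(z in cube a l) dual_weight p w z = S%:E &
    (W / l ^+ n * (S / l ^+ n) `^ (p - 1) <= K)%R].

Variable w : Rn R n -> R.
Hypotheses (w_ge0 : forall z, (0 <= w z)%R) (mw : measurable_fun [set: Rn R n] w).
Hypothesis (w_Ap : Ap_bound w).
Local Notation sg := (dual_weight p w).

Variables (m : nat) (h : R) (o : 'I_n -> R).
Hypothesis h_gt0 : (0 < h)%R.
Local Notation leafT := {ffun 'I_n -> 'I_(2 ^ m)}.
Local Notation leaf := (@leaf R n m h o).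
Local Notation cell := (@cell R n m h o).
Implicit Types (x y : leafT) (z : Rn R n).

(** An infinite integral yields the default value 0 through [fine], so identities for leaf means
    come with a finiteness hypothesis. *)
Definition leaf_mean (g : Rn R n -> \bar R) x : R :=
  (fine (\int[mu]_(z in leaf x) g z) / h ^+ n)%R.

Let hn0 : (0 < h ^+ n)%R. Proof. exact: exprn_gt0. Qed.

Lemma leaf_meanE (g : Rn R n -> \bar R) x (r : R) :
  \int[mu]_(z in leaf x) g z = r%:E -> leaf_mean g x = (r / h ^+ n)%R.
Proof. by rewrite /leaf_mean => ->. Qed.

Lemma integral_leafE (g : Rn R n -> \bar R) x : (forall z, 0 <= g z) ->
  \int[mu]_(z in leaf x) g z < +oo ->
  \int[mu]_(z in leaf x) g z = (leaf_mean g x * h ^+ n)%:E.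
Proof.
move=> g0 gfin; rewrite /leaf_mean divfK ?gt_eqF// fineK//.
by rewrite ge0_fin_numE// integral_ge0.
Qed.

Lemma leaf_mean_ge0 (g : Rn R n -> \bar R) x : (forall z, 0 <= g z) ->
  (0 <= leaf_mean g x)%R.
Proof. by move=> g0; rewrite divr_ge0 ?(ltW hn0)// fine_ge0// integral_ge0. Qed.

Lemma avg_leaf_mean (g : Rn R n -> \bar R) k x (A : set (Rn R n)) (G : R) :
  measurable_fun [set: Rn R n] g ->
  (forall z, 0 <= g z) -> (k <= m)%N -> measurable A -> cell k x `<=` A ->
  \int[mu]_(z in A) g z = G%:E ->
  (avg (@label n m) k (leaf_mean g) x <= G / ((2 ^ (m - k))%:R * h) ^+ n)%R.
Proof.
move=> mg g0 km mA cA gA.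
have cc0 := cell_card_gt0 R (@label n m) k x.
have le_sum : \sum_(y | label k y == label k x) \int[mu]_(z in leaf y) g z <= G%:E.
  rewrite -integral_cell// -gA; apply: ge0_subset_integral => //.
  - exact: measurable_cell.
  - exact: measurable_funS mg.
have fin y : label k y == label k x -> \int[mu]_(z in leaf y) g z < +oo.
  move=> yx; apply: (@le_lt_trans _ _ G%:E); last exact: ltry.
  apply: le_trans le_sum; rewrite (bigD1 y)//= leeDl// sume_ge0// => y' _.
  exact: integral_ge0.
rewrite avgE ler_pdivrMr//.
have -> : (G / ((2 ^ (m - k))%:R * h) ^+ n * cell_card R (@label n m) k x = G / h ^+ n)%R.
  have d0 : (0 < (2 ^ (m - k))%:R :> R)%R by rewrite ltr0n expn_gt0.
  rewrite cell_card_label//; move: d0; set d := (2 ^ (m - k))%N => d0.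
  by rewrite natrX exprMn; field; rewrite !expf_neq0 ?gt_eqF.
rewrite ler_pdivlMr// mulr_suml -lee_fin -sumEFin.
apply: le_trans le_sum; rewrite le_eqVlt; apply/orP; left; apply/eqP.
by apply: eq_bigr => y yx; rewrite -integral_leafE// fin.
Qed.

Lemma leaf_sub_cube x :
  leaf x `<=` cube (Rn_of (fun i => o i + (label m x i)%:R * ((2 ^ (m - m))%:R * h))%R)
                     ((2 ^ (m - m))%:R * h)%R.
Proof.
move=> z xz; apply: (cell_in_cube h_gt0 (leqnn m)); apply/cellP.
by exists x.
Qed.

Lemma Ap_leaf_bound k x : (k <= m)%N ->
  (avg (@label n m) k (leaf_mean (EFin \o w)) x *
   avg (@label n m) k (leaf_mean sg) x `^ (p - 1) <= K)%R.
Proof.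
move=> km; have p1 := p_gt1.
have sub := cell_in_cube (o := o) h_gt0 km (x := x).
set a := Rn_of _ in sub; set l := ((2 ^ (m - k))%:R * h)%R in sub.
have l0 : (0 < l)%R by rewrite mulr_gt0// ltr0n expn_gt0.
have [W [S [intW intS WS]]] := w_Ap a l0.
have w0 z : 0 <= (EFin \o w) z by rewrite lee_fin.
have sg0 z : 0 <= sg z by exact: dual_weight_ge0.
have mEw : measurable_fun [set: Rn R n] (EFin \o w) by exact/measurable_EFinP.
have msg := measurable_dual_weight p_gt1 w_ge0 mw.
have hW := avg_leaf_mean mEw w0 km (measurable_cube a l) sub intW.
have hS := avg_leaf_mean msg sg0 km (measurable_cube a l) sub intS.
apply: le_trans WS; apply: ler_pM => //.
- by apply: avg_ge0 => y; exact: leaf_mean_ge0.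
- exact: powR_ge0.
- apply: ge0_ler_powR => //; first lra.
  + by rewrite nnegrE avg_ge0// => y; exact: leaf_mean_ge0.
  + by rewrite nnegrE (le_trans _ hS)// avg_ge0// => y; exact: leaf_mean_ge0.
Qed.

Lemma leaf_weights x : [/\ \int[mu]_(z in leaf x) (w z)%:E < +oo,
  \int[mu]_(z in leaf x) sg z < +oo,
  (0 < leaf_mean sg x)%R, (0 < leaf_mean (EFin \o w) x)%R &
  (1 <= leaf_mean (EFin \o w) x * leaf_mean sg x `^ (p - 1))%R].
Proof.
have p1 := p_gt1; have sub := @leaf_sub_cube x.
set a := Rn_of _ in sub; set l := ((2 ^ (m - m))%:R * h)%R in sub.
have l0 : (0 < l)%R by rewrite mulr_gt0// ltr0n expn_gt0.
have [W [S [intW intS WS]]] := w_Ap a l0.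
have w0 z : 0 <= (EFin \o w) z by rewrite lee_fin.
have sg0 z : 0 <= sg z by exact: dual_weight_ge0.
have mEw : measurable_fun [set: Rn R n] (EFin \o w) by exact/measurable_EFinP.
have msg := measurable_dual_weight p_gt1 w_ge0 mw.
have mL : measurable (leaf x) by exact: measurable_leaf.
have mC := measurable_cube a l.
have finw : \int[mu]_(z in leaf x) (w z)%:E < +oo.
  apply: (@le_lt_trans _ _ W%:E); last exact: ltry.
  rewrite -intW; apply: (ge0_subset_integral mu mL mC _ (fun z _ => w0 z) sub).
  exact: measurable_funS mEw.
have fins : \int[mu]_(z in leaf x) sg z < +oo.
  apply: (@le_lt_trans _ _ S%:E); last exact: ltry.
  rewrite -intS; apply: (ge0_subset_integral mu mL mC _ (fun z _ => sg0 z) sub).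
  exact: measurable_funS msg.
have Ew := integral_leafE w0 finw; have Es := integral_leafE sg0 fins.
have muL : mu (leaf x) = (h ^+ n)%:E by exact: lebesgue_leaf.
have s0 : (0 < leaf_mean sg x)%R.
  rewrite -(pmulr_lgt0 _ hn0) -lte_fin -Es; apply: integral_gt0 => //.
  - exact: measurable_funS msg.
  - by move=> z _; exact: dual_weight_gt0.
  - by rewrite muL lte_fin.
have Ew1 : \int[mu]_(z in leaf x) (cst 1%R z `^ p * w z)%:E =
    (leaf_mean (EFin \o w) x * h ^+ n)%:E.
  by rewrite -Ew; apply: eq_integral => z _; rewrite /= powR1 mul1r.
(* Hoelder's inequality for the constant 1 on the leaf is the reverse A_p inequality, with lower
   bound 1. *)
have [u] := @hoelder_young_pair _ _ _ mu p w sg (leaf x) (cst 1%R)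
  (leaf_mean (EFin \o w) x * h ^+ n) (leaf_mean sg x * h ^+ n) p1
  (young_pair_dual p_gt1 w_ge0) mL (measurable_funS measurableT (@subsetT _ _) mw)
  (measurable_funS measurableT (@subsetT _ _) msg) (measurable_cst _) w_ge0 sg0
  (fun=> ler01) (mulr_gt0 s0 hn0) Es Ew1.
have -> : \int[mu]_(t in leaf x) (cst 1%R t)%:E = (h ^+ n)%:E.
  transitivity (\int[mu]_(t in leaf x) cst 1%:E t) => //.
  by rewrite integral_cst// muL mul1e.
move=> -[<-] [_].
rewrite powRM ?(ltW hn0) ?(ltW s0)// mulrCA -powRD; last first.
  by rewrite (gt_eqF hn0) implybT.
rewrite (_ : p + (1 - p) = 1)%R; last by ring.
rewrite powRr1 ?(ltW hn0)// ler_pM2r// => H.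
have H1 : (1 <= leaf_mean (EFin \o w) x * leaf_mean sg x `^ (p - 1))%R.
  rewrite -(@ler_pM2l _ (leaf_mean sg x `^ (1 - p))) ?powR_gt0//.
  rewrite mulr1 mulrCA -powRD; last by rewrite (gt_eqF s0) implybT.
  by rewrite addrA subrK subrr powRr0 mulr1.
split => //; rewrite -(@pmulr_lgt0 _ (leaf_mean sg x `^ (p - 1))) ?powR_gt0//.
exact: lt_le_trans H1.
Qed.

Variables (J : finType) (f : J -> Rn R n -> R) (X : R).
Hypotheses (f_ge0 : forall j z, (0 <= f j z)%R)
  (mf : forall j, measurable_fun [set: Rn R n] (f j)).

Definition lq_norm z : R := ((\sum_j f j z `^ q) `^ q^-1)%R.

Hypothesis intX : \int[mu]_z (lq_norm z `^ p * w z)%:E = X%:E.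

Lemma measurable_lq_norm : measurable_fun [set: Rn R n] lq_norm.
Proof.
apply: (measurableT_comp (measurable_powR _)).
apply: measurable_sum => j; exact: (measurableT_comp (measurable_powR _)).
Qed.

Lemma measurable_lq_norm_w :
  measurable_fun [set: Rn R n] (fun z => (lq_norm z `^ p * w z)%:E).
Proof.
apply/measurable_EFinP; apply: measurable_funM; last exact: mw.
apply: (measurableT_comp (measurable_powR _)); exact: measurable_lq_norm.
Qed.

Lemma le_lq_norm j z : (f j z <= lq_norm z)%R.
Proof.
have q0 : (0 < q)%R by exact: lt_trans ltr01 q_gt1.
have s0 : (0 <= \sum_j f j z `^ q)%R by apply: sumr_ge0 => *; exact: powR_ge0.
rewrite -[leLHS](powRr1 (f_ge0 j z)) -(divff (lt0r_neq0 q0)) powRrM /lq_norm.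
apply: ge0_ler_powR; rewrite ?nnegrE ?powR_ge0 ?invr_ge0 ?(ltW q0)//.
by rewrite (bigD1 j)//= lerDl sumr_ge0// => *; exact: powR_ge0.
Qed.

Lemma powR_lq_norm z : (lq_norm z `^ q = \sum_j f j z `^ q)%R.
Proof.
have q0 : (0 < q)%R by exact: lt_trans ltr01 q_gt1.
rewrite /lq_norm -powRrM mulVf ?powRr1 ?gt_eqF//.
by apply: sumr_ge0 => *; exact: powR_ge0.
Qed.

(** The last bound, Hoelder's inequality on a leaf, is the reason for the term F^p sig^(1-p) in
    [discrete_bound]. *)
Lemma leaf_functions x : [/\ \int[mu]_(z in leaf x) (lq_norm z)%:E < +oo,
   forall j, \int[mu]_(z in leaf x) (f j z)%:E < +oo,
   (\sum_j leaf_mean (EFin \o f j) x `^ q <= leaf_mean (EFin \o lq_norm) x `^ q)%R &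
   ((leaf_mean (EFin \o lq_norm) x `^ p * leaf_mean sg x `^ (1 - p) * h ^+ n)%:E <=
     \int[mu]_(z in leaf x) (lq_norm z `^ p * w z)%:E)].
Proof.
have p1 := p_gt1; have q1 := q_gt1.
have [finw fins s0 w0 ws] := leaf_weights x.
have sg0 z : 0 <= sg z by exact: dual_weight_ge0.
have mL : measurable (leaf x) by exact: measurable_leaf.
have mg := measurable_lq_norm_w.
have g0 z : 0 <= (lq_norm z `^ p * w z)%:E by rewrite lee_fin mulr_ge0 ?powR_ge0.
have F0 z : (0 <= lq_norm z)%R by exact: powR_ge0.
have fing : \int[mu]_(z in leaf x) (lq_norm z `^ p * w z)%:E < +oo.
  apply: (@le_lt_trans _ _ X%:E); last exact: ltry.
  by rewrite -intX; apply: ge0_subset_integral.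
have Es := integral_leafE sg0 fins; have Eg := integral_leafE g0 fing.
have mS (U : sigmaRingType _) (g : Rn R n -> U) : measurable_fun [set: Rn R n] g ->
    measurable_fun (leaf x) g.
  exact: (measurable_funS measurableT (@subsetT _ _)).
have msg := measurable_dual_weight p_gt1 w_ge0 mw.
have [u intu [u0 uX]] := @hoelder_young_pair _ _ _ mu p w sg (leaf x) lq_norm _ _ p1
  (young_pair_dual p_gt1 w_ge0) mL (measurable_funS measurableT (@subsetT _ _) mw)
  (measurable_funS measurableT (@subsetT _ _) msg)
  (measurable_funS measurableT (@subsetT _ _) measurable_lq_norm) w_ge0 sg0
  F0 (mulr_gt0 s0 hn0) Es Eg.
have finf j : \int[mu]_(z in leaf x) (f j z)%:E < +oo.
  apply: (@le_lt_trans _ _ u%:E); last exact: ltry.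
  rewrite -intu; apply: (ge0_le_integral mu mL).
  - by move=> z _; rewrite lee_fin.
  - by apply/measurable_EFinP; apply: measurable_funS (mf j).
  - by apply/measurable_EFinP; apply: measurable_funS measurable_lq_norm.
  - by move=> z _; rewrite lee_fin; exact: le_lq_norm.
have f0 j z : 0 <= (EFin \o f j) z by rewrite lee_fin.
have Ef j := integral_leafE (f0 j) (finf j).
have Mf := @leaf_meanE (EFin \o lq_norm) x u intu.
split => //; first by rewrite intu ltry.
- have : (\sum_j (leaf_mean (EFin \o f j) x * h ^+ n) `^ q <= u `^ q)%R.
    apply: (@minkowski_integral _ _ _ mu J (leaf x) f lq_norm q u
      (fun j => leaf_mean (EFin \o f j) x * h ^+ n)%R q1 mL) => //.
    + by move=> j; apply: measurable_funS (mf j).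
    + exact: measurable_funS measurable_lq_norm.
    + by move=> z; rewrite powR_lq_norm.
  have -> : (u = leaf_mean (EFin \o lq_norm) x * h ^+ n)%R.
    by rewrite Mf divfK// gt_eqF.
  under eq_bigr do rewrite powRM ?(ltW hn0) ?leaf_mean_ge0//.
  rewrite -mulr_suml powRM ?(ltW hn0)//; last by apply: leaf_mean_ge0 => z; rewrite lee_fin.
  by rewrite ler_pM2r ?powR_gt0.
rewrite Eg lee_fin; apply: le_trans uX.
have -> : (u = leaf_mean (EFin \o lq_norm) x * h ^+ n)%R.
  by rewrite Mf divfK// gt_eqF.
have M0 : (0 <= leaf_mean (EFin \o lq_norm) x)%R.
  by apply: leaf_mean_ge0 => z; rewrite lee_fin.
move: s0 M0; have := hn0; set H := (h ^+ n)%R.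
move: (leaf_mean sg x) (leaf_mean (EFin \o lq_norm) x) => S M H0 s0 M0.
rewrite !powRM ?(ltW H0) ?(ltW s0)// mulrACA -powRD; last first.
  by rewrite (gt_eqF H0) implybT.
by rewrite (_ : p + (1 - p) = 1)%R ?powRr1 ?(ltW H0)//; ring.
Qed.

Lemma grid_estimate :
  (\sum_x leaf_mean (EFin \o w) x * h ^+ n *
     (\sum_j maxavg (@label n m) (fun j => leaf_mean (EFin \o f j)) 0 m j x `^ q) `^ (p / q)
   <= discrete_const (2 ^ n)%:R q p * K `^ (p / Num.min q (p - 1)) * X)%R.
Proof.
have F0 z : (0 <= lq_norm z)%R by exact: powR_ge0.
have ex0 : (0 < 2 ^ m)%N by rewrite expn_gt0.
have K0 : (0 <= K)%R.
  apply: le_trans (Ap_leaf_bound [ffun=> Ordinal ex0] (leq0n m)).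
  rewrite mulr_ge0 ?powR_ge0// avg_ge0// => y; apply: leaf_mean_ge0 => z.
  by rewrite lee_fin.
have D1 : (1 <= (2 ^ n)%:R :> R)%R by rewrite ler1n expn_gt0.
have db k x : (k < m)%N -> (cell_card R (@label n m) k x <=
    (2 ^ n)%:R * cell_card R (@label n m) k.+1 x)%R.
  move=> km; rewrite !cell_card_label ?(ltnW km)// -natrM ler_nat -expnMn -expnS.
  by rewrite subnSK.
have := @discrete_bound R _ _ (@label n m) (@label_nested n m) m (@label_inj n m)
  _ D1 db J (fun j => leaf_mean (EFin \o f j)) (leaf_mean (EFin \o lq_norm)) q q_gt1
  _ _ _ p K (leaf_mean (EFin \o w)) (leaf_mean sg) p_gt1 K0 _ _ _ _.
move=> /(_ _ _ _ _ _ _ _) H.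
under eq_bigr do rewrite mulrAC.
rewrite -mulr_suml.
apply: (@le_trans _ _ (discrete_const (2 ^ n)%:R q p * K `^ (p / Num.min q (p - 1)) *
  (\sum_x leaf_mean (EFin \o lq_norm) x `^ p * leaf_mean sg x `^ (1 - p)) * h ^+ n)%R).
  rewrite ler_pM2r//; apply: H.
  - by move=> j x; apply: leaf_mean_ge0 => z; rewrite lee_fin.
  - by move=> x; apply: leaf_mean_ge0 => z; rewrite lee_fin.
  - by move=> x; have [] := leaf_functions x.
  - by move=> x; have [] := leaf_weights x.
  - by move=> x; have [] := leaf_weights x.
  - by move=> k x km; exact: Ap_leaf_bound.
  - by move=> x; have [] := leaf_weights x.
rewrite -mulrA ler_wpM2l//.
  by rewrite /discrete_const /sparse_const !mulr_ge0 ?powR_ge0.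
rewrite mulr_suml -lee_fin -sumEFin -intX.
apply: (@le_trans _ _ (\sum_x \int[mu]_(z in leaf x) (lq_norm z `^ p * w z)%:E)).
  by apply: lee_sum => x _; have [] := leaf_functions x.
have g0 z : 0 <= (lq_norm z `^ p * w z)%:E by rewrite lee_fin mulr_ge0 ?powR_ge0.
rewrite -(@ge0_integral_bigsetU _ _ _ mu _ leaf).
- apply: (ge0_subset_integral mu _ measurableT measurable_lq_norm_w) => //.
  by apply: bigsetU_measurable => x _; exact: measurable_leaf.
- by move=> x; exact: measurable_leaf.
- exact: index_enum_uniq.
- exact: trivIset_leaf.
- exact: measurable_funS measurable_lq_norm_w.
- by move=> z _.
Qed.

End grid_estimate.

(** * Finiteness on cubes of A_p weights, and families of suprema *)

Section Ap_weights.
Variables (R : realType) (n : nat) (p : R).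
Hypothesis p_gt1 : (1 < p)%R.
Local Notation mu := (lebesgue_Rn R n).
Variable w : Rn R n -> R.
Hypothesis w_Ap : Ap p w.

Lemma centered_cubeP (N : nat) (z : Rn R n) :
  cube (Rn_of (fun=> - N%:R)%R) (2 * N%:R)%R z <->
  forall i, (- N%:R <= coordinate z i <= N%:R)%R.
Proof.
split => H i; have := H i; rewrite coordinate_Rn_of.
  by rewrite (_ : - N%:R + 2 * N%:R = N%:R)%R//; ring.
by rewrite (_ : - N%:R + 2 * N%:R = N%:R)%R//; ring.
Qed.

Lemma cube_eventually_centered (a : Rn R n) (l : R) :
  exists N0, forall N, (N0 <= N)%N ->
    cube a l `<=` cube (Rn_of (fun=> - N%:R)%R) (2 * N%:R)%R.
Proof.
pose M := (\sum_(i < n) (`|coordinate a i| + `|l|))%R.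
exists (Num.truncn M).+1 => N MN z zQ; apply/centered_cubeP => i.
have MNR : (M <= N%:R)%R.
  by apply: ltW; apply: lt_le_trans (truncnS_gt M) _; rewrite ler_nat.
have : (`|coordinate a i| + `|l| <= M)%R.
  by rewrite /M (bigD1 i)//= lerDl sumr_ge0// => k _; rewrite addr_ge0.
have /andP[z1 z2] := zQ i.
have := ler_norm (coordinate a i); have := lerNnormlW (lexx `|coordinate a i|)%R.
have := ler_norm l; rewrite -normrN; have := ler_norm (- coordinate a i)%R.
by rewrite normrN => *; apply/andP; split; lra.
Qed.

Lemma averageE (g : Rn R n -> \bar R) a l : (0 < l)%R ->
  average g (cube a l) = ((l ^+ n)^-1)%:E * \int[mu]_(z in cube a l) g z.
Proof.
move=> l0; rewrite /average lebesgue_cube ?ltW// inver gt_eqF//.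
exact: exprn_gt0.
Qed.

(** Unless w vanishes almost everywhere, some centered cube has positive mass, and this forces the
    dual weight to be locally integrable. *)
Lemma Ap_cases : \int[mu]_z (w z)%:E = 0 \/
  exists2 K : R, Ap_const p w = K%:E & Ap_bound p K w.
Proof.
have [[mw w0 wfin] Apfin] := w_Ap; have p1 := p_gt1.
have mEw : measurable_fun [set: Rn R n] (EFin \o w) by exact/measurable_EFinP.
have w0' z : 0 <= (EFin \o w) z by rewrite lee_fin.
have msg := measurable_dual_weight p_gt1 w0 mw.
have sg0 z : 0 <= dual_weight p w z by exact: dual_weight_ge0.
pose Q N : set (Rn R n) := cube (Rn_of (fun=> - N%:R)%R) (2 * N%:R)%R.
have mQ N : measurable (Q N) by exact: measurable_cube.
have [allz|/existsNP[N0 N0z]] := pselect (forall N, \int[mu]_(z in Q N) (w z)%:E = 0).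
  left; have cvgQ : \int[mu]_(z in Q N) (w z)%:E @[N --> \oo] -->
      \int[mu]_(z in \bigcup_N Q N) (w z)%:E.
    apply: ge0_nondecreasing_set_cvg_integral.
    - move=> i j ij; apply/subsetPset => z /centered_cubeP zi; apply/centered_cubeP => k.
      have /andP[h1 h2] := zi k.
      have ij' : (i%:R <= j%:R :> R)%R by rewrite ler_nat.
      by move: h1 h2 ij'; clear => *; apply/andP; split; lra.
    - exact: mQ.
    - by move=> i; exact: measurable_funS mEw.
    - by move=> i z _; exact: w0'.
  have UQ : \bigcup_N Q N = [set: Rn R n].
    apply/seteqP; split => // z _.
    have [N0 /(_ N0 (leqnn _)) H] := cube_eventually_centered z 1%R.
    by exists N0 => //; apply: H => i; rewrite lexx lerDl ler01.
  rewrite UQ in cvgQ; apply: (cvg_unique _ cvgQ) => //=.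
  by under eq_fun do rewrite allz; exact: cvg_cst.
right.
have Apge0 : 0 <= Ap_const p w.
  apply: (@le_trans _ _ (average (EFin \o w) (Q 1%N) *
    average (dual_weight p w) (Q 1%N) `^ (p - 1))).
    rewrite /Q; have l0 : (0 < 2 * 1%:R :> R)%R by lra.
    rewrite !averageE//; apply: mule_ge0; last exact: poweR_ge0.
    apply: mule_ge0; last exact: integral_ge0.
    by rewrite lee_fin invr_ge0 exprn_ge0// ltW.
  apply: ereal_sup_ubound; exists (Q 1%N) => //; eexists; eexists; split; last reflexivity.
  lra.
have fK : Ap_const p w \is a fin_num by rewrite ge0_fin_numE.
exists (fine (Ap_const p w)); first by rewrite fineK.
have N0gt0 : 0 < \int[mu]_(z in Q N0) (w z)%:E.
  rewrite lt_neqAle; apply/andP; split; first by rewrite eq_sym; exact/eqP.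
  by apply: integral_ge0 => z _; exact: w0'.
have sfin a l : (0 < l)%R -> \int[mu]_(z in cube a l) dual_weight p w z < +oo.
  move=> l0; have [N1 H1] := cube_eventually_centered a l.
  (* This cube contains the given one and one of positive mass; an infinite dual integral over it
     would make the A_p product infinite. *)
  pose N := (maxn N0 N1).+1; pose Q' := Q N.
  have mQ' : measurable Q' by exact: mQ.
  have L0 : (0 < 2 * N%:R :> R)%R by rewrite mulr_gt0// ltr0n.
  have int_gt0 : 0 < \int[mu]_(z in Q') (w z)%:E.
    apply: lt_le_trans N0gt0 _.
    apply: (ge0_subset_integral mu (mQ N0) mQ' _ (fun z _ => w0' z)).
      exact: measurable_funS mEw.
    move=> z /centered_cubeP zi; apply/centered_cubeP => k.
    have /andP[h1 h2] := zi k.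
    have ij' : (N0%:R <= N%:R :> R)%R by rewrite ler_nat leqW// leq_maxl.
    by move: h1 h2 ij'; clear => *; apply/andP; split; lra.
  have lt1 : average (EFin \o w) Q' * average (dual_weight p w) Q' `^ (p - 1) < +oo.
    apply: le_lt_trans Apfin; apply: ereal_sup_ubound; exists Q' => //.
    by eexists; eexists; split; [exact: L0|reflexivity].
  have av0 : 0 < average (EFin \o w) Q'.
    by rewrite averageE// mule_gt0// lte_fin invr_gt0 exprn_gt0.
  have : average (dual_weight p w) Q' < +oo.
    apply: (@lty_poweRy R _ (p - 1)%R); first by rewrite subr_eq0 gt_eqF.
    rewrite ltey; apply/eqP => e; move: lt1; rewrite e gt0_muley// ltxx//.
  rewrite averageE// => H2.
  apply: (@le_lt_trans _ _ (\int[mu]_(z in Q') dual_weight p w z)).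
    apply: (ge0_subset_integral mu (measurable_cube a l) mQ' _ (fun z _ => sg0 z)).
      exact: measurable_funS msg.
    by apply: H1; rewrite leqW// leq_maxr.
  rewrite ltey; apply/eqP => e; move: H2; rewrite e gt0_muley ?ltxx//.
  by rewrite lte_fin invr_gt0 exprn_gt0.
move=> a l l0; have ln0 : (0 < l ^+ n)%R by exact: exprn_gt0.
have Qc : cubes (cube a l) by exists a, l.
have wf := wfin _ Qc; have sf := sfin a l l0.
have wf' : \int[mu]_(z in cube a l) (w z)%:E \is a fin_num.
  by rewrite ge0_fin_numE//; apply: integral_ge0 => z _; exact: w0'.
have sf' : \int[mu]_(z in cube a l) dual_weight p w z \is a fin_num.
  by rewrite ge0_fin_numE// integral_ge0.
have [W eW] : exists W, \int[mu]_(z in cube a l) (w z)%:E = W%:E.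
  by eexists; rewrite -[LHS]fineK.
have [S eS] : exists S, \int[mu]_(z in cube a l) dual_weight p w z = S%:E.
  by eexists; rewrite -[LHS]fineK.
exists W, S; split => //; rewrite -lee_fin fineK//.
have : average (EFin \o w) (cube a l) * average (dual_weight p w) (cube a l) `^ (p - 1) <= Ap_const p w.
  by apply: ereal_sup_ubound; exists (cube a l).
apply: le_trans; rewrite !averageE// eW eS -!EFinM lee_fin.
by rewrite [(W / _)%R]mulrC [(S / _)%R]mulrC.
Qed.

End Ap_weights.

(** Each maximal function has its own supremum over cubes; this allows fixing one cube per index
    beforehand. In the induction the last choice y is frozen, the others are bounded with lam - y^q,
    and the supremum over y comes last. *)
Lemma sup_sum_poweR (R : realType) (q lam : R) (A : nat -> set (\bar R)) (J : nat) :
  (0 < q)%R -> (forall j, A j !=set0) -> (forall j x, A j x -> 0 <= x) ->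
  (forall x : nat -> \bar R, (forall j, A j (x j)) ->
     \sum_(j < J) x j `^ q <= lam%:E) ->
  \sum_(j < J) (ereal_sup (A j)) `^ q <= lam%:E.
Proof.
move=> q0 An0 A0; elim: J lam => [|J ih] lam H.
  pose x j := projT1 (cid (An0 j)).
  by have := H x (fun j => projT2 (cid (An0 j))); rewrite !big_ord0.
have supge0 j : 0 <= ereal_sup (A j).
  by have [x Ax] := An0 j; apply: le_trans (A0 _ _ Ax) _; exact: ereal_sup_ubound.
have sum0 (x : nat -> \bar R) : 0 <= \sum_(j < J) x j `^ q.
  by apply: sume_ge0 => *; exact: poweR_ge0.
have key y : A J y -> \sum_(j < J) ereal_sup (A j) `^ q + y `^ q <= lam%:E.
  move=> Ay.
  have yfin : y `^ q \is a fin_num.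
    rewrite ge0_fin_numE ?poweR_ge0//; apply: (@le_lt_trans _ _ lam%:E); last exact: ltry.
    pose x j := if j == J then y else projT1 (cid (An0 j)).
    have Hx : forall j, A j (x j).
      move=> j; rewrite /x; case: eqP => [->//|_]; exact: (projT2 (cid (An0 j))).
    have := H x Hx; rewrite big_ord_recr/= {2}/x eqxx; apply: le_trans.
    by rewrite leeDr// sum0.
  rewrite -leeBrDr// -[X in _ <= _ - X]fineK// -EFinB; apply: ih => x Ax.
  rewrite EFinB fineK// leeBrDr//.
  pose x' j := if j == J then y else x j.
  have Hx' : forall j, A j (x' j) by move=> j; rewrite /x'; case: eqP => [->|].
  have := H x' Hx'; rewrite big_ord_recr/= {2}/x' eqxx; apply: le_trans.
  rewrite leeD2r//; apply: lee_sum => j _; rewrite /x' ifF//.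
  by apply/negbTE; rewrite neq_ltn ltn_ord.
rewrite big_ord_recr/=.
set S := \sum_(j < J) _ in key *.
have S0 : 0 <= S by exact: (sum0 (fun j => ereal_sup (A j))).
have Sfin : S \is a fin_num.
  rewrite ge0_fin_numE//; have [y Ay] := An0 J.
  apply: (@le_lt_trans _ _ lam%:E); last exact: ltry.
  by apply: le_trans (key _ Ay); rewrite leeDl// poweR_ge0.
rewrite -leeBrDl//.
have b0 : 0 <= lam%:E - S.
  have [y Ay] := An0 J; rewrite leeBrDl// adde0.
  by apply: le_trans (key _ Ay); rewrite leeDl// poweR_ge0.
have q0' : q != 0%R by rewrite gt_eqF.
have -> : lam%:E - S = ((lam%:E - S) `^ q^-1) `^ q.
  by rewrite -poweRrM mulVf// poweRe1.
apply: gt0_ler_poweR; first exact: ltW.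
- by rewrite in_itv/= supge0 leey.
- by rewrite in_itv/= poweR_ge0 leey.
apply: ub_ereal_sup => y Ay.
have -> : y = (y `^ q) `^ q^-1.
  by rewrite -poweRrM divff// poweRe1// (A0 _ _ Ay).
apply: gt0_ler_poweR; first by rewrite invr_ge0 ltW.
- by rewrite in_itv/= poweR_ge0 leey.
- by rewrite in_itv/= b0 leey.
by rewrite leeBrDl//; exact: key.
Qed.

Local Close Scope ereal_scope.

(** * Capturing a cube in a cell of a shifted grid *)

Section dyadic_grids.
Variables (R : realType) (n : nat).
Local Notation mu := (lebesgue_Rn R n).

(** At stage N the window has side 2^N and the leaves have side 2^-N: the windows exhaust the space
    while the mesh tends to 0. *)
Definition depth N := (2 * N)%N.
Definition mesh N : R := (2 ^+ N)^-1.
(* Shifting by a third of the top side moves each dyadic grid of a smaller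
   scale by one or two thirds of its own side. *)
Definition origin N (T : {ffun 'I_n -> bool}) (i : 'I_n) : R :=
  - (2 ^+ N / 2) + (if T i then 2 ^+ N / 3 else 0).
Local Notation leafN N T := (@leaf R n (depth N) (mesh N) (origin N T)).
Local Notation cellN N T := (@cell R n (depth N) (mesh N) (origin N T)).

Lemma mesh_gt0 N : 0 < mesh N.
Proof. by rewrite invr_gt0 exprn_gt0. Qed.

Lemma mesh_top N : (2 ^ depth N)%:R * mesh N = 2 ^+ N.
Proof.
by rewrite /depth mulnC expnM natrX natrX expr2 mulfK// expf_neq0.
Qed.

Lemma le_exp2 N : N%:R <= 2 ^+ N :> R.
Proof. by rewrite -natrX ler_nat ltnW// ltn_expl. Qed.

(** The largest available dyadic side not exceeding 6 l. Being above 3 l, it gives lam < 1/3 in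
    [one_third]; being at most 6 l, it costs 6^n in the averages. *)
Lemma dyadic_scale (l : R) : 0 < l -> exists N0, forall N, (N0 <= N)%N ->
  exists2 k, (k <= depth N)%N &
    3 * l < (2 ^ (depth N - k))%:R * mesh N <= 6 * l.
Proof.
move=> l0; exists (maxn (Num.truncn (6 * l)).+1 (Num.truncn (6 * l)^-1).+1) => N.
rewrite geq_max => /andP[N1 N2].
have n1 : 6 * l <= 2 ^+ N.
  apply: le_trans (le_exp2 N); apply/ltW/(lt_le_trans (truncnS_gt _)).
  by rewrite ler_nat.
have n2 : (6 * l)^-1 <= 2 ^+ N.
  apply: le_trans (le_exp2 N); apply/ltW/(lt_le_trans (truncnS_gt _)).
  by rewrite ler_nat.
have e0 : 0 < 2 ^+ N :> R by rewrite exprn_gt0.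
have l6 : 0 < 6 * l by lra.
pose y := 6 * l * 2 ^+ N; have y1 : 1 <= y.
  by rewrite /y -ler_pdivrMl// mulr1.
have y0 : 0 <= y by lra.
have /andP[t1 t2] := truncn_itv y0.
have tgt0 : (0 < Num.truncn y)%N by rewrite truncn_gt0.
have /andP[j1 j2] := trunc_log_bounds (ltnSn 1) tgt0.
set j := trunc_log 2 (Num.truncn y) in j1 j2.
have ley : (2 ^ j)%:R <= y by apply: le_trans t1; rewrite ler_nat.
have gty : y < (2 ^ j.+1)%:R by apply: (lt_le_trans t2); rewrite ler_nat.
have jd : (j <= depth N)%N.
  rewrite -(@leq_exp2l 2)// -(ler_nat R); apply: (le_trans ley).
  by rewrite -[leRHS](@mulfK _ (mesh N)) ?gt_eqF ?mesh_gt0// mesh_top invrK ler_pM2r.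
exists (depth N - j)%N; first exact: leq_subr.
rewrite subKn// /mesh ltr_pdivlMr// ler_pdivrMr// -/y ley andbT.
by move: gty; rewrite expnS natrM /y; lra.
Qed.

(** In units of the cell side D the shift 2^N / 3 equals 2^k / 3, and the lower bound on a becomes
    the lower bound on u in [one_third]. *)
Lemma half_open_interval N k (a l : R) : (k <= depth N)%N -> 0 < l ->
  - (2 ^+ N / 6) <= a ->
  let D := (2 ^ (depth N - k))%:R * mesh N in
  3 * l < D -> exists (t : bool) (b : nat),
    let o := - (2 ^+ N / 2) + (if t then 2 ^+ N / 3 else 0) in
    o + b%:R * D <= a /\ a + l < o + b.+1%:R * D.
Proof.
move=> km l0 a6 D lD.
have D0 : 0 < D by rewrite mulr_gt0 ?mesh_gt0// ltr0n expn_gt0.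
have topD : (2 ^ k)%:R * D = 2 ^+ N.
  by rewrite /D mulrA -natrM -expnD subnKC// mesh_top.
pose u := (a + 2 ^+ N / 2) / D; pose lam := l / D.
have lam3 : lam < 1 / 3 by rewrite /lam ltr_pdivrMr//; lra.
have ku : (2 ^ k)%:R / 3 <= u by rewrite /u ler_pdivlMr// mulrAC topD; lra.
have [H|H] := one_third ku lam3.
  exists false, (Num.truncn u) => /=; rewrite addr0.
  have u0 : 0 <= u by apply: le_trans ku; rewrite divr_ge0.
  have /andP[t1 _] := truncn_itv u0.
  move: t1 H; set t := Num.truncn u; rewrite {1}/u ler_pdivlMr// => t1.
  by rewrite /u /lam -mulrDl ltr_pdivrMr// => t2; split; lra.
set v := u - _ in H; exists true, (Num.truncn v) => /=.
have v0 : 0 <= v by rewrite /v subr_ge0.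
have /andP[t1 _] := truncn_itv v0.
have vE : v * D = a + 2 ^+ N / 2 - 2 ^+ N / 3.
  by rewrite /v mulrBl /u divfK ?gt_eqF// mulrAC topD.
move: t1 H; set t := Num.truncn v; rewrite -(ler_pM2r D0) vE => t1.
rewrite -(ltr_pM2r D0) mulrDl vE /lam divfK ?gt_eqF// => t2.
by split; lra.
Qed.

(** The shift is chosen in each coordinate separately, whence 2^n grids. *)
Lemma cube_in_cell (a : Rn R n) (l : R) : 0 < l -> exists N0, forall N, (N0 <= N)%N ->
  exists (T : {ffun 'I_n -> bool}) (k : nat),
  [/\ (k <= depth N)%N, (2 ^ (depth N - k))%:R * mesh N <= 6 * l &
   forall z, cube a l z -> exists2 x, leafN N T x z & cube a l `<=` cellN N T k x].
Proof.
move=> l0; have [N1 H1] := dyadic_scale l0.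
have [N2 H2] := cube_eventually_centered a l.
exists (maxn N1 (6 * N2)) => N; rewrite geq_max => /andP[NN1 NN2].
have [k kN /andP[lD Dl]] := H1 _ NN1.
set D := _ * mesh N in lD Dl.
have D0 : 0 < D by rewrite mulr_gt0 ?mesh_gt0// ltr0n expn_gt0.
have N2e : N2%:R <= 2 ^+ N / 6 :> R.
  rewrite ler_pdivlMr// mulrC; apply: le_trans (le_exp2 N).
  by rewrite -natrM ler_nat.
(* This range lies in the windows of all shifts: unshifted they run from -2^N/2 to 2^N/2, shifted
   from -2^N/6 to 5 * 2^N/6. *)
have region z i : cube a l z -> - (2 ^+ N / 6) <= coordinate z i <= 2 ^+ N / 6.
  move=> /(H2 _ (leqnn N2)) /centered_cubeP /(_ i) /andP[h1 h2].
  by apply/andP; split; lra.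
have ca : cube a l a by move=> i; rewrite lexx lerDl ltW.
have C i : exists tb : bool * nat,
    let o := - (2 ^+ N / 2) + (if tb.1 then 2 ^+ N / 3 else 0) in
    o + tb.2%:R * D <= coordinate a i /\ coordinate a i + l < o + tb.2.+1%:R * D.
  have /andP[a6 _] := region _ i ca.
  by have [t [b H]] := half_open_interval kN l0 a6 lD; exists (t, b).
pose tb i := projT1 (cid (C i)); pose tbP i := projT2 (cid (C i)).
pose T := [ffun i => (tb i).1].
have labelE x z : cube a l z -> leafN N T x z -> forall i, label k x i = (tb i).2.
  move=> zQ xz i; apply: (leaf_label (mesh_gt0 N) xz kN).
  have [h1 h2] := tbP i; have /andP[h3 h4] := zQ i.
  by rewrite /origin ffunE; apply/andP; split; [exact: le_trans h3|exact: le_lt_trans h4 h2].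
exists T, k; split => // z zQ.
have [x xz] : exists x, leafN N T x z.
  apply: leaf_cover; first exact: mesh_gt0.
  move=> i; have /andP[h1 h2] := region _ i zQ; rewrite mesh_top /origin.
  have e0 : 0 < 2 ^+ N :> R by rewrite exprn_gt0.
  by case: (T i); move: e0 h1 h2; clear => *; apply/andP; split; lra.
exists x => // z' z'Q.
have [x' x'z'] : exists x, leafN N T x z'.
  apply: leaf_cover; first exact: mesh_gt0.
  move=> i; have /andP[h1 h2] := region _ i z'Q; rewrite mesh_top /origin.
  have e0 : 0 < 2 ^+ N :> R by rewrite exprn_gt0.
  by case: (T i); move: e0 h1 h2; clear => *; apply/andP; split; lra.
apply/cellP; exists x' => //; apply/ffunP => i.
by rewrite (labelE _ _ z'Q x'z') (labelE _ _ zQ xz).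
Qed.

Lemma average_le_maxavg (m k : nat) (h : R) (o : 'I_n -> R) (J : finType)
    (f : J -> Rn R n -> R) j (a : Rn R n) (l : R) x :
  0 < h -> 0 < l -> (k <= m)%N -> (2 ^ (m - k))%:R * h <= 6 * l ->
  (forall j z, 0 <= f j z) -> measurable_fun [set: Rn R n] (f j) ->
  (forall y, \int[mu]_(z in @leaf R n m h o y) (f j z)%:E < +oo)%E ->
  cube a l `<=` @cell R n m h o k x ->
  (average (EFin \o f j) (cube a l) <=
   (6 ^+ n * maxavg (@label n m) (fun j => leaf_mean h o (EFin \o f j)) 0 m j x)%:E)%E.
Proof.
move=> h0 l0 km Dl f0 mf fin sub.
have ln0 : 0 < l ^+ n by exact: exprn_gt0.
have hn0 : 0 < h ^+ n by exact: exprn_gt0.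
have f0' z : (0 <= (EFin \o f j) z)%E by rewrite lee_fin.
have mEf : measurable_fun [set: Rn R n] (EFin \o f j) by exact/measurable_EFinP.
have M0 (y : {ffun 'I_n -> 'I_(2 ^ m)}) : 0 <= leaf_mean h o (EFin \o f j) y by exact: leaf_mean_ge0.
have av0 : 0 <= avg (@label n m) k (leaf_mean h o (EFin \o f j)) x by exact: avg_ge0.
have avM : avg (@label n m) k (leaf_mean h o (EFin \o f j)) x <=
    maxavg (@label n m) (fun j => leaf_mean h o (EFin \o f j)) 0 m j x.
  rewrite /maxavg subn0.
  exact: (le_rmax (fun m' => avg (@label n m) (0 + m') (leaf_mean h o (EFin \o f j))) x km).
rewrite averageE//.
apply: (@le_trans _ _ ((l ^+ n)^-1%:E * \int[mu]_(z in cell h o k x) (EFin \o f j) z)%E).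
  rewrite lee_wpmul2l ?lee_fin ?invr_ge0 ?(ltW ln0)//.
  apply: ge0_subset_integral => //; first exact: measurable_cube.
    exact: measurable_cell.
  exact: measurable_funS mEf.
rewrite integral_cell//.
rewrite (eq_bigr (fun y => (leaf_mean h o (EFin \o f j) y * h ^+ n)%:E)); last first.
  by move=> y _; rewrite -integral_leafE.
rewrite sumEFin -EFinM lee_fin -mulr_suml.
rewrite (_ : \sum_(y | _) _ = avg (@label n m) k (leaf_mean h o (EFin \o f j)) x *
    cell_card R (@label n m) k x); last first.
  by rewrite avgE divfK// gt_eqF// cell_card_gt0.
rewrite cell_card_label//.
have -> : (l ^+ n)^-1 * (avg (@label n m) k (leaf_mean h o (EFin \o f j)) x *
     ((2 ^ (m - k)) ^ n)%:R * h ^+ n) =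
   (((2 ^ (m - k))%:R * h) ^+ n / l ^+ n) * avg (@label n m) k (leaf_mean h o (EFin \o f j)) x.
  by rewrite natrX exprMn; ring.
apply: ler_pM => //; first by rewrite divr_ge0 ?exprn_ge0 ?mulr_ge0 ?(ltW h0) ?(ltW l0).
rewrite -expr_div_n; apply: lerXn2r; rewrite ?nnegrE//.
  by rewrite divr_ge0 ?mulr_ge0 ?(ltW h0) ?(ltW l0).
by rewrite ler_pdivrMr.
Qed.

End dyadic_grids.

(** * The upper bound *)

Local Open Scope ereal_scope.

Lemma le_limn_einf (R : realType) (u : (\bar R)^nat) (b : \bar R) N0 :
  (forall N, (N0 <= N)%N -> b <= u N) -> b <= limn_einf u.
Proof.
move=> bu; rewrite limn_einf_lim.
apply: lime_ge; first exact: is_cvg_einfs.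
exists N0 => // N /= NN; apply: le_ereal_inf_tmp => _ [k /= Nk <-].
by apply: bu; exact: leq_trans Nk.
Qed.

Lemma nneseries_le (R : realType) (u : (\bar R)^nat) (b : \bar R) :
  (forall j, 0 <= u j) -> (forall J, \sum_(j < J) u j <= b) ->
  \sum_(j <oo) u j <= b.
Proof.
move=> u0 ub; apply: lime_le; first exact: is_cvg_nneseries.
by exists 0%N => // J _ /=; rewrite big_mkord; exact: ub.
Qed.

Lemma ler_poweR (R : realType) (x y : \bar R) (r : R) : (0 <= r)%R -> 0 <= x -> x <= y ->
  x `^ r <= y `^ r.
Proof.
move=> r0 x0 xy; apply: gt0_ler_poweR => //; rewrite in_itv/= ?x0 leey//.
by rewrite (le_trans x0 xy).
Qed.

Section integral_step_function.
Context d (T : measurableType d) (R : realType).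
Variables (mu : {measure set T -> \bar R}) (I J : finType).
Variables (c : I -> J -> R) (A : I -> J -> set T) (g : T -> \bar R).
Hypotheses (c_ge0 : forall i j, (0 <= c i j)%R) (mA : forall i j, measurable (A i j)).
Hypotheses (mg : measurable_fun [set: T] g) (g_ge0 : forall x, 0 <= g x).

Lemma step_term_ge0 i j x : 0 <= (c i j)%:E * (g \_ (A i j)) x.
Proof.
by apply: mule_ge0; rewrite ?lee_fin// patchE; case: ifP.
Qed.

Lemma measurable_step_term i j :
  measurable_fun [set: T] (fun x => (c i j)%:E * (g \_ (A i j)) x).
Proof.
apply: measurable_funeM; apply/(measurable_restrictT _ _).1 => //.
exact: measurable_funS mg.
Qed.

Lemma measurable_step : measurable_fun [set: T]
  (fun x => \sum_i \sum_j (c i j)%:E * (g \_ (A i j)) x).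
Proof.
apply: emeasurable_sum => i; apply: emeasurable_sum => j.
exact: measurable_step_term.
Qed.

Lemma integral_step : \int[mu]_x (\sum_i \sum_j (c i j)%:E * (g \_ (A i j)) x) =
  \sum_i \sum_j (c i j)%:E * \int[mu]_(x in A i j) g x.
Proof.
rewrite ge0_integral_sum//; last 2 first.
- by move=> i; apply: emeasurable_sum => j; exact: measurable_step_term.
- by move=> i x _; apply: sume_ge0 => j _; exact: step_term_ge0.
apply: eq_bigr => i _; rewrite ge0_integral_sum//; last 2 first.
- by move=> j; exact: measurable_step_term.
- by move=> j x _; exact: step_term_ge0.
apply: eq_bigr => j _; rewrite ge0_integralZl_EFin//; last 2 first.
- by move=> x _; rewrite patchE; case: ifP.
- apply/(measurable_restrictT _ _).1 => //; exact: measurable_funS mg.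
by rewrite -integral_mkcond.
Qed.

End integral_step_function.

Lemma le_term_sum (R : realType) (I : finType) (F : I -> R) (i : I) :
  (forall j, 0 <= F j)%R -> (F i <= \sum_j F j)%R.
Proof. by move=> F0; rewrite (bigD1 i)//= lerDl sumr_ge0. Qed.

Lemma powR_ratioK (R : realType) (x r s : R) : (0 < r)%R -> (0 < s)%R -> (0 <= x)%R ->
  ((x `^ (r / s)) `^ (s / r) = x)%R.
Proof.
move=> r0 s0 x0; rewrite -powRrM (_ : r / s * (s / r) = 1)%R ?powRr1//.
by field; rewrite !gt_eqF.
Qed.

Lemma ler_powR_ratio (R : realType) (x y r s : R) : (0 < r)%R -> (0 < s)%R ->
  (0 <= x)%R -> (0 <= y)%R -> (x <= y `^ (s / r))%R = (x `^ (r / s) <= y)%R.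
Proof.
move=> r0 s0 x0 y0; apply/idP/idP => h.
  rewrite -[leRHS](powR_ratioK s0 r0)//; apply: ge0_ler_powR => //.
  - by rewrite divr_ge0 ?ltW.
  - by rewrite nnegrE powR_ge0.
rewrite -[leLHS](powR_ratioK r0 s0)//; apply: ge0_ler_powR => //.
- by rewrite divr_ge0 ?ltW.
- by rewrite nnegrE powR_ge0.
Qed.

Section upper_bound.
Variables (R : realType) (n : nat) (p q K : R).
Hypotheses (p_gt1 : (1 < p)%R) (q_gt1 : (1 < q)%R).
Local Notation mu := (lebesgue_Rn R n).
Variable w : Rn R n -> R.
Hypotheses (w_ge0 : forall z, (0 <= w z)%R) (mw : measurable_fun [set: Rn R n] w).
Hypothesis (w_Ap : Ap_bound p K w).
Variable f : (Rn R n -> R)^nat.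
Hypothesis mf : forall j, measurable_fun [set: Rn R n] (f j).
Variable X : R.
Hypothesis intX : \int[mu]_z (`|vnorm q f z| `^ p * (w z)%:E) = X%:E.

Local Notation shiftT := {ffun 'I_n -> bool}.
Local Notation leafN N T := (@leaf R n (depth N) (mesh R N) (origin R N T)).
Local Notation absf := (fun j z => `|f j z|%R).

(** This is [maxavg] written out, so that j ranges over all natural numbers instead of a finite
    type. *)
Definition dyadic_maximal N (T : shiftT) (x : {ffun 'I_n -> 'I_(2 ^ depth N)}) (j : nat) : R :=
  rmax (fun k => avg (@label n (depth N)) (0 + k)
    (leaf_mean (mesh R N) (origin R N T) (EFin \o absf j))) (depth N - 0) x.

(** 6^n compares a cube with its cell; the number of shifts enters because the indices j are
    distributed over the grids. *)
Definition shift_const : R := (#|{: shiftT}|%:R * (6 ^+ n) `^ q)%R.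

Definition majorant_coef N (T : shiftT) (x : {ffun 'I_n -> 'I_(2 ^ depth N)}) : R :=
  (shift_const `^ (p / q) * (\sum_(j < N) dyadic_maximal T x j `^ q) `^ (p / q))%R.

(** At each z at most one leaf per grid contributes. Its power q / p dominates sums of q-th powers
    of averages, and only j < N occur, so it is a finite step function. *)
Definition majorant N z : R :=
  (\sum_(T : shiftT) \sum_(x : {ffun 'I_n -> 'I_(2 ^ depth N)})
     majorant_coef T x * \1_(leafN N T x) z)%R.

Let absf_ge0 N (j : 'I_N) z : (0 <= absf j z)%R. Proof. exact: normr_ge0. Qed.

Let mabsf N (j : 'I_N) : measurable_fun [set: Rn R n] (absf j).
Proof. by apply: measurableT_comp => //; exact: mf. Qed.

Lemma lq_norm_le_vnorm N z :
  (lq_norm q (fun j : 'I_N => absf j) z)%:E <= vnorm q f z.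
Proof.
have q1 := q_gt1; rewrite /lq_norm /vnorm -poweR_EFin; apply: ler_poweR.
- by rewrite invr_ge0; lra.
- by rewrite lee_fin sumr_ge0// => *; exact: powR_ge0.
rewrite -sumEFin; under eq_bigr do rewrite -poweR_EFin.
rewrite -(big_mkord xpredT (fun j => `|f j z|%:E `^ q)).
by apply: nneseries_lim_ge => j _ _; exact: poweR_ge0.
Qed.

Lemma partial_integral N : exists XN : R,
  [/\ \int[mu]_z (lq_norm q (fun j : 'I_N => absf j) z `^ p * w z)%:E = XN%:E,
      (0 <= XN)%R & (XN <= X)%R].
Proof.
have p1 := p_gt1.
have g0 z : 0 <= (lq_norm q (fun j : 'I_N => absf j) z `^ p * w z)%:E.
  by rewrite lee_fin mulr_ge0 ?powR_ge0.
have le1 : \int[mu]_z (lq_norm q (fun j : 'I_N => absf j) z `^ p * w z)%:E <= X%:E.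
  rewrite -intX; apply: le_integral_nonmeasurable => // z.
  rewrite EFinM -poweR_EFin lee_wpmul2r ?lee_fin//; apply: ler_poweR; first lra.
    by rewrite lee_fin powR_ge0.
  by rewrite gee0_abs ?poweR_ge0// lq_norm_le_vnorm.
have int0 : 0 <= \int[mu]_z (lq_norm q (fun j : 'I_N => absf j) z `^ p * w z)%:E.
  exact: integral_ge0.
have fin : \int[mu]_z (lq_norm q (fun j : 'I_N => absf j) z `^ p * w z)%:E \is a fin_num.
  by rewrite ge0_fin_numE//; apply: le_lt_trans le1 _; exact: ltry.
exists (fine (\int[mu]_z (lq_norm q (fun j : 'I_N => absf j) z `^ p * w z)%:E)).
by rewrite fineK//; split => //; rewrite -lee_fin fineK.
Qed.

Lemma leaf_integral_finite N T x j :
  \int[mu]_(z in leafN N T x) (absf j z)%:E < +oo.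
Proof.
have [XN [eN _ _]] := partial_integral j.+1.
have [_ H _ _] := @leaf_functions R n p q K p_gt1 q_gt1 w w_ge0 mw w_Ap (depth N)
  (mesh R N) (origin R N T) (mesh_gt0 R N) _ (fun j' : 'I_j.+1 => absf j') XN
  (@absf_ge0 _) (@mabsf _) eN x.
exact: (H ord_max).
Qed.

Lemma dyadic_maximal_ge0 N (T : shiftT) x j : (0 <= @dyadic_maximal N T x j)%R.
Proof.
apply: rmax_ge0 => k y; apply: avg_ge0 => y'; apply: leaf_mean_ge0 => [|z].
- exact: mesh_gt0.
- by rewrite lee_fin.
Qed.

Lemma majorant_coef_ge0 N (T : shiftT) x : (0 <= @majorant_coef N T x)%R.
Proof. by rewrite mulr_ge0 ?powR_ge0. Qed.

Lemma majorant_ge0 N z : (0 <= majorant N z)%R.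
Proof.
by apply: sumr_ge0 => T _; apply: sumr_ge0 => x _; rewrite mulr_ge0 ?majorant_coef_ge0.
Qed.

Lemma leaf_le_majorant N (T : shiftT) x z : leafN N T x z ->
  (shift_const * \sum_(j < N) dyadic_maximal T x j `^ q <= majorant N z `^ (q / p))%R.
Proof.
move=> xz; have p1 := p_gt1; have q1 := q_gt1.
have s0 : (0 <= shift_const)%R by rewrite mulr_ge0 ?powR_ge0.
have S0 : (0 <= \sum_(j < N) dyadic_maximal T x j `^ q)%R.
  by rewrite sumr_ge0// => *; exact: powR_ge0.
have sS0 : (0 <= shift_const * \sum_(j < N) dyadic_maximal T x j `^ q)%R.
  exact: mulr_ge0.
rewrite ler_powR_ratio ?majorant_ge0//; [|lra|lra].
rewrite powRM// -/(majorant_coef T x).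
apply: (@le_trans _ _ (\sum_x majorant_coef T x * \1_(leafN N T x) z)%R).
  apply: le_trans (le_term_sum x _) => [|y].
    by rewrite indicE mem_set// mulr1.
  by rewrite mulr_ge0 ?majorant_coef_ge0.
apply: (le_term_sum T (F := fun T => \sum_x majorant_coef T x * \1_(leafN N T x) z)%R).
by move=> T'; apply: sumr_ge0 => y _; rewrite mulr_ge0 ?majorant_coef_ge0.
Qed.

Lemma averages_le_majorant z (a : nat -> Rn R n) (l : nat -> R) J :
  (forall j, (0 < l j)%R) -> (forall j, cube (a j) (l j) z) ->
  exists N0, forall N, (N0 <= N)%N ->
  \sum_(j < J) average (EFin \o absf j) (cube (a j) (l j)) `^ q <=
    (majorant N z `^ (q / p))%:E.
Proof.
move=> l0 Qz; have q1 := q_gt1; have p1 := p_gt1.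
pose N0 j := projT1 (cid (cube_in_cell (a j) (l0 j))).
have N0P j := projT2 (cid (cube_in_cell (a j) (l0 j))).
exists (maxn J (\max_(j < J) N0 j)) => N; rewrite geq_max => /andP[JN NN].
have ex (j : 'I_J) : exists T : shiftT, exists2 x, leafN N T x z &
    average (EFin \o absf j) (cube (a j) (l j)) <= (6 ^+ n * dyadic_maximal T x j)%:E.
  have N0N : (N0 j <= N)%N by apply: leq_trans NN; exact: leq_bigmax.
  have [T [k [kN Dl H]]] := N0P j N N0N.
  have [x xz sub] := H z (Qz j); exists T, x => //.
  apply: (@average_le_maxavg R n (depth N) k (mesh R N) (origin R N T) 'I_J
    (fun j => absf j) j (a j) (l j) x) => //.
  - exact: mesh_gt0.
  - by move=> y; exact: leaf_integral_finite.
pose T j := projT1 (cid (ex j)).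
have TP j := projT2 (cid (ex j)).
have avge0 (j : nat) : 0 <= average (EFin \o absf j) (cube (a j) (l j)).
  rewrite averageE//; apply: mule_ge0.
    by rewrite lee_fin invr_ge0 exprn_ge0// ltW.
  by apply: integral_ge0 => y _; rewrite lee_fin.
have maj0 : (0 <= majorant N z `^ (q / p))%R by exact: powR_ge0.
(* Indices are grouped by the grid capturing their cube. Within one grid all cells contain the same
   leaf around z, and each grid is allotted an equal share of the majorant. *)
rewrite (partition_big T xpredT)//=.
have card0 : (0 < #|{: shiftT}|)%N.
  by apply/card_gt0P; exists [ffun=> false].
have tau0 : (0 < #|{: shiftT}|%:R :> R)%R by rewrite ltr0n.
apply: (@le_trans _ _ (\sum_(T0 : shiftT) ((#|{: shiftT}|%:R)^-1 * majorant N z `^ (q / p))%:E)); last first.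
  by rewrite sumEFin lee_fin sumr_const -[X in (X <= _)%R]mulr_natl mulrA divff ?mul1r// gt_eqF.
apply: lee_sum => T0 _.
have [/existsP[j0 /eqP Tj0]|/existsPn noj] := boolP [exists j, T j == T0]; last first.
  rewrite big_pred0; last by move=> j; exact: (negbTE (noj j)).
  by rewrite lee_fin mulr_ge0 ?invr_ge0.
have [x xz _] := TP j0; rewrite -/(T j0) Tj0 in x xz.
apply: (@le_trans _ _ (\sum_(j < J) ((6 ^+ n) `^ q * dyadic_maximal T0 x j `^ q)%:E)).
  rewrite big_mkcond; apply: lee_sum => j _; case: ifPn => [/eqP Tj|_]; last first.
    by rewrite lee_fin mulr_ge0 ?powR_ge0.
  have [y yz avy] := TP j; rewrite -/(T j) Tj in y yz avy.
  rewrite (leaf_inj (mesh_gt0 R N) xz yz) -powRM ?exprn_ge0 ?dyadic_maximal_ge0//.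
  rewrite -poweR_EFin; apply: (ler_poweR (ltW (lt_trans ltr01 q1)) _ avy).
  exact: avge0.
rewrite sumEFin lee_fin -mulr_sumr ler_pdivlMl// mulrA.
apply: le_trans (leaf_le_majorant xz).
rewrite ler_wpM2l ?mulr_ge0 ?powR_ge0//.
rewrite (big_ord_widen_cond N xpredT (fun j => dyadic_maximal T0 x j `^ q)%R JN).
rewrite [leRHS](bigID (fun j : 'I_N => (j < J)%N))/= lerDl sumr_ge0// => *.
exact: powR_ge0.
Qed.

(** For a fixed choice of cubes the majorant dominates from some N0 on. N0 depends on the choice but
    the lower limit does not, so suprema can be taken afterwards. *)
Lemma vmaximal_le_liminf z : `|vmaximal q f z| `^ p * (w z)%:E <=
  limn_einf (fun N => (majorant N z * w z)%:E).
Proof.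
have q1 := q_gt1; have p1 := p_gt1.
have q0 : (0 < q)%R by lra.
have p0 : (0 < p)%R by lra.
have [wz|wz] := eqVneq (w z) 0%R.
  rewrite wz mule0; apply: (@le_limn_einf _ _ _ 0%N) => N _; by rewrite mulr0.
have w0 : (0 < w z)%R by rewrite lt_neqAle eq_sym wz w_ge0.
have L0 : 0 <= limn_einf (fun N => (majorant N z * w z)%:E).
  by apply: (@le_limn_einf _ _ _ 0%N) => N _; rewrite lee_fin mulr_ge0 ?majorant_ge0.
have : exists L', L' = limn_einf (fun N => (majorant N z * w z)%:E) by eexists.
move=> [[L||] eL]; rewrite -eL ?leey//; last by move: L0; rewrite -eL.
rewrite -eL lee_fin in L0.
pose A j := [set average (fun y => `|f j y|%:E) Q | Q in cubes `&` [set Q | Q z]].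
have MA j : cube_maximal (f j) z = ereal_sup (A j) by [].
have An0 j : A j !=set0.
  eexists; exists (cube z 1%R) => //; split; first by exists z, 1%R.
  by move=> i /=; rewrite lexx lerDl ler01.
have A0 j x : A j x -> 0 <= x.
  move=> [Q [[a [l [l0 ->]]] _] <-]; rewrite averageE//; apply: mule_ge0.
    by rewrite lee_fin invr_ge0 exprn_ge0// ltW.
  by apply: integral_ge0 => y _; rewrite lee_fin.
have M0 j : 0 <= cube_maximal (f j) z.
  have [x Ax] := An0 j; rewrite MA; apply: le_trans (A0 _ _ Ax) _.
  exact: ereal_sup_ubound.
have key J : \sum_(j < J) cube_maximal (f j) z `^ q <= ((L / w z) `^ (q / p))%:E.
  apply: (@sup_sum_poweR R q _ A J q0 An0 A0) => x Ax.
  have ex j : exists al : Rn R n * R, [/\ (0 < al.2)%R, cube al.1 al.2 z &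
      x j = average (EFin \o absf j) (cube al.1 al.2)].
    have [Q [[a [l [l0 ->]]] Qz] <-] := Ax j.
    by exists (a, l).
  pose al j := projT1 (cid (ex j)); have alP j := projT2 (cid (ex j)).
  have [N0 H] := @averages_le_majorant z (fun j => (al j).1) (fun j => (al j).2) J
    (fun j => let: And3 h _ _ := alP j in h) (fun j => let: And3 _ h _ := alP j in h).
  have E : \sum_(j < J) x j `^ q =
      \sum_(j < J) average (EFin \o absf j) (cube (al j).1 (al j).2) `^ q.
    by apply: eq_bigr => j _; have [_ _ ->] := alP j.
  have s0 : 0 <= \sum_(j < J) x j `^ q.
    by apply: sume_ge0 => *; exact: poweR_ge0.
  have sfin : \sum_(j < J) x j `^ q \is a fin_num.
    rewrite ge0_fin_numE//; apply: (@le_lt_trans _ _ (majorant N0 z `^ (q / p))%:E).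
      by rewrite E; exact: H.
    exact: ltry.
  pose y := fine (\sum_(j < J) x j `^ q).
  have y0 : (0 <= y)%R by rewrite fine_ge0.
  rewrite -(fineK sfin) -/y lee_fin.
  have : (y `^ (p / q) * w z)%:E <= L%:E.
    rewrite eL; apply: (@le_limn_einf _ _ _ N0) => N NN.
    rewrite lee_fin ler_pM2r//.
    rewrite -ler_powR_ratio ?majorant_ge0//.
    by rewrite -lee_fin fineK// E; exact: H.
  by rewrite lee_fin -ler_pdivlMr// ler_powR_ratio// divr_ge0// ltW.
have S : \sum_(j <oo) cube_maximal (f j) z `^ q <= ((L / w z) `^ (q / p))%:E.
  by apply: nneseries_le => // j; exact: poweR_ge0.
have S0 : 0 <= \sum_(j <oo) cube_maximal (f j) z `^ q.
  by apply: nneseries_ge0 => j _ _; exact: poweR_ge0.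
rewrite gee0_abs ?poweR_ge0// /vmaximal -poweRrM.
apply: (@le_trans _ _ ((((L / w z) `^ (q / p))%:E `^ (q^-1 * p)) * (w z)%:E)).
  rewrite lee_wpmul2r ?lee_fin//; apply: ler_poweR => //.
  by rewrite mulr_ge0 ?invr_ge0 ?(ltW q0) ?(ltW p0).
rewrite poweR_EFin -powRrM (_ : q / p * (q^-1 * p) = 1)%R; last first.
  by field; apply/andP; split; lra.
by rewrite powRr1 ?divr_ge0// -EFinM divfK.
Qed.

Lemma majorant_weightE N z : (majorant N z * w z)%:E = \sum_(T : shiftT)
    \sum_(x : {ffun 'I_n -> 'I_(2 ^ depth N)})
      (majorant_coef T x)%:E * ((EFin \o w) \_ (leafN N T x)) z.
Proof.
rewrite /majorant mulr_suml -sumEFin; apply: eq_bigr => T _.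
rewrite mulr_suml -sumEFin; apply: eq_bigr => x _.
rewrite patchE indicE; case: ifPn => _; first by rewrite mulr1 EFinM.
by rewrite mulr0 mul0r mule0.
Qed.

Let mEw : measurable_fun [set: Rn R n] (EFin \o w).
Proof. exact/measurable_EFinP. Qed.

Let mleaf N (T : shiftT) (x : {ffun 'I_n -> 'I_(2 ^ depth N)}) :
  measurable (leafN N T x).
Proof. exact: measurable_leaf. Qed.

Lemma measurable_majorant N :
  measurable_fun [set: Rn R n] (fun z => (majorant N z * w z)%:E).
Proof.
have -> : (fun z => (majorant N z * w z)%:E) = (fun z => \sum_(T : shiftT)
    \sum_(x : {ffun 'I_n -> 'I_(2 ^ depth N)})
      (majorant_coef T x)%:E * ((EFin \o w) \_ (leafN N T x)) z).
  by apply/funext => z; exact: majorant_weightE.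
exact: (@measurable_step _ (Rn R n) R _ _ (@majorant_coef N) _ _ (@mleaf N) mEw).
Qed.

Definition upper_const : R :=
  (shift_const `^ (p / q) * #|{: shiftT}|%:R * discrete_const (2 ^ n)%:R q p)%R.

Lemma integral_majorant N :
  \int[mu]_z (majorant N z * w z)%:E <=
  (upper_const * K `^ (p / Num.min q (p - 1)) * X)%:E.
Proof.
have [XN [eN XN0 XNX]] := partial_integral N.
have w0' z : 0 <= (EFin \o w) z by rewrite lee_fin.
have -> : \int[mu]_z (majorant N z * w z)%:E = \sum_(T : shiftT)
    \sum_(x : {ffun 'I_n -> 'I_(2 ^ depth N)})
      (majorant_coef T x)%:E * \int[mu]_(z in leafN N T x) (EFin \o w) z.
  rewrite -(@integral_step _ (Rn R n) R mu _ _ _ _ _ (@majorant_coef_ge0 N) (@mleaf N) mEw w0').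
  by apply: eq_integral => z _; exact: majorant_weightE.
have K0 : (0 <= K)%R.
  have [W [S [eW eS]]] := w_Ap (Rn_of (fun=> 0%R)) ltr01.
  apply: le_trans; rewrite mulr_ge0 ?powR_ge0// divr_ge0 ?exprn_ge0//.
  by rewrite -lee_fin -eW; apply: integral_ge0 => z _; rewrite lee_fin.
pose B := (shift_const `^ (p / q) * (discrete_const (2 ^ n)%:R q p * K `^ (p / Num.min q (p - 1)) * X))%R.
apply: (@le_trans _ _ (\sum_(T : shiftT) B%:E)); last first.
  rewrite sumEFin lee_fin sumr_const -mulr_natl /B /upper_const.
  by rewrite le_eqVlt; apply/orP; left; apply/eqP; ring.
apply: lee_sum => T _.
have lw x := let: And5 h _ _ _ _ := @leaf_weights R n p K p_gt1 w w_ge0 mw w_Ap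
  (depth N) (mesh R N) (origin R N T) (mesh_gt0 R N) x in h.
rewrite (eq_bigr (fun x => (majorant_coef T x * (leaf_mean (mesh R N) (origin R N T) (EFin \o w) x * mesh R N ^+ n))%:E)); last first.
  by move=> x _; rewrite EFinM (integral_leafE (mesh_gt0 R N) w0' (lw x)).
rewrite sumEFin lee_fin /B.
have GE := @grid_estimate R n p q K p_gt1 q_gt1 w w_ge0 mw w_Ap (depth N)
  (mesh R N) (origin R N T) (mesh_gt0 R N) _ (fun j : 'I_N => absf j) XN
  (@absf_ge0 _) (@mabsf _) eN.
apply: (@le_trans _ _ (shift_const `^ (p / q) *
  (discrete_const (2 ^ n)%:R q p * K `^ (p / Num.min q (p - 1)) * XN))%R); last first.
  rewrite ler_wpM2l ?powR_ge0// ler_wpM2l// mulr_ge0 ?powR_ge0//.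
  by rewrite /discrete_const /sparse_const !mulr_ge0 ?powR_ge0.
apply: le_trans (ler_wpM2l (powR_ge0 _ _) GE).
rewrite mulr_sumr; apply: ler_sum => x _; rewrite /majorant_coef.
rewrite -[leLHS]mulrA ler_wpM2l ?powR_ge0// [leLHS]mulrC.
exact: lexx.
Qed.

Lemma vmaximal_integral :
  \int[mu]_z (`|vmaximal q f z| `^ p * (w z)%:E) <=
  (upper_const * K `^ (p / Num.min q (p - 1)) * X)%:E.
Proof.
apply: (@le_trans _ _ (\int[mu]_z limn_einf (fun N => (majorant N z * w z)%:E))).
  apply: le_integral_nonmeasurable => z; last exact: vmaximal_le_liminf.
  by rewrite mule_ge0 ?poweR_ge0// lee_fin.
apply: (@le_trans _ _ (limn_einf (fun N => \int[mu]_z (majorant N z * w z)%:E))).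
  have H0 N z : [set: Rn R n] z -> 0 <= (majorant N z * w z)%:E.
    by move=> _; rewrite lee_fin mulr_ge0 ?majorant_ge0.
  exact: (@fatou _ _ _ mu _ measurableT _ measurable_majorant H0).
rewrite limn_einf_lim; apply: lime_le; first exact: is_cvg_einfs.
exists 0%N => // N _ /=; apply: le_trans (integral_majorant N).
by apply: ereal_inf_lbound; exists N => //=.
Qed.

End upper_bound.

(** On the grid with a single leaf the lower bound of [leaf_weights] meets the A_p bound. *)
Lemma Ap_bound_ge1 (R : realType) n (p K : R) (w : Rn R n -> R) : (1 < p)%R ->
  (forall z, 0 <= w z)%R -> measurable_fun [set: Rn R n] w -> Ap_bound p K w ->
  (1 <= K)%R.
Proof.
move=> p1 w0 mw Kb; pose x := [ffun i : 'I_n => @Ordinal (2 ^ 0) 0 (ltn0Sn 0)].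
have [_ _ _ _ H] := @leaf_weights R n p K p1 w w0 mw Kb 0 1 (fun=> 0%R) ltr01 x.
have := @Ap_leaf_bound R n p K p1 w w0 mw Kb 0 1 (fun=> 0%R) ltr01 0 x (leqnn 0).
by rewrite /avg !(wavg_leaf (@label_inj n 0)) ?ltr01//; exact: le_trans.
Qed.

Lemma upper_estimate (R : realType) n (p q : R) : (1 < q)%R -> (1 < p)%R ->
  exists c : R, forall (w : Rn R n -> R) (f : (Rn R n -> R)^nat),
    Ap p w -> (forall j, measurable_fun [set: Rn R n] (f j)) ->
    wLnorm p w (vmaximal q f) <=
      c%:E * Ap_const p w `^ (Num.max (q^-1) ((p - 1)^-1))%R * wLnorm p w (vnorm q f).
Proof.
move=> q1 p1.
have p0 : (0 < p)%R by lra.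
have min0 : (0 < Num.min q (p - 1))%R by rewrite lt_min; apply/andP; split; lra.
have uc0 : (0 <= upper_const n p q)%R.
  rewrite /upper_const /discrete_const /sparse_const /shift_const.
  by rewrite !mulr_ge0 ?powR_ge0.
(* Adding 1 keeps the constant positive, so the right-hand side is +oo whenever the norm of f is. *)
exists (upper_const n p q `^ p^-1 + 1)%R => w f w_Ap mf.
have [[mw w0 _] _] := w_Ap.
have c0 : (0 < upper_const n p q `^ p^-1 + 1)%R by rewrite ltr_wpDl ?powR_ge0.
have norm0 g : 0 <= wLnorm p w g by exact: poweR_ge0.
have mEw : measurable_fun [set: Rn R n] (EFin \o w) by exact/measurable_EFinP.
have [w_zero|[K eK Kb]] := Ap_cases p1 w_Ap.
  rewrite (_ : wLnorm p w (vmaximal q f) = 0); last first.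
    rewrite /wLnorm (_ : \int[_]_z _ = 0); first by rewrite poweR0r// invr_eq0 gt_eqF.
    apply/eqP; rewrite eq_le; apply/andP; split; last first.
      by apply: integral_ge0 => z _; rewrite mule_ge0 ?poweR_ge0// lee_fin.
    (* As w has integral 0, even the largest possible integrand +oo * w has integral 0. *)
    have <- : \int[lebesgue_Rn R n]_z (+oo * (w z)%:E) = 0.
      rewrite (ge0_integralZl _ measurableT mEw) ?leey//; last first.
        by move=> z _; rewrite /= lee_fin.
      by rewrite /= w_zero mule0.
    apply: le_integral_nonmeasurable => z; first by rewrite mule_ge0 ?poweR_ge0// lee_fin.
    by rewrite lee_wpmul2r ?leey ?lee_fin.
  by rewrite !mule_ge0 ?poweR_ge0// lee_fin ltW.
have K1 := Ap_bound_ge1 p1 w0 mw Kb.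
have K0 : (0 < K)%R by lra.
have XE : exists X, X = \int[lebesgue_Rn R n]_z (`|vnorm q f z| `^ p * (w z)%:E) by eexists.
have X0 : 0 <= \int[lebesgue_Rn R n]_z (`|vnorm q f z| `^ p * (w z)%:E).
  by apply: integral_ge0 => z _; rewrite mule_ge0 ?poweR_ge0// lee_fin.
rewrite eK; case: XE => [[X||] eX]; last first.
- by move: X0; rewrite -eX.
- rewrite [X in _ <= _ * X]/wLnorm -eX poweRyr ?invr_eq0 ?gt_eqF// gt0_muley ?leey//.
  by rewrite poweR_EFin -EFinM lte_fin mulr_gt0 ?powR_gt0.
have XR0 : (0 <= X)%R by rewrite -lee_fin eX.
rewrite /wLnorm -eX.
apply: (@le_trans _ _ ((upper_const n p q * K `^ (p / Num.min q (p - 1)) * X)%:E `^ p^-1)).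
  apply: ler_poweR; first by rewrite invr_ge0 ltW.
    by apply: integral_ge0 => z _; rewrite mule_ge0 ?poweR_ge0// lee_fin.
  by apply: vmaximal_integral => //; exact/esym.
rewrite !poweR_EFin -!EFinM lee_fin; move: (upper_const n p q) uc0 => U U0.
rewrite powRM ?mulr_ge0 ?powR_ge0// powRM ?powR_ge0//.
rewrite -powRrM ler_wpM2r ?powR_ge0//.
have -> : (p / Num.min q (p - 1) * p^-1 = Num.max q^-1 (p - 1)^-1)%R.
  rewrite mulrAC divff ?gt_eqF// mul1r; have p10 : (0 < p - 1)%R by lra.
  have q0 : (0 < q)%R by lra.
  rewrite minEle maxEle; case: (leP q (p - 1)%R) => h.
    by rewrite lef_pV2 ?posrE//; case: leP => // h'; congr (_^-1)%R; lra.
  by rewrite lef_pV2 ?posrE// ltW.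
by rewrite ler_wpM2r ?powR_ge0// lerDl.
Qed.

(** * The truncated weight 1/|x_i0| *)

Local Close Scope ereal_scope.

Section profile.
Variable R : realType.
Implicit Types (t : R) (m k j : nat).

(* Equal to 2^k for 2^-(k+1) < |t| <= 2^-k and k < m, to 2^m for
   |t| <= 2^-m, and to 1 for |t| > 1. *)
Definition profile m t : R := 1 + \sum_(k < m) 2 ^+ k * (`|t| <= 2 ^- k.+1)%R%:R.

Lemma half_pow_gt0 k : 0 < 2 ^- k :> R.
Proof. by rewrite invr_gt0 exprn_gt0. Qed.

Lemma half_powS k : 2 ^- k = 2 * 2 ^- k.+1 :> R.
Proof. by rewrite exprS invfM mulrA divff// mul1r. Qed.

Lemma half_pow_le j k : (j <= k)%N -> 2 ^- k <= 2 ^- j :> R.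
Proof.
by move=> jk; rewrite lef_pV2 ?posrE ?exprn_gt0// ler_weXn2l// ler1n.
Qed.

Lemma sum_exp2 m : 1 + \sum_(k < m) 2 ^+ k = 2 ^+ m :> R.
Proof.
elim: m => [|m ih]; first by rewrite big_ord0 addr0.
by rewrite big_ord_recr/= addrA ih exprS; ring.
Qed.

Lemma profileS m t : profile m.+1 t = profile m t + 2 ^+ m * (`|t| <= 2 ^- m.+1)%R%:R.
Proof. by rewrite /profile big_ord_recr/= addrA. Qed.

Lemma profile_ge1 m t : 1 <= profile m t.
Proof. by rewrite lerDl sumr_ge0// => k _; rewrite mulr_ge0// exprn_ge0. Qed.

Lemma profile_leq m m' t : (m <= m')%N -> profile m t <= profile m' t.
Proof.
move=> /subnK <-; elim: (m' - m)%N => [//|k ih]; rewrite addSn profileS.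
by apply: (le_trans ih); rewrite lerDl mulr_ge0// exprn_ge0.
Qed.

Lemma profile_inner j t : `|t| <= 2 ^- j -> profile j t = 2 ^+ j.
Proof.
move=> tj; rewrite -sum_exp2 /profile; congr (1 + _); apply: eq_bigr => k _.
by rewrite (le_trans tj) ?mulr1// half_pow_le.
Qed.

Lemma profile_ge m j t : (j <= m)%N -> `|t| <= 2 ^- j -> 2 ^+ j <= profile m t.
Proof. by move=> jm /profile_inner <-; exact: profile_leq. Qed.

Lemma profile_le m j t : (j <= m)%N -> 2 ^- j.+1 < `|t| -> profile m t <= 2 ^+ j.
Proof.
move=> jm tj; have -> : profile m t = profile j t.
  move: jm => /subnK <-; elim: (m - j)%N => [//|k ih]; rewrite addSn profileS ih.
  rewrite (_ : (_ <= _)%R = false) ?mulr0 ?addr0//; apply/negbTE; rewrite -ltNge.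
  by apply: le_lt_trans tj; rewrite half_pow_le// ltnS leq_addl.
rewrite -sum_exp2 /profile lerD2l; apply: ler_sum => k _.
rewrite ler_piMr ?exprn_ge0//; case: (`|t| <= _) => /=; by rewrite ?ler01 ?lexx.
Qed.

Lemma profile_far m t : 1 < `|t| -> profile m t = 1.
Proof.
move=> t1; rewrite /profile big1 ?addr0// => k _.
rewrite (_ : (_ <= _)%R = false) ?mulr0//; apply/negbTE; rewrite -ltNge.
by apply: le_lt_trans t1; rewrite invf_le1 ?exprn_gt0// exprn_ege1// ler1n.
Qed.

Lemma profile_mul m t : 2 ^- m.+1 < `|t| -> 1 / 2 <= profile m t * `|t|.
Proof.
elim: m => [|m ih] tm.
  by rewrite /profile big_ord0 addr0 !mul1r ltW.
have [h|h] := ltP (2 ^- m.+1) `|t|.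
  by apply: le_trans (ih h) _; rewrite ler_wpM2r// profile_leq.
rewrite (profile_inner h).
have e : 2 ^+ m.+1 * 2 ^- m.+2 = 1 / 2 :> R.
  rewrite [X in _ / X]exprS invfM mulrCA divff ?mulr1 ?div1r// expf_neq0//.
by rewrite -e ler_pM2l ?exprn_gt0// ltW.
Qed.

Lemma measurable_profile m : measurable_fun [set: R] (profile m).
Proof.
apply: measurable_funD; first exact: measurable_cst.
apply: measurable_sum => k; apply: measurable_funM; first exact: measurable_cst.
rewrite (_ : (fun _ => _) = \1_[set t : R | `|t| <= 2 ^- k.+1]); last first.
  by apply/funext => t; rewrite indicE; congr ((nat_of_bool _)%:R); apply/idP/idP; rewrite inE.
apply: measurable_indic.
rewrite (_ : [set t : R | _] = `[- 2 ^- k.+1, 2 ^- k.+1]%classic).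
  exact: measurable_itv.
by apply/seteqP; split => t /=; rewrite in_itv/= ler_norml.
Qed.

End profile.

Section slabs.
Variables (R : realType) (n : nat) (i0 : 'I_n).
Local Notation mu := (lebesgue_Rn R n).
Implicit Types (a z : Rn R n) (l : R) (I : set R).

Definition slab a l I : set (Rn R n) := box (fun i =>
  if i == i0 then I else `[coordinate a i, coordinate a i + l]%classic).

Lemma slabP a l I z : slab a l I z <-> I (coordinate z i0) /\
  forall i, i != i0 -> coordinate a i <= coordinate z i <= coordinate a i + l.
Proof.
split => [H|[H1 H2] i].
  split=> [|i ii0]; first by have := H i0; rewrite eqxx.
  by have := H i; rewrite (negbTE ii0) /= in_itv.
by case: eqP => [->//|/eqP ii0]; rewrite /= in_itv; exact: H2.
Qed.

Lemma measurable_slab a l I : measurable (I : set (measurableTypeR R)) ->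
  measurable (slab a l I).
Proof.
by move=> mI; apply: measurable_box => i; case: ifP => _ //; exact: measurable_itv.
Qed.

Lemma lebesgue_slab a l I (c : R) : 0 <= l ->
  measurable (I : set (measurableTypeR R)) -> lebesgue_measure I = c%:E ->
  mu (slab a l I) = (c * l ^+ n.-1)%:E.
Proof.
move=> l0 mI Ic; rewrite lebesgue_box; last first.
  by move=> i; case: ifP => _ //; exact: measurable_itv.
rewrite (bigD1 i0)//= eqxx Ic.
rewrite (eq_bigr (fun=> l%:E)); last first.
  move=> i /negbTE ->; rewrite lebesgue_measure_itv/= lte_fin ltrDl.
  case: ltP => [_|l0']; first by rewrite -EFinD addrAC subrr add0r.
  by congr (_%:E); lra.
have -> : (\prod_(i < n | i != i0) l%:E = (l ^+ n.-1)%:E)%E.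
  rewrite (_ : n.-1 = #|[pred i | i != i0]|); last first.
    have := cardC1 i0; rewrite card_ord => <-; apply: eq_card => i; by rewrite !inE.
  rewrite -prodr_const; elim/big_ind2 : _ => // x1 x2 y1 y2 -> ->.
  by rewrite EFinM.
by rewrite EFinM.
Qed.

Lemma lebesgue_slab_itv a l (b0 b1 : bool) (u v : R) : 0 <= l -> u <= v ->
  mu (slab a l [set` Interval (BSide b0 u) (BSide b1 v)]) = ((v - u) * l ^+ n.-1)%:E.
Proof.
move=> l0 uv; apply: lebesgue_slab => //.
rewrite lebesgue_measure_itv/= lte_fin; case: ltP => [_|vu]; first by rewrite EFinB.
by congr (_%:E); lra.
Qed.

Definition strip_weight m z : R := profile m (coordinate z i0).

Lemma measurable_strip_weight m : measurable_fun [set: Rn R n] (strip_weight m).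
Proof. exact: (measurableT_comp (@measurable_profile R m) (measurable_coordinate i0)). Qed.

Definition strip k : set (Rn R n) := [set z | `|coordinate z i0| <= 2 ^- k].

Lemma measurable_strip k : measurable (strip k).
Proof.
rewrite (_ : strip k = (fun z : Rn R n => coordinate z i0 : measurableTypeR R) @^-1` `[- 2 ^- k, 2 ^- k]%classic).
  by rewrite -[X in measurable X]setTI; exact: measurable_coordinate.
by apply/seteqP; split => z; rewrite /strip /= in_itv/= ler_norml.
Qed.

Lemma integral_strip_weight m a l : 0 <= l ->
  (\int[mu]_(z in cube a l) (strip_weight m z)%:E =
   (l ^+ n)%:E + \sum_(k < m) (2 ^+ k)%:E * mu (cube a l `&` strip k.+1))%E.
Proof.
move=> l0; have mQ := measurable_cube a l.
have E z : ((strip_weight m z)%:E = 1 + \sum_(k < m) (2 ^+ k)%:E * (\1_(strip k.+1) z)%:E)%E.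
  rewrite /strip_weight /profile EFinD -sumEFin; congr (_ + _)%E.
  apply: eq_bigr => k _; rewrite EFinM indicE; congr (_ * (nat_of_bool _)%:R%:E)%E.
  by apply/idP/idP; rewrite inE.
have mi k : measurable_fun (cube a l) (EFin \o \1_(strip k) : Rn R n -> \bar R).
  by apply/measurable_EFinP; apply: measurable_indic; exact: measurable_strip.
under eq_integral do rewrite E.
rewrite (ge0_integralD mu mQ); last 4 first.
- by move=> z _; exact: lee01.
- exact: measurable_cst.
- by move=> z _; apply: sume_ge0 => k _; rewrite mule_ge0// lee_fin ?exprn_ge0.
- by apply: emeasurable_sum => k; apply: measurable_funeM; exact: mi.
rewrite integral_cst// mul1e lebesgue_cube//; congr (_ + _)%E.
rewrite (ge0_integral_sum mu mQ); last 2 first.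
- by move=> k; apply: measurable_funeM; exact: mi.
- by move=> k z _; rewrite mule_ge0// lee_fin ?exprn_ge0.
apply: eq_bigr => k _; rewrite (ge0_integralZl_EFin mu mQ); last 3 first.
- by move=> z _; rewrite lee_fin.
- exact: mi.
- by rewrite exprn_ge0.
congr (_ * _)%E; rewrite (integral_indic mu mQ (measurable_strip k.+1)).
by congr (mu _); exact: setIC.
Qed.

(** Each of the m strips contributes at most 4 v(x) |Q|, and the constant 1 in the profile at most
    v(x) |Q|. *)
Lemma strip_weight_A1 m a l x : 0 < l -> cube a l x ->
  (\int[mu]_(z in cube a l) (strip_weight m z)%:E <=
   ((1 + 4 * m%:R) * strip_weight m x * l ^+ n)%:E)%E.
Proof.
move=> l0 Qx; have mQ := measurable_cube a l; have l0' := ltW l0.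
have ln0 : 0 <= l ^+ n by exact: exprn_ge0.
have n0 : (0 < n)%N by case: n i0 => // -[].
rewrite integral_strip_weight//.
set v := strip_weight m x; have v1 : 1 <= v by exact: profile_ge1.
have term (k : 'I_m) : ((2 ^+ k)%:E * mu (cube a l `&` strip k.+1) <= (4 * v * l ^+ n)%:E)%E.
  have k0 : 0 <= 2 ^+ k :> R by exact: exprn_ge0.
  (* Near the hyperplane, 2^k <= v(x) suffices. Otherwise a cube meeting the strip has l >= |x_i0| /
     2, so v(x) |x_i0| >= 1/2 gives 4 v(x) l >= 1, while density times width of the strip is 1. *)
  have [xk|xk] := leP `|coordinate x i0| (2 ^- k).
    apply: (@le_trans _ _ ((2 ^+ k)%:E * mu (cube a l))%E).
      rewrite lee_wpmul2l ?lee_fin//; apply: le_measure; rewrite ?inE//.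
      by apply: measurableI => //; exact: measurable_strip.
    rewrite lebesgue_cube// -EFinM lee_fin ler_wpM2r//.
    have : 2 ^+ k <= v by apply: profile_ge => //; exact: ltnW.
    lra.
  have [Q0|/set0P[y [Qy yk]]] := eqVneq (cube a l `&` strip k.+1) set0.
    by rewrite Q0 measure0 mule0 lee_fin !mulr_ge0//; lra.
  have {}yk : `|coordinate y i0| <= 2 ^- k.+1 by exact: yk.
  have d0 := half_pow_gt0 R k.+1; have dS := half_powS R k.
  have lx : `|coordinate x i0| <= 2 * l.
    have /andP[x1 x2] := Qx i0; have /andP[y1 y2] := Qy i0.
    have : `|coordinate x i0| <= `|coordinate y i0| + l.
      rewrite -[X in `|X| <= _](subrK (coordinate y i0)) addrC.
      apply: (le_trans (ler_normD _ _)); rewrite lerD2l ler_norml.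
      by apply/andP; split; lra.
    lra.
  have vl : 1 <= 4 * v * l.
    have : 1 / 2 <= v * `|coordinate x i0|.
      apply: profile_mul; apply: le_lt_trans xk; apply: half_pow_le.
      by apply: leqW; exact: ltnW.
    have : v * `|coordinate x i0| <= v * (2 * l) by rewrite ler_wpM2l//; lra.
    lra.
  pose I : set R := `[- 2 ^- k.+1, 2 ^- k.+1]%classic.
  have step : (mu (cube a l `&` strip k.+1) <= mu (slab a l I))%E.
    apply: le_measure; rewrite ?inE.
    - by apply: measurableI => //; exact: measurable_strip.
    - by apply: measurable_slab; exact: measurable_itv.
    - move=> z [Qz]; rewrite /strip /= => zk; apply/slabP; split => [|i _]; last exact: Qz.
      by rewrite /I /= in_itv/= -ler_norml.
  have {}k0 : (0 <= (2 ^+ k)%:E :> \bar R)%E by rewrite lee_fin.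
  apply: (le_trans (lee_wpmul2l k0 step)).
  rewrite /I lebesgue_slab_itv//; last by lra.
  rewrite -EFinM lee_fin opprK mulrA.
  have -> : 2 ^+ k * (2 ^- k.+1 + 2 ^- k.+1) = 1 :> R.
    have -> : 2 ^- k.+1 + 2 ^- k.+1 = 2 ^- k :> R by rewrite (half_powS R k); ring.
    by rewrite divff// expf_neq0.
  rewrite mul1r -[in leRHS](prednK n0) exprS mulrA ler_peMl// exprn_ge0//.
apply: (@le_trans _ _ ((l ^+ n)%:E + \sum_(k < m) (4 * v * l ^+ n)%:E)%E).
  by rewrite leeD2l//; apply: lee_sum => k _; exact: term.
rewrite sumEFin -EFinD lee_fin sumr_const card_ord -[X in _ + X <= _]mulr_natl.
have m0 : 0 <= m%:R :> R by [].
have -> : (1 + 4 * m%:R) * v * l ^+ n = v * l ^+ n + m%:R * (4 * v * l ^+ n) by ring.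
by rewrite lerD2r ler_peMl.
Qed.

End slabs.

Local Open Scope ereal_scope.

Lemma average_ge0 (R : realType) n (g : Rn R n -> \bar R) (a : Rn R n) (l : R) :
  (0 < l)%R -> (forall z, 0 <= g z) -> 0 <= average g (cube a l).
Proof.
move=> l0 g0; rewrite averageE//; apply: mule_ge0; last exact: integral_ge0.
by rewrite lee_fin invr_ge0 exprn_ge0// ltW.
Qed.

(** * A_p constants of an A_1 weight and of its dual power *)

Section A1_weights.
Variables (R : realType) (n : nat) (p : R).
Hypothesis p_gt1 : (1 < p)%R.
Local Notation mu := (lebesgue_Rn R n).

Lemma average_le (g : Rn R n -> \bar R) a (l c : R) : (0 < l)%R ->
  measurable_fun [set: Rn R n] g -> (forall z, 0 <= g z) ->
  (forall z, cube a l z -> g z <= c%:E) -> average g (cube a l) <= c%:E.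
Proof.
move=> l0 mg g0 gc; have ln0 : (0 < l ^+ n)%R by exact: exprn_gt0.
have mQ := measurable_cube a l.
rewrite averageE// lee_pdivrMl//.
apply: (@le_trans _ _ (\int[mu]_(z in cube a l) cst c%:E z)).
  apply: (ge0_le_integral mu mQ (fun z _ => g0 z) _ (measurable_cst _) gc).
  exact: measurable_funS mg.
by rewrite integral_cst// lebesgue_cube ?(ltW l0)// muleC.
Qed.

(** This lower bound allows a negative exponent to be replaced by 0 in [exponent_lower_bound]. *)
Lemma Ap_const_ge1 (w : Rn R n -> R) (a : Rn R n) :
  (forall z, cube a 1%R z -> w z = 1%R) -> 1 <= Ap_const p w.
Proof.
move=> w1; have mQ := measurable_cube a 1%R.
have Q1 : mu (cube a 1%R) = 1 by rewrite lebesgue_cube// expr1n.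
have av1 (g : Rn R n -> \bar R) : (forall z, cube a 1%R z -> g z = 1) ->
    average g (cube a 1%R) = 1.
  move=> g1; rewrite averageE ?ltr01// expr1n invr1 mul1e.
  rewrite (eq_integral (cst 1)); last by move=> z; rewrite inE => /g1.
  by rewrite integral_cst// mul1e.
apply: ereal_sup_ubound; exists (cube a 1%R); first by exists a, 1%R; rewrite ltr01.
rewrite !av1 ?poweR1r ?mule1//.
- move=> z /w1 wz; rewrite dual_weightE// wz ?ler01// oner_eq0.
  by rewrite powR1.
- by move=> z /w1 wz; rewrite /= wz.
Qed.

Variables (v : Rn R n -> R) (B : R).
Hypotheses (v_ge1 : forall z, (1 <= v z)%R) (mv : measurable_fun [set: Rn R n] v).
Hypothesis v_A1 : forall a l x, (0 < l)%R -> cube a l x ->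
  \int[mu]_(z in cube a l) (v z)%:E <= (B * v x * l ^+ n)%:E.

Let v_gt0 z : (0 < v z)%R. Proof. exact: lt_le_trans ltr01 (v_ge1 z). Qed.

Lemma A1_average a l : (0 < l)%R -> exists V : R,
  [/\ (0 < V)%R, \int[mu]_(z in cube a l) (v z)%:E = (V * l ^+ n)%:E,
      average (EFin \o v) (cube a l) = V%:E, (0 < B)%R &
      forall z, cube a l z -> (V / B <= v z)%R].
Proof.
move=> l0; have ln0 : (0 < l ^+ n)%R by exact: exprn_gt0.
have mQ := measurable_cube a l.
have Qa : cube a l a by move=> i; rewrite lexx lerDl ltW.
have int1 : (l ^+ n)%:E <= \int[mu]_(z in cube a l) (v z)%:E.
  rewrite -(lebesgue_cube a (ltW l0)) -[leLHS]mul1e -integral_cst//.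
  apply: (ge0_le_integral mu mQ (fun _ _ => lee01) (measurable_cst _)).
    by apply/measurable_EFinP; exact: measurable_funS mv.
  by move=> z _; rewrite lee_fin.
have int0 : 0 <= \int[mu]_(z in cube a l) (v z)%:E.
  by apply: le_trans int1; rewrite lee_fin ltW.
have fin : \int[mu]_(z in cube a l) (v z)%:E \is a fin_num.
  by rewrite ge0_fin_numE//; apply: le_lt_trans (v_A1 l0 Qa) _; exact: ltry.
pose V := (fine (\int[mu]_(z in cube a l) (v z)%:E) / l ^+ n)%R.
have EV : \int[mu]_(z in cube a l) (v z)%:E = (V * l ^+ n)%:E.
  by rewrite /V divfK ?gt_eqF// fineK.
have V1 : (1 <= V)%R.
  by rewrite -(ler_pM2r ln0) mul1r -lee_fin -EV.
have V0 : (0 < V)%R by exact: lt_le_trans ltr01 V1.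
have VB z : cube a l z -> (V <= B * v z)%R.
  by move=> Qz; rewrite -(ler_pM2r ln0) -lee_fin -EV; exact: v_A1.
have B0 : (0 < B)%R.
  by rewrite -(pmulr_lgt0 B (v_gt0 a)); exact: lt_le_trans (VB _ Qa).
exists V; split => //.
- by rewrite averageE// EV -EFinM mulrC mulfK// gt_eqF.
- by move=> z Qz; rewrite ler_pdivrMr// mulrC; exact: VB.
Qed.

(** On a cube with average V one has v >= V / B, so the dual average to the power p - 1 is at most B
    / V. *)
Lemma Ap_A1 : Ap p v /\ Ap_const p v <= B%:E.
Proof.
have p1 := p_gt1; have p10 : (0 < p - 1)%R by lra.
have v0 z : (0 <= v z)%R by exact: ltW.
have H : Ap_const p v <= B%:E.
  apply: ub_ereal_sup => _ [_ [a [l [l0 ->]]] <-].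
  have [V [V0 EV -> B0 VB]] := A1_average a l0.
  have VB0 : (0 < V / B)%R by rewrite divr_gt0.
  have : average (dual_weight p v) (cube a l) <= ((V / B) `^ (- (p - 1)^-1))%:E.
    apply: (average_le l0); [exact: measurable_dual_weight|exact: dual_weight_ge0|].
    move=> z Qz; rewrite dual_weightE// gt_eqF// lee_fin !powRN.
    rewrite lef_pV2 ?posrE ?powR_gt0//; apply: ge0_ler_powR.
    - by rewrite invr_ge0 ltW.
    - by rewrite nnegrE ltW.
    - by rewrite nnegrE.
    - exact: VB.
  move=> /(@ler_poweR _ _ _ (p - 1)%R (ltW p10)) h.
  have {}h := h (average_ge0 a l0 (dual_weight_ge0 p v)).
  apply: (le_trans (lee_wpmul2l _ h)); first by rewrite lee_fin ltW.
  rewrite poweR_EFin -powRrM mulNr mulVf ?gt_eqF// powR_inv1 ?(ltW VB0)//.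
  by rewrite -EFinM invf_div mulrC divfK ?gt_eqF.
split => //; split; last by apply: le_lt_trans H _; exact: ltry.
split => // _ [a [l [l0 ->]]]; have [V [_ -> _ _ _]] := A1_average a l0.
exact: ltry.
Qed.

(** The dual weight of v^(1-p) is v, so the two averages exchange roles. The resulting power B^(p-1)
    is the source of the threshold 1/(p-1). *)
Lemma Ap_A1_dual : Ap p (fun z => v z `^ (1 - p))%R /\
  Ap_const p (fun z => v z `^ (1 - p))%R <= (B `^ (p - 1))%:E.
Proof.
have p1 := p_gt1; have p10 : (0 < p - 1)%R by lra.
pose w z : R := (v z `^ (1 - p))%R; rewrite -/w.
have w0 z : (0 <= w z)%R by exact: powR_ge0.
have mw : measurable_fun [set: Rn R n] w.
  exact: (measurableT_comp (measurable_powR _) mv).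
have dual : dual_weight p w = EFin \o v.
  apply/funext => z; rewrite dual_weightE// gt_eqF ?powR_gt0// /w /= -powRrM.
  rewrite (_ : (1 - p) * - (p - 1)^-1 = 1)%R ?powRr1//; first exact: ltW.
  by field; rewrite gt_eqF.
have mEw : measurable_fun [set: Rn R n] (EFin \o w) by exact/measurable_EFinP.
have H : Ap_const p w <= (B `^ (p - 1))%:E.
  apply: ub_ereal_sup => _ [_ [a [l [l0 ->]]] <-].
  have [V [V0 EV avV B0 VB]] := A1_average a l0; rewrite dual avV.
  have VB0 : (0 < V / B)%R by rewrite divr_gt0.
  have h : average (EFin \o w) (cube a l) <= ((V / B) `^ (1 - p))%:E.
    apply: (average_le l0 mEw) => [z|z Qz]; first by rewrite lee_fin.
    rewrite lee_fin /w (_ : 1 - p = - (p - 1))%R; last by ring.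
    rewrite !powRN lef_pV2 ?posrE ?powR_gt0//; apply: ge0_ler_powR.
    - exact: ltW.
    - by rewrite nnegrE ltW.
    - by rewrite nnegrE ltW.
    - exact: VB.
  rewrite poweR_EFin; apply: (le_trans (lee_wpmul2r _ h)).
    by rewrite lee_fin powR_ge0.
  rewrite -EFinM lee_fin (_ : 1 - p = - (p - 1))%R; last by ring.
  rewrite powRN -[X in (X^-1 * _)%R]mulr1 powRM ?(ltW V0) ?invr_ge0 ?(ltW B0)//.
  rewrite mulr1 invfM mulrAC mulVf ?mul1r ?gt_eqF ?powR_gt0//.
  by rewrite -powRN -[(B^-1)%R]powR_inv1 ?(ltW B0)// -powRrM mulN1r opprK.
split => //; split; last by apply: le_lt_trans H _; exact: ltry.
split => // _ [a [l [l0 ->]]].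
apply: (@le_lt_trans _ _ (l ^+ n)%:E); last exact: ltry.
have mQ := measurable_cube a l.
rewrite -(lebesgue_cube a (ltW l0)) -[leRHS]mul1e -integral_cst//.
apply: (ge0_le_integral mu mQ _ _ (measurable_cst _)).
- by move=> z _; rewrite lee_fin; exact: w0.
- exact: measurable_funS mEw.
- move=> z _; rewrite lee_fin -(powRr0 (v z)); apply: ler_powR => //.
  by rewrite subr_le0 ltW.
Qed.

End A1_weights.

(** * Sharpness *)

Local Close Scope ereal_scope.

(** The left side grows like M^(1/p + tau), the right side like M^(1/p + rho a). The number 9 M
    bounds 1 + 4 (M + M), the A_1 constant of the test weights. *)
Lemma powR_growth_exponent (R : realType) (p kappa c a rho tau : R) :
  0 < p -> 0 < kappa -> 0 <= c ->
  (forall M, (0 < M)%N -> (kappa * M%:R `^ (1 + p * tau)) `^ p^-1 <=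
     c * ((9 * M%:R) `^ rho) `^ a * (9 * M%:R) `^ p^-1) ->
  tau <= rho * a.
Proof.
move=> p0 k0 c0 H; rewrite leNgt; apply/negP => ea.
pose e := tau - rho * a; have e0 : 0 < e by rewrite /e subr_gt0.
pose C := c * 9 `^ (rho * a + p^-1) / kappa `^ p^-1.
have kp0 : 0 < kappa `^ p^-1 by exact: powR_gt0.
have C0 : 0 <= C by rewrite divr_ge0 ?mulr_ge0 ?powR_ge0.
pose M := (Num.truncn (C `^ e^-1)).+1.
have MR : C `^ e^-1 < M%:R by exact: truncnS_gt.
have M0 : 0 < M%:R :> R by rewrite ltr0n.
have CM : C < M%:R `^ e.
  have -> : C = (C `^ e^-1) `^ e by rewrite -powRrM mulVf ?powRr1// gt_eqF.
  by apply: gt0_ltr_powR => //; rewrite nnegrE ?powR_ge0// ltW.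
move: CM; rewrite ltNge => /negP; apply.
rewrite /C ler_pdivlMr//.
have M9 : 0 < 9 * M%:R :> R by rewrite mulr_gt0.
have := H M (ltn0Sn _); rewrite powRM ?(ltW k0) ?powR_ge0// -!powRrM.
rewrite -mulrA -powRD; last by rewrite (gt_eqF M9) implybT.
rewrite powRM ?(ltW M0)// => h.
rewrite -(@ler_pM2r _ (M%:R `^ (rho * a + p^-1))) ?powR_gt0//.
rewrite -[leRHS]mulrA; apply: le_trans h; rewrite mulrAC -powRD; last first.
  by rewrite (gt_eqF M0) implybT.
rewrite mulrC le_eqVlt; apply/orP; left; apply/eqP; congr (_ * _ `^ _).
by rewrite /e; field; rewrite gt_eqF.
Qed.

Local Open Scope ereal_scope.

Section test_functions.
Variables (R : realType) (n : nat) (i0 : 'I_n).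
Local Notation mu := (lebesgue_Rn R n).
Local Notation orig := (Rn_of (fun=> 0%R) : Rn R n).
Local Notation unit_cube := (cube orig 1%R).
Local Notation v := (@strip_weight R n i0).

Definition shell i : set (Rn R n) :=
  slab i0 orig 1%R `](2 ^- i.+1)%R, (2 ^- i)%R]%classic.

Lemma shellP i z : shell i z -> (2 ^- i.+1 < coordinate z i0 <= 2 ^- i)%R /\ unit_cube z.
Proof.
move=> /slabP[]; rewrite /= in_itv/= => /andP[h1 h2] h3; split; first by rewrite h1.
move=> i'; have [->|ii0] := eqVneq i' i0; last by exact: h3.
rewrite coordinate_Rn_of add0r (le_trans h2) ?andbT.
  by apply: ltW; apply: lt_trans h1; exact: half_pow_gt0.
by rewrite invf_le1 ?exprn_gt0// exprn_ege1// ler1n.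
Qed.

Lemma measurable_shell i : measurable (shell i).
Proof. by apply: measurable_slab; exact: measurable_itv. Qed.

Lemma lebesgue_shell i : mu (shell i) = (2 ^- i.+1)%:E.
Proof.
rewrite /shell lebesgue_slab_itv ?expr1n ?mulr1//; last first.
  exact: half_pow_le.
by congr (_%:E); rewrite [X in (X - _)%R](half_powS R i); ring.
Qed.

Lemma shell_uniq i j z : shell i z -> shell j z -> i = j.
Proof.
move=> /shellP[/andP[i1 i2] _] /shellP[/andP[j1 j2] _].
case: (ltngtP i j) => // ij.
- by have := lt_le_trans i1 (le_trans j2 (half_pow_le R ij)); rewrite ltxx.
- by have := lt_le_trans j1 (le_trans i2 (half_pow_le R ij)); rewrite ltxx.
Qed.

Lemma shell_norm i z : shell i z -> (2 ^- i.+1 < `|coordinate z i0| <= 2 ^- i)%R.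
Proof.
move=> /shellP[/andP[h1 h2] _]; rewrite ger0_norm ?h1//.
by apply: ltW; apply: lt_trans h1; exact: half_pow_gt0.
Qed.

Lemma strip_weight_shell m i z : (i <= m)%N -> shell i z -> v m z = (2 ^+ i)%R.
Proof.
move=> im /shell_norm/andP[h1 h2]; apply/eqP; rewrite eq_le.
by rewrite profile_le//= profile_ge.
Qed.

Lemma shell_lower (p : R) (m : nat) (U : Rn R n -> \bar R) (w : Rn R n -> R) (dl om : nat -> R) :
  (0 <= p)%R -> (forall i, 0 <= dl i)%R -> (forall i, 0 <= om i)%R -> (forall z, 0 <= w z)%R ->
  (forall i z, (i < m)%N -> shell i z -> (dl i)%:E <= U z) ->
  (forall i z, (i < m)%N -> shell i z -> (om i <= w z)%R) ->
  (\sum_(i < m) dl i `^ p * om i * 2 ^- i.+1)%R%:E <= \int[mu]_z (`|U z| `^ p * (w z)%:E).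
Proof.
move=> p0 d0 o0 w0 Ud wo.
pose c i := (dl i `^ p * om i)%R.
have c0 i : (0 <= c i)%R by rewrite mulr_ge0 ?powR_ge0.
have m1 i : measurable_fun [set: Rn R n] (fun z => (c i)%:E * (\1_(shell i) z)%:E).
  apply: measurable_funeM; apply/measurable_EFinP; apply: measurable_indic.
  exact: measurable_shell.
have t0 i z : 0 <= (c i)%:E * (\1_(shell i) z)%:E by rewrite mule_ge0// lee_fin.
have -> : (\sum_(i < m) dl i `^ p * om i * 2 ^- i.+1)%R%:E =
    \int[mu]_z (\sum_(i < m) (c i)%:E * (\1_(shell i) z)%:E).
  rewrite (ge0_integral_sum mu measurableT); last 2 first.
  - by move=> i; exact: m1.
  - by move=> i z _; exact: t0.
  rewrite -sumEFin; apply: eq_bigr => i _.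
  rewrite (ge0_integralZl_EFin mu measurableT); last 3 first.
  - by move=> z _; rewrite lee_fin.
  - by apply/measurable_EFinP; apply: measurable_indic; exact: measurable_shell.
  - exact: c0.
  by rewrite (integral_indic mu measurableT (measurable_shell i)) setIT lebesgue_shell.
apply: le_integral_nonmeasurable => z; first by apply: sume_ge0 => i _; exact: t0.
have rhs0 : 0 <= `|U z| `^ p * (w z)%:E by rewrite mule_ge0 ?poweR_ge0// lee_fin.
have [[i iz]|noz] := pselect (exists i : 'I_m, shell i z); last first.
  rewrite big1// => i _; rewrite indicE memNset ?mule0// => iz.
  by apply: noz; exists i.
rewrite (bigD1 i)//= big1 ?adde0 => [|j ji]; last first.
  rewrite indicE memNset ?mule0// => jz.
  by move/eqP: ji; apply; apply/val_inj; exact: shell_uniq jz iz.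
rewrite indicE mem_set// mule1 /c EFinM.
apply: lee_pmul; rewrite ?lee_fin ?powR_ge0//; last exact: wo.
rewrite -poweR_EFin; apply: ler_poweR => //; first by rewrite lee_fin.
by apply: le_trans (Ud _ _ (ltn_ord i) iz) _; exact: lee_abs.
Qed.

Lemma unit_cube_weight m : \int[mu]_(z in unit_cube) (v m z)%:E <= (1 + 4 * m%:R)%:E.
Proof.
pose e : Rn R n := Rn_of (fun=> 1%R).
have Qe : unit_cube e by move=> i; rewrite !coordinate_Rn_of add0r ler01 lexx.
apply: (le_trans (strip_weight_A1 i0 m ltr01 Qe)).
rewrite lee_fin expr1n mulr1; apply: ler_piMr; first by have := ler0n R m; lra.
rewrite /strip_weight coordinate_Rn_of; have := @profile_le R m 0 1 (leq0n m).
by rewrite expr0 normr1; apply; rewrite invf_lt1 ?exprn_gt0// expr1 ltr1n.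
Qed.

(** Corner of a cube of side 2^-j that contains z, touches the face where coordinate i0 is 0 and,
    thanks to the minimum, stays in the unit cube. *)
Definition corner_cube (z : Rn R n) j : Rn R n :=
  Rn_of (fun i => if i == i0 then 0%R else Num.min (coordinate z i) (1 - 2 ^- j)%R).

Lemma corner_cubeP z j : unit_cube z -> (coordinate z i0 <= 2 ^- j)%R ->
  cube (corner_cube z j) (2 ^- j)%R z /\ cube (corner_cube z j) (2 ^- j)%R `<=` unit_cube.
Proof.
move=> zQ zj; have l0 := half_pow_gt0 R j.
have l1 : (2 ^- j <= 1 :> R)%R by rewrite invf_le1 ?exprn_gt0// exprn_ege1// ler1n.
split=> [i|y yQ i].
  have /andP[z0 z1] := zQ i; rewrite !coordinate_Rn_of add0r in z0 z1 *.
  case: eqP => [ei|_]; first by rewrite z0 add0r ei.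
  by rewrite minEle; case: ifPn => h; apply/andP; split; lra.
have /andP[y0 y1] := yQ i; have /andP[z0 z1] := zQ i.
rewrite !coordinate_Rn_of add0r in y0 y1 z0 z1 *.
move: y0 y1; case: eqP => [ei|_]; first by move=> h1 h2; apply/andP; split; lra.
by rewrite minEle; case: ifPn => h h1 h2; apply/andP; split; lra.
Qed.

Lemma slab_in_corner z j (I : set R) :
  I `<=` `[0%R, (2 ^- j)%R]%classic ->
  slab i0 (corner_cube z j) (2 ^- j)%R I `<=` cube (corner_cube z j) (2 ^- j)%R.
Proof.
move=> I01 y /slabP[h1 h2] i; have [ei|ii0] := eqVneq i i0; last exact: h2.
by rewrite coordinate_Rn_of ei eqxx add0r; have := I01 _ h1; rewrite /= in_itv.
Qed.

Lemma cube_maximal_ge (g : Rn R n -> R) z j (c : R) : unit_cube z ->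
  (coordinate z i0 <= 2 ^- j)%R ->
  (c * (2 ^- j) ^+ n)%:E <=
    \int[mu]_(y in cube (corner_cube z j) (2 ^- j)%R) `|g y|%:E ->
  c%:E <= cube_maximal g z.
Proof.
move=> zQ zj h; have l0 := half_pow_gt0 R j.
have [Qz _] := corner_cubeP zQ zj.
apply: (@le_trans _ _ (average (fun y => `|g y|%:E) (cube (corner_cube z j) (2 ^- j)%R))).
  by rewrite averageE// lee_pdivlMl ?exprn_gt0// -EFinM mulrC.
apply: ereal_sup_ubound; exists (cube (corner_cube z j) (2 ^- j)%R) => //.
by split => //; exists (corner_cube z j), (2 ^- j)%R.
Qed.

Lemma half_pow_pred (j : nat) : ((2 ^- j) * (2 ^- j) ^+ n.-1 = (2 ^- j) ^+ n :> R)%R.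
Proof.
have n0 : (0 < n)%N by case: n i0 => // -[].
by rewrite -exprS prednK.
Qed.

(** Shell j fills the half of the corner cube of side 2^-j farther from the face. *)
Lemma cube_maximal_shell (f : Rn R n -> R) i j z : (j <= i)%N -> shell i z ->
  measurable_fun [set: Rn R n] f -> (forall y, shell j y -> f y = 1%R) ->
  (1 / 2)%:E <= cube_maximal f z.
Proof.
move=> ji iz mf fj; have [/andP[_ zi] zQ] := shellP iz.
have zj : (coordinate z i0 <= 2 ^- j)%R by apply: (le_trans zi); exact: half_pow_le.
have l0 := half_pow_gt0 R j.
pose I : set R := `](2 ^- j.+1)%R, (2 ^- j)%R]%classic.
have mS : measurable (slab i0 (corner_cube z j) (2 ^- j)%R I).
  by apply: measurable_slab; exact: measurable_itv.
have sub : slab i0 (corner_cube z j) (2 ^- j)%R I `<=` cube (corner_cube z j) (2 ^- j)%R.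
  apply: slab_in_corner => t; rewrite /I /= !in_itv/= => /andP[t1 ->].
  by rewrite andbT ltW// (lt_trans _ t1)// half_pow_gt0.
apply: (cube_maximal_ge zQ zj).
have mQ := measurable_cube (corner_cube z j) (2 ^- j)%R.
have mEf : measurable_fun [set: Rn R n] (fun y => `|f y|%:E).
  by apply/measurable_EFinP; apply: measurableT_comp.
apply: (@le_trans _ _ (\int[mu]_(y in slab i0 (corner_cube z j) (2 ^- j)%R I) cst 1 y)).
  rewrite integral_cst// mul1e /I lebesgue_slab_itv ?(ltW l0)//; last exact: half_pow_le.
  rewrite lee_fin -half_pow_pred mulrA [X in (_ <= (X - _) * _)%R](half_powS R j).
  by rewrite [X in (_ * X * _ <= _)%R](half_powS R j) le_eqVlt; apply/orP; left; apply/eqP; field.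
apply: (@le_trans _ _ (\int[mu]_(y in slab i0 (corner_cube z j) (2 ^- j)%R I) `|f y|%:E)).
  apply: (ge0_le_integral mu mS (fun _ _ => lee01) (measurable_cst _)).
    exact: measurable_funS mEf.
  move=> y Sy; rewrite fj ?normr1//.
  have [_ sQ] := corner_cubeP zQ zj.
  have yQ := sQ _ (sub _ Sy); have /slabP[h1 _] := Sy.
  by apply/slabP; split => // i' _; exact: yQ.
apply: (ge0_subset_integral mu mS mQ _ _ sub).
  exact: measurable_funS mEf.
by move=> y _; rewrite lee_fin.
Qed.

End test_functions.

Section sharpness.
Variables (R : realType) (n : nat) (i0 : 'I_n) (p q : R).
Hypotheses (p_gt1 : (1 < p)%R) (q_gt1 : (1 < q)%R).
Local Notation mu := (lebesgue_Rn R n).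
Local Notation orig := (Rn_of (fun=> 0%R) : Rn R n).
Local Notation unit_cube := (cube orig 1%R).
Local Notation v := (@strip_weight R n i0).
Local Notation shell := (@shell R n i0).

Lemma vmaximal_ge (f : (Rn R n -> R)^nat) k (c : R) z : (0 <= c)%R ->
  (forall j, (j < k)%N -> c%:E <= cube_maximal (f j) z) ->
  ((k%:R * c `^ q) `^ q^-1)%:E <= vmaximal q f z.
Proof.
move=> c0 fc; have q1 := q_gt1; have q0 : (0 <= q)%R by lra.
rewrite -poweR_EFin; apply: ler_poweR; first by rewrite invr_ge0.
  by rewrite lee_fin mulr_ge0 ?powR_ge0.
apply: (@le_trans _ _ (\sum_(0 <= j < k) cube_maximal (f j) z `^ q)).
  rewrite big_mkord mulr_natl -[k in (_ *+ k)%R]card_ord -sumr_const -sumEFin.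
  apply: lee_sum => j _; rewrite -poweR_EFin; apply: ler_poweR => //.
  exact: fc.
by apply: nneseries_lim_ge => j _ _; exact: poweR_ge0.
Qed.

Lemma vnorm_single (f : (Rn R n -> R)^nat) i z :
  (forall j, j != i -> f j z = 0%R) -> vnorm q f z = `|f i z|%:E.
Proof.
move=> fi; have q1 := q_gt1; have q0 : (0 < q)%R by lra.
rewrite /vnorm (@nneseriesD1 _ _ i predT)//; last by move=> k _; exact: poweR_ge0.
rewrite eseries0 ?adde0; last first.
  by move=> j _ /= ji; rewrite fi// normr0 powR0// gt_eqF.
by rewrite !poweR_EFin -powRrM divff ?powRr1// gt_eqF.
Qed.

Lemma strip_weight_far m z : cube (Rn_of (fun=> 2%R)) 1%R z -> v m z = 1%R.
Proof.
move=> /(_ i0); rewrite coordinate_Rn_of => /andP[h _].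
by apply: profile_far; rewrite (lt_le_trans _ (ler_norm _))// (lt_le_trans _ h)// ltr1n.
Qed.

(** Common frame of both tests: the A_p constant is at most (9 M)^rho, the norm of f at most (9
    M)^(1/p), and tau measures the growth of the maximal function. Truncating at M + M leaves M
    shells that each contribute a full power of M. As the A_p constant is at least 1, a may be
    raised to max(a, 0), which makes its power monotone. *)
Lemma exponent_lower_bound (w : nat -> Rn R n -> R) (f : nat -> (Rn R n -> R)^nat)
    (a c kappa rho tau : R) :
  (forall w f, Ap p w -> (forall j, measurable_fun [set: Rn R n] (f j)) ->
     wLnorm p w (vmaximal q f) <= c%:E * Ap_const p w `^ a * wLnorm p w (vnorm q f)) ->
  (0 < kappa)%R ->
  (forall M j, measurable_fun [set: Rn R n] (f M j)) ->
  (forall M, Ap p (w M) /\ Ap_const p (w M) <= ((1 + 4 * (M + M)%:R) `^ rho)%:E) ->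
  (0 <= rho)%R ->
  (forall M z, cube (Rn_of (fun=> 2%R)) 1%R z -> w M z = 1%R) ->
  (forall M z, 0 <= w M z)%R ->
  (forall M z, `|vnorm q (f M) z| `^ p * (w M z)%:E <=
     (v (M + M) z * \1_unit_cube z)%:E) ->
  (forall M, (kappa * M%:R `^ (1 + p * tau))%:E <=
     \int[mu]_z (`|vmaximal q (f M) z| `^ p * (w M z)%:E)) ->
  (tau <= rho * Num.max a 0)%R.
Proof.
move=> H k0 mf Apw rho0 w1 w0 fw lower.
have p1 := p_gt1; have p0 : (0 < p)%R by lra.
have c0 : (0 <= Num.max c 0)%R by rewrite le_max lexx orbT.
apply: (powR_growth_exponent p0 k0 c0) => M M0.
have [ApM ApB] := Apw M.
have Ap1 : 1 <= Ap_const p (w M) by apply: Ap_const_ge1 => // z; exact: w1.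
have M9 : (1 + 4 * (M + M)%:R <= 9 * M%:R :> R)%R.
  have : (1 <= M%:R :> R)%R by rewrite ler1n.
  by rewrite natrD; lra.
have M90 : (0 <= 1 + 4 * (M + M)%:R :> R)%R by rewrite addr_ge0// mulr_ge0.
have {}M9' : (0 <= 9 * M%:R :> R)%R by apply: le_trans M9.
have {}ApB : Ap_const p (w M) <= ((9 * M%:R) `^ rho)%:E.
  by apply: (le_trans ApB); rewrite lee_fin; apply: ge0_ler_powR.
have upper : wLnorm p (w M) (vnorm q (f M)) <= ((9 * M%:R) `^ p^-1)%:E.
  rewrite -poweR_EFin; apply: ler_poweR; first by rewrite invr_ge0 ltW.
    by apply: integral_ge0 => z _; rewrite mule_ge0 ?poweR_ge0// lee_fin.
  apply: (@le_trans _ _ (\int[mu]_(z in unit_cube) (v (M + M) z)%:E)); last first.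
    by apply: (le_trans (unit_cube_weight R i0 (M + M)%N)); rewrite lee_fin.
  rewrite [leRHS]integral_mkcond; apply: le_integral_nonmeasurable => z.
    by rewrite mule_ge0 ?poweR_ge0// lee_fin.
  apply: (le_trans (fw M z)); rewrite patchE indicE.
  by case: ifPn => _; rewrite ?mulr1 ?mulr0.
have {}lower : ((kappa * M%:R `^ (1 + p * tau)) `^ p^-1)%:E <=
    wLnorm p (w M) (vmaximal q (f M)).
  rewrite -poweR_EFin; apply: ler_poweR; first by rewrite invr_ge0 ltW.
    by rewrite lee_fin mulr_ge0 ?powR_ge0// ltW.
  exact: lower.
rewrite -lee_fin; apply: (le_trans lower); apply: (le_trans (H _ _ ApM (mf M))).
have fin : Ap_const p (w M) \is a fin_num.
  by rewrite ge0_fin_numE ?(le_trans _ Ap1)//; apply: le_lt_trans ApB _; exact: ltry.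
move: Ap1 ApB; rewrite -(fineK fin) !lee_fin; set K := fine _ => K1 KB.
have K0 : (0 <= K)%R by lra.
rewrite poweR_EFin -EFinM [leRHS]EFinM.
apply: (@le_trans _ _ ((Num.max c 0 * ((9 * M%:R) `^ rho) `^ Num.max a 0)%R%:E *
    wLnorm p (w M) (vnorm q (f M)))).
  apply: lee_wpmul2r; first exact: poweR_ge0.
  rewrite lee_fin; apply: (@le_trans _ _ (Num.max c 0 * K `^ a)%R).
    by apply: ler_wpM2r; rewrite ?powR_ge0// le_max lexx.
  apply: ler_wpM2l => //; apply: (@le_trans _ _ (K `^ Num.max a 0)%R).
    by apply: ler_powR => //; rewrite le_max lexx.
  apply: ge0_ler_powR; rewrite ?nnegrE ?powR_ge0//.
  by rewrite le_max lexx orbT.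
by apply: lee_wpmul2l => //; rewrite lee_fin mulr_ge0 ?powR_ge0.
Qed.

(* Test family for the exponent 1/q: the weight is v and f_j is the indicator
   of the j-th shell. *)
Lemma shell_indicators_test (a c : R) :
  (forall w f, Ap p w -> (forall j, measurable_fun [set: Rn R n] (f j)) ->
     wLnorm p w (vmaximal q f) <= c%:E * Ap_const p w `^ a * wLnorm p w (vnorm q f)) ->
  (q^-1 <= Num.max a 0)%R.
Proof.
move=> H; rewrite -[leRHS]mul1r; have p1 := p_gt1; have q1 := q_gt1.
have p0 : (0 < p)%R by lra.
have q0 : (0 < q)%R by lra.
pose f M j : Rn R n -> R := if (j < M + M)%N then \1_(shell j) else cst 0%R.
pose kappa : R := (1 / 2 * (1 / 2) `^ p)%R.
have v1 m z : (1 <= v m z)%R by exact: profile_ge1.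
have v0 m z : (0 <= v m z)%R by exact: le_trans (v1 m z).
apply: (exponent_lower_bound (w := fun M => v (M + M)) (f := f) (kappa := kappa) H).
- by rewrite /kappa mulr_gt0// powR_gt0.
- move=> M j; rewrite /f; case: ifP => _; last exact: measurable_cst.
  by apply: measurable_indic; exact: measurable_shell.
- move=> M; rewrite powRr1; last by rewrite addr_ge0// mulr_ge0.
  apply: (Ap_A1 p_gt1 (v1 _) (@measurable_strip_weight R n i0 _)).
  by move=> b l x l0 Qx; exact: strip_weight_A1.
- exact: ler01.
- by move=> M z; exact: strip_weight_far.
- by move=> M z; exact: v0.
- move=> M z.
  have [i fi] : exists i, forall j, j != i -> f M j z = 0%R.
    have [[i iz]|noz] := pselect (exists i, shell i z).
      exists i => j ji; rewrite /f; case: ifP => // _; rewrite indicE memNset// => jz.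
      by move/eqP: ji; apply; exact: shell_uniq jz iz.
    exists 0%N => j _; rewrite /f; case: ifP => // _; rewrite indicE memNset// => jz.
    by apply: noz; exists j.
  rewrite (vnorm_single fi) abse_EFin normr_id poweR_EFin -EFinM lee_fin mulrC.
  apply: ler_wpM2l => //; rewrite /f; case: ifP => _; last first.
    by rewrite normr0 powR0 ?gt_eqF.
  rewrite !indicE; case: (boolP (z \in shell i)) => [|_]; last first.
    by rewrite normr0 powR0 ?gt_eqF.
  by rewrite inE => /shellP[_ zQ]; rewrite mem_set// normr1 powR1.
move=> M; set m := (M + M)%N.
(* On shell i the maximal functions of the indicators of shells 0 to i are all at least 1/2. *)
pose dl i : R := ((i.+1%:R * (1 / 2) `^ q) `^ q^-1)%R.
have := @shell_lower R n i0 p m (vmaximal q (f M)) (v m) dl (fun i => 2 ^+ i)%R.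
move=> h; apply: le_trans (h (ltW p0) _ _ _ _ _); last 5 first.
- by move=> i; exact: powR_ge0.
- by move=> i; exact: exprn_ge0.
- by [].
- move=> i z im iz; apply: vmaximal_ge => // j ji.
  have jm : (j < m)%N by exact: leq_trans im.
  apply: (cube_maximal_shell (ltnSE ji) iz).
    rewrite /f jm; apply: measurable_indic; exact: measurable_shell.
  by move=> y jy; rewrite /f jm indicE mem_set.
- by move=> i z im iz; rewrite (strip_weight_shell (ltnW im) iz).
rewrite lee_fin.
have -> : (\sum_(i < m) dl i `^ p * 2 ^+ i * 2 ^- i.+1 =
    \sum_(i < m) kappa * i.+1%:R `^ (p / q))%R.
  apply: eq_bigr => i _; rewrite /dl powRM ?powR_ge0// -powRrM divff ?gt_eqF// powRr1//.
  rewrite -mulrA exprS invfM (mulrCA (2 ^+ i)%R) divff ?expf_neq0// mulr1.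
  rewrite powRM ?powR_ge0// -powRrM (mulrC q^-1%R) /kappa; ring.
(* Only the shells from M to 2 M - 1 are kept; there i + 1 >= M. *)
rewrite /m big_split_ord/= -[leLHS]add0r; apply: lerD.
  by apply: sumr_ge0 => i _; rewrite mulr_ge0 ?powR_ge0// /kappa mulr_ge0 ?powR_ge0.
have [->|M0] := posnP M.
  by rewrite powR0 ?mulr0 ?big_ord0// gt_eqF// addr_gt0// divr_gt0.
have M0R : (M%:R != 0 :> R)%R by rewrite pnatr_eq0 -lt0n.
rewrite powRD ?M0R ?implybT// powRr1// mulrCA mulr_natl -[X in (_ *+ X)%R]card_ord -sumr_const.
apply: ler_sum => i _; apply: ler_wpM2l; first by rewrite /kappa mulr_ge0 ?powR_ge0.
apply: ge0_ler_powR; rewrite ?nnegrE//; first by rewrite divr_ge0 ?ltW.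
by rewrite ler_nat -addnS leq_addr.
Qed.

(** All strips with i <= k < m contribute equally, since the density 2^k cancels the width 2^-(k+1)
    up to 1/2. The factor m - i is the logarithmic divergence of the integral of 1/|t|. *)
Lemma corner_weight m i z : (i <= m)%N -> unit_cube z -> (coordinate z i0 <= 2 ^- i)%R ->
  ((m - i)%:R * (1 / 2) * 2 ^+ i * (2 ^- i) ^+ n)%R%:E <=
    \int[mu]_(y in cube (corner_cube i0 z i) (2 ^- i)%R) (v m y)%:E.
Proof.
move=> im zQ zi; have l0 := half_pow_gt0 R i; have l0' := ltW l0.
rewrite integral_strip_weight//.
apply: (@le_trans _ _ (\sum_(k < m) (if (i <= k)%N then 1 / 2 * (2 ^- i) ^+ n.-1 else 0)%R%:E)).
  rewrite sumEFin lee_fin -big_mkcond/= sumr_const -(half_pow_pred R i0).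
  have -> : #|[pred k : 'I_m | (i <= k)%N]| = (m - i)%N.
    rewrite -sum1_card -(big_mkord (fun k => i <= k)%N (fun=> 1%N)).
    rewrite (@big_cat_nat _ _ _ i)//= big_nat_cond big_pred0 ?add0n; last first.
      by move=> k; rewrite leq0n /=; lia.
    rewrite big_nat_cond (eq_bigl (fun k => (i <= k < m)%N)); last by move=> k; lia.
    by rewrite -big_nat sum_nat_const_nat muln1.
  rewrite -mulr_natl le_eqVlt; apply/orP; left; apply/eqP.
  by field; rewrite expf_neq0.
rewrite -[leLHS]add0e; apply: leeD; first by rewrite lee_fin exprn_ge0.
apply: lee_sum => k _; case: ifPn => [ik|_]; last first.
  by rewrite mule_ge0// lee_fin exprn_ge0.
pose I : set R := `[0%R, (2 ^- k.+1)%R]%classic.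
have d0 := half_pow_gt0 R k.+1.
have -> : (1 / 2 * (2 ^- i) ^+ n.-1)%R%:E =
    (2 ^+ k)%:E * mu (slab i0 (corner_cube i0 z i) (2 ^- i)%R I).
  rewrite /I lebesgue_slab_itv ?(ltW d0)// -EFinM; congr (_%:E).
  by rewrite subr0 mulrA exprS invfM mulrCA divff ?expf_neq0// mulr1 div1r.
apply: lee_wpmul2l; first by rewrite lee_fin exprn_ge0.
apply: le_measure; rewrite ?inE.
- by apply: measurable_slab; exact: measurable_itv.
- by apply: measurableI; [exact: measurable_cube|exact: measurable_strip].
move=> y Sy; split.
  apply: slab_in_corner Sy => t; rewrite /I /= !in_itv/= => /andP[-> t2]/=.
  by apply: (le_trans t2); apply: half_pow_le; exact: leqW.
have /slabP[+ _] := Sy; rewrite /I /strip /= in_itv/= => /andP[y0 y1].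
by rewrite ger0_norm.
Qed.

(* Test family for the exponent 1/(p - 1): the weight is v^(1 - p) and f_0 is
   v on the unit cube. *)
Lemma dual_strip_test (a c : R) :
  (forall w f, Ap p w -> (forall j, measurable_fun [set: Rn R n] (f j)) ->
     wLnorm p w (vmaximal q f) <= c%:E * Ap_const p w `^ a * wLnorm p w (vnorm q f)) ->
  ((p - 1)^-1 <= Num.max a 0)%R.
Proof.
move=> H; have p1 := p_gt1; have q1 := q_gt1.
have p0 : (0 < p)%R by lra.
have q0 : (0 < q)%R by lra.
have p10 : (0 < p - 1)%R by lra.
(* The goal becomes 1 <= (p - 1) max(a, 0), the case tau = 1 and rho = p - 1. *)
rewrite -[leLHS]mul1r ler_pdivrMr// mulrC.
have v1 m z : (1 <= v m z)%R by exact: profile_ge1.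
have v0 m z : (0 < v m z)%R by exact: lt_le_trans (v1 m z).
pose w M z : R := (v (M + M) z `^ (1 - p))%R.
pose f M j : Rn R n -> R :=
  if j is 0%N then (fun z => v (M + M) z * \1_unit_cube z)%R else cst 0%R.
pose kappa : R := (1 / 2 * (1 / 2) `^ p)%R.
have mQ : measurable unit_cube by exact: measurable_cube.
have mf M j : measurable_fun [set: Rn R n] (f M j).
  case: j => [|j]; last exact: measurable_cst.
  apply: measurable_funM; first exact: measurable_strip_weight.
  exact: measurable_indic.
apply: (exponent_lower_bound (w := w) (f := f) (kappa := kappa) H).
- by rewrite /kappa mulr_gt0// powR_gt0.
- exact: mf.
- move=> M; apply: (Ap_A1_dual p_gt1 (v1 _) (@measurable_strip_weight R n i0 _)).
  by move=> b l x l0 Qx; exact: strip_weight_A1.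
- exact: ltW.
- by move=> M z /strip_weight_far h; rewrite /w h powR1.
- by move=> M z; exact: powR_ge0.
- move=> M z; rewrite (@vnorm_single (f M) 0%N); last by case.
  rewrite abse_EFin normr_id poweR_EFin -EFinM lee_fin /f.
  rewrite indicE; case: (z \in unit_cube) => /=; last first.
    by rewrite !mulr0 normr0 powR0 ?gt_eqF// mul0r.
  rewrite !mulr1 ger0_norm ?(ltW (v0 _ _))// /w -powRD; last first.
    by rewrite (gt_eqF (v0 _ _)) implybT.
  by rewrite addrCA subrr addr0 powRr1// ltW.
move=> M; set m := (M + M)%N.
pose dl i : R := ((m - i)%:R * (1 / 2) * 2 ^+ i)%R.
have dl0 i : (0 <= dl i)%R by rewrite !mulr_ge0// exprn_ge0.
have := @shell_lower R n i0 p m (vmaximal q (f M)) (w M) dl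
  (fun i => (2 ^+ i) `^ (1 - p))%R.
move=> h; apply: le_trans (h (ltW p0) _ _ _ _ _); last 5 first.
- exact: dl0.
- by move=> i; exact: powR_ge0.
- by move=> z; exact: powR_ge0.
- move=> i z im iz; have [/andP[_ zi] zQ] := shellP iz.
  have := @vmaximal_ge (f M) 1 (dl i) z (dl0 i).
  rewrite mul1r -powRrM divff ?gt_eqF// powRr1//; apply => -[|//] _.
  apply: (cube_maximal_ge zQ zi); apply: (le_trans (corner_weight (ltnW im) zQ zi)).
  rewrite le_eqVlt; apply/orP; left; apply/eqP; apply: eq_integral => y; rewrite inE => yQ.
  have [_ sQ] := corner_cubeP zQ zi.
  by rewrite /f indicE mem_set ?mulr1 ?ger0_norm// ?ltW//; exact: sQ.
- by move=> i z im iz; rewrite /w (strip_weight_shell (ltnW im) iz).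
rewrite lee_fin mulr1.
(* All powers of 2^i cancel, so only the logarithmic factor m - i remains. *)
have -> : (\sum_(i < m) dl i `^ p * (2 ^+ i) `^ (1 - p) * 2 ^- i.+1 =
    \sum_(i < m) kappa * (m - i)%:R `^ p)%R.
  apply: eq_bigr => i _; rewrite /dl.
  have e0 : (0 <= 2 ^+ i :> R)%R by rewrite exprn_ge0.
  rewrite powRM// ?mulr_ge0// powRM// -[X in (X * _)%R]mulrA -powRD; last first.
    by rewrite expf_neq0 ?implybT.
  rewrite addrCA subrr addr0 powRr1// exprS invfM -mulrA (mulrCA (2 ^+ i)%R).
  by rewrite divff ?expf_neq0// mulr1 /kappa; ring.
(* Here the shells i < M are kept, where m - i >= M. *)
rewrite /m big_split_ord/= -[leLHS]addr0; apply: lerD; last first.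
  by apply: sumr_ge0 => i _; rewrite mulr_ge0 ?powR_ge0// /kappa mulr_ge0 ?powR_ge0.
have [->|M0] := posnP M.
  by rewrite powR0 ?mulr0 ?big_ord0// gt_eqF// addr_gt0.
have M0R : (M%:R != 0 :> R)%R by rewrite pnatr_eq0 -lt0n.
rewrite powRD ?M0R ?implybT// powRr1// mulrCA mulr_natl -[X in (_ *+ X)%R]card_ord -sumr_const.
apply: ler_sum => i _; apply: ler_wpM2l; first by rewrite /kappa mulr_ge0 ?powR_ge0.
apply: ge0_ler_powR; rewrite ?nnegrE//; first exact: ltW.
by rewrite ler_nat; move: (ltn_ord i); clear; lia.
Qed.

(** Both thresholds are positive, so a lower bound for max(a, 0) is one for a itself. *)
Lemma sharp_exponent (a : R) : (a < Num.max (q^-1) ((p - 1)^-1))%R ->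
  ~ exists c : R, forall w f,
    Ap p w -> (forall j, measurable_fun [set: Rn R n] (f j)) ->
    wLnorm p w (vmaximal q f) <= c%:E * Ap_const p w `^ a * wLnorm p w (vnorm q f).
Proof.
have p1 := p_gt1; have q1 := q_gt1.
move=> am [c H]; have := shell_indicators_test H; have := dual_strip_test H.
move: am; have : (0 < q^-1)%R by rewrite invr_gt0; lra.
have : (0 < (p - 1)^-1)%R by rewrite invr_gt0; lra.
by rewrite !maxEle; do !case: ifPn => ?; move=> *; lra.
Qed.

End sharpness.

Theorem corollary4p3 (R : realType) (n : nat) (p q : R)
    (n_gt0 : (0 < n)%N) (q_gt1 : (1 < q)%R) (p_gt1 : (1 < p)%R) :
  (exists c : R,
    forall (w : Rn R n -> R) (f : (Rn R n -> R)^nat),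
      Ap p w -> (forall j, measurable_fun [set: Rn R n] (f j)) ->
      wLnorm p w (vmaximal q f) <=
        c%:E * Ap_const p w `^ (Num.max (q^-1) ((p - 1)^-1))%R
        * wLnorm p w (vnorm q f)) /\
  (forall a : R, (a < Num.max (q^-1) ((p - 1)^-1))%R ->
    ~ exists c : R,
      forall (w : Rn R n -> R) (f : (Rn R n -> R)^nat),
        Ap p w -> (forall j, measurable_fun [set: Rn R n] (f j)) ->
        wLnorm p w (vmaximal q f) <=
          c%:E * Ap_const p w `^ a * wLnorm p w (vnorm q f)).
Proof.
split; first exact: upper_estimate.
by move=> a; exact: (sharp_exponent (Ordinal n_gt0)).
Qed.
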